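(* Let $N\ge1$, $q>1$, $T\in(0,\infty]$, $\Omega$ a domain in $\mathbb{R}^N$, $Q_{\Omega,T}=\Omega\times(0,T)$. For any nonnegative weak solution $u$ of $u_t-\Delta u+|\nabla u|^q=0$ in $Q_{\Omega,T}$, the following conditions are equivalent: (i) $u\in L^\infty_{loc}([0,T);L^1_{loc}(\Omega))$; (ii) $\nabla u\in L^q_{loc}(\Omega\times[0,T))$; (iii) $u(\cdot,t)$ converges weak$^*$, as $t\to0$, to some nonnegative Radon measure $u_0$ in $\Omega$, i.e. $\lim_{t\to0}\int_\Omega u(\cdot,t)\varphi\,dx=\int_\Omega\varphi\,du_0$ for all $\varphi\in C_c(\Omega)$. And then for any $\tau\in(0,T)$ and any $\varphi\in C^1_c(\Omega\times[0,T))$, $$\int_\Omega u(\cdot,\tau)\varphi(\cdot,\tau)\,dx+\int_0^\tau\int_\Omega(-u\varphi_t+\nabla u\cdot\nabla\varphi+|\nabla u|^q\varphi)\,dx\,dt=\int_\Omega\varphi(\cdot,0)\,du_0 .$$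
   Context: A nonnegative weak solution of $u_t-\Delta u+|\nabla u|^q=0$ in $Q_{\Omega,T}$ is a nonnegative $u\in L^1_{loc}(Q_{\Omega,T})$ with $|\nabla u|^q\in L^1_{loc}(Q_{\Omega,T})$ such that $\int_0^T\int_\Omega(-u\varphi_t-u\Delta\varphi+|\nabla u|^q\varphi)\,dx\,dt=0$ for all $\varphi\in\mathcal{D}(Q_{\Omega,T})$. Such $u$ belongs to $C((0,T);L^1_{loc}(\Omega))$ (after modification on a null set), and $u(\cdot,t)$ refers to this representative. The space in (i) consists of functions in $L^\infty((0,\tau);L^1(\omega))$ for all $\tau\in(0,T)$, $\omega\subset\subset\Omega$. *)

(* Defs.v *)
From HB Require Import structures.
From mathcomp Require Import all_boot all_order all_algebra.
From mathcomp Require Import all_classical all_reals all_analysis.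
From mathcomp Require Import measurable_realfun.
Set Implicit Arguments.
Unset Strict Implicit.
Unset Printing Implicit Defensive.
Import Order.TTheory GRing.Theory Num.Theory.
Import numFieldNormedType.Exports.
Local Open Scope classical_set_scope.
Local Open Scope ring_scope.

Definition rV_display : measure_display. Proof. exact. Qed.

Section rV_borel.
Context {R : realType} {n : nat}.
Local Notation B := (<<s @open 'rV[R]_n >>).
Let B0 : B set0. Proof. exact: sigma_algebra0. Qed.
Let BC A : B A -> B (~` A). Proof. exact: sigma_algebraC. Qed.
Let BU (F : (set 'rV[R]_n)^nat) : (forall i, B (F i)) -> B (\bigcup_i F i).
Proof. exact: sigma_algebra_bigcup. Qed.
HB.instance Definition _ := @isMeasurable.Build rV_display 'rV[R]_n B B0 BC BU.
End rV_borel.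

Section rV_measurability.
Context {R : realType} {n : nat}.
Local Notation T := (measurableTypeR R * 'rV[R]_n)%type.

Let rat_ball (q : rat * 'rV[rat]_n * nat) : set T :=
  (ball (ratr q.1.1 : R) q.2.+1%:R^-1) `*`
  (ball (map_mx ratr q.1.2 : 'rV[R]_n) q.2.+1%:R^-1).

Lemma open_rV_measurable (U : set 'rV[R]_n) : open U -> measurable U.
Proof. exact: sub_sigma_algebra. Qed.

Lemma open_prod_rV_measurable (U : set (R * 'rV[R]_n)) :
  open U -> measurable (U : set T).
Proof.
move=> oU; rewrite (_ : U = \bigcup_q (if `[< rat_ball q `<=` U >] then rat_ball q
                                      else set0)).
  apply: countable_bigcupT_measurable => [|q]; first exact: countableP.
  case: ifPn => // _; apply: measurableX.
    by apply: open_measurable; exact: ball_open.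
  by apply: open_rV_measurable; exact: ball_open.
apply/seteqP; split => [[x v] Uxv|p [q _]]; last first.
  by case: ifPn => // /asboolP; apply.
have /nbhs_ballP[e /= e0 eU] : nbhs (x, v) U by exact: open_nbhs_nbhs.
have [k ke] : exists k : nat, k.+1%:R^-1 + k.+1%:R^-1 < e.
  exists (Num.trunc (2 / e)).
  rewrite -mulr2n -[ltLHS]mulr_natl ltr_pdivrMr// mulrC -ltr_pdivrMr//.
  exact: truncnS_gt.
have k0 : 0 < k.+1%:R^-1 :> R by rewrite invr_gt0.
have rat_approx (y : R) : exists q : rat, ball y k.+1%:R^-1 (ratr q).
  have [|_ [/[swap] -[q _ <-] yq]] := @dense_rat R _ _ (ball_open y k.+1%:R^-1).
    by exists y; exact: ballxx.
  by exists q.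
have [q xq] := rat_approx x.
have /choice[w vw] := fun i => rat_approx (v ord0 i).
exists (q, \row_i w i, k) => //.
have vq : ball v k.+1%:R^-1 (map_mx ratr (\row_i w i) : 'rV[R]_n).
  by split=> // i j; rewrite !mxE ord1.
have incl : rat_ball (q, \row_i w i, k) `<=` U.
  move=> [y z] [/= qy wz]; apply: eU; split => /=.
    exact: le_ball (ltW ke) _ (ball_triangle xq qy).
  exact: le_ball (ltW ke) _ (ball_triangle vq wz).
case: ifPn => [_|/asboolPn//].
split => /=; first exact: ball_sym.
exact: ball_sym.
Qed.

Lemma measurable_coord i :
  measurable_fun setT (fun v : 'rV[R]_n => v ord0 i : measurableTypeR R).
Proof.
apply: (@measurability _ _ _ _ setT _ _ (RGenOpens.measurableE R)).
move=> _ [_ [a [b ->]] <-]; rewrite setTI; apply: open_rV_measurable.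
by apply: open_comp => [v _|]; [exact: coord_continuous|exact: interval_open].
Qed.

End rV_measurability.

Section rV_cons.
Context {R : realType} {n : nat}.

Definition rV_cons (p : measurableTypeR R * 'rV[R]_n) : 'rV[R]_n.+1 :=
  row_mx (const_mx p.1 : 'rV_1) p.2.

Lemma rV_cons0 p : rV_cons p ord0 ord0 = p.1.
Proof.
rewrite /rV_cons mxE; case: splitP => [i _|[]//]; exact: mxE.
Qed.

Lemma rV_consS p i : rV_cons p ord0 (lift ord0 i) = p.2 ord0 i.
Proof.
rewrite /rV_cons mxE; case: splitP => [[[]]//|j /= ij].
by congr (p.2 _ _); apply: val_inj; move: ij => /= [].
Qed.

Lemma measurable_rV_cons : measurable_fun setT rV_cons.
Proof.
apply: (@measurability _ _ _ _ setT rV_cons (@open 'rV[R]_n.+1) erefl) => _ [U oU <-].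
rewrite setTI; apply: open_prod_rV_measurable.
rewrite openE => -[x v] /= Uxv.
have /nbhs_ballP[e /= e0 eU] : nbhs (rV_cons (x, v)) U by exact: open_nbhs_nbhs.
apply/nbhs_ballP; exists e => //= -[y w] [/= xy [_ vw]]; apply: eU; split=> // i j.
rewrite ord1; case: (unliftP ord0 j) => [j' ->|->].
  by rewrite !rV_consS; exact: vw.
by rewrite !rV_cons0.
Qed.

Definition rV_uncons (v : 'rV[R]_n.+1) : measurableTypeR R * 'rV[R]_n :=
  (v ord0 ord0, \row_i v ord0 (lift ord0 i)).

Lemma rV_consK : cancel rV_cons rV_uncons.
Proof.
case=> x v; rewrite /rV_uncons rV_cons0; congr pair.
by apply/rowP => i; rewrite mxE rV_consS.
Qed.

Lemma measurable_rV_uncons : measurable_fun setT rV_uncons.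
Proof.
apply: measurable_fun_pair.
  exact: measurable_coord.
apply: (@measurability _ _ _ _ setT _ (@open 'rV[R]_n) erefl) => _ [U oU <-].
rewrite setTI; apply: open_rV_measurable; apply: open_comp => // v _ /=.
move=> B /nbhs_ballP[e /= e0 eB]; apply/nbhs_ballP; exists e => //= w [_ vw].
by apply: eB; split=> // i j; rewrite !mxE; exact: vw.
Qed.

End rV_cons.

Section lebesgue_rV.
Context {R : realType}.
Local Open Scope ereal_scope.

Section cons_measure.
Context {n : nat} (m : {sigma_finite_measure set 'rV[R]_n -> \bar R}).

Definition cons_measure : set 'rV[R]_n.+1 -> \bar R :=
  pushforward (@lebesgue_measure R \x m) rV_cons.

Let cons_measure0 : cons_measure set0 = 0.
Proof. by rewrite /cons_measure /pushforward preimage_set0 measure0. Qed.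

Let cons_measure_ge0 A : 0 <= cons_measure A.
Proof. by rewrite /cons_measure /pushforward measure_ge0. Qed.

Let cons_measure_sigma_additive : semi_sigma_additive cons_measure.
Proof.
by apply: measure_semi_sigma_additive; exact: measurable_rV_cons.
Qed.

HB.instance Definition _ := isMeasure.Build _ _ _ cons_measure
  cons_measure0 cons_measure_ge0 cons_measure_sigma_additive.

Let cons_measure_sigma_finite : sigma_finite setT cons_measure.
Proof.
have /sigma_finiteP[F [TF ndF Foo]] := sigma_finiteT (@lebesgue_measure R).
have /sigma_finiteP[G [TG ndG Goo]] := sigma_finiteT m.
exists (fun k => rV_uncons @^-1` (F k `*` G k)).
  rewrite -preimage_bigcup (_ : \bigcup_k _ = setT) ?preimage_setT//.
  rewrite -setXTT TF TG predeqE => -[x y]; split=> [[k _ []/= ? ?]|].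
    by split; exists k.
  move=> [/= [k _ Fkx] [l _ Gly]]; exists (maxn k l) => //; split.
    by move: x Fkx; exact/subsetPset/ndF/leq_maxl.
  by move: y Gly; exact/subsetPset/ndG/leq_maxr.
move=> k; have [mF Fk] := Foo k; have [mG Gk] := Goo k.
have mFG : measurable (F k `*` G k) by exact: measurableX.
split.
  by rewrite -[X in measurable X]setTI; exact: measurable_rV_uncons.
rewrite /cons_measure /pushforward (_ : _ @^-1` _ = F k `*` G k).
  by rewrite product_measure1E// lte_mul_pinfty// ge0_fin_numE.
by apply/seteqP; split => p; rewrite /preimage /mkset rV_consK.
Qed.

HB.instance Definition _ := Measure_isSigmaFinite.Build _ _ _ cons_measure
  cons_measure_sigma_finite.

End cons_measure.

(* n-dimensional Lebesgue measure, by iterated products along the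
   identification 'rV_n.+1 = R * 'rV_n; see lebesgue_rV_box *)
Fixpoint lebesgue_rV (n : nat) : {sigma_finite_measure set 'rV[R]_n -> \bar R} :=
  if n is n'.+1 then cons_measure (lebesgue_rV n') else @dirac _ 'rV[R]_0 0%R R.

End lebesgue_rV.
Arguments lebesgue_rV {R} n.

Lemma lebesgue_rV_box (R : realType) n (a b : 'rV[R]_n) :
  (forall i, a 0 i <= b 0 i) ->
  lebesgue_rV n [set x | forall i, x 0 i \in `]a 0 i, b 0 i]] =
  (\prod_i (b 0 i - a 0 i))%:E.
Proof.
elim: n a b => [|n IH] a b ab.
  by rewrite big_ord0 /= diracE mem_set// => -[].
rewrite big_ord_recl/= /cons_measure /pushforward.
pose A : set (measurableTypeR R) := `]a 0 0, b 0 0]%classic.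
pose a' := \row_i a 0 (lift 0 i); pose b' := \row_i b 0 (lift 0 i).
pose B := [set x : 'rV[R]_n | forall i, x 0 i \in `]a' 0 i, b' 0 i]].
have mB : measurable B.
  rewrite (_ : B = \bigcap_i ((fun x : 'rV[R]_n => x 0 i) @^-1`
    `]a' 0 i, b' 0 i]%classic)); last first.
    by apply/seteqP; split=> x /= => [Bx i _|Bx i]; exact: Bx.
  apply: fin_bigcap_measurable => // i _.
  by rewrite -[X in measurable X]setTI; exact: measurable_coord.
rewrite (_ : _ @^-1` _ = A `*` B).
  rewrite product_measure1E//=; last exact: measurable_itv.
  rewrite [X in (_ * X)%E](_ : _ =
      (\prod_i (b' 0 i - a' 0 i))%:E); last by apply: IH => i; rewrite !mxE.
  rewrite lebesgue_measure_itv/= lte_fin EFinM; congr (_ * _)%E.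
    case: ltP => //; rewrite le_eqVlt ltNge ab orbF => /eqP ->.
    by rewrite subrr.
  by congr EFin; apply: eq_bigr => i _; rewrite !mxE.
apply/seteqP; split=> [[x v] h|[x v] [/= Ax Bv] i].
  split=> [|i] /=; first by have := h 0; rewrite rV_cons0.
  by have := h (lift 0 i); rewrite rV_consS !mxE.
case: (unliftP 0 i) => [j ->|->]; last by rewrite rV_cons0.
by rewrite rV_consS; have := Bv j; rewrite !mxE.
Qed.

Section cylinder.
Context {R : realType} {N : nat}.
Implicit Types (Omega : set 'rV[R]_N) (T : \bar R).

(* points of space-time are pairs (x, t); R carries the measurable structure
   measurableTypeR on which the library defines lebesgue_measure *)
Definition lebesgue_xt :
    {measure set ('rV[R]_N * measurableTypeR R)%type -> \bar R} :=
  (lebesgue_rV N \x lebesgue_measure)%E.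

Definition domain Omega := [/\ open Omega, connected Omega & Omega !=set0].

Definition cylinder Omega T : set ('rV[R]_N * R) :=
  [set p | [/\ Omega p.1, 0 < p.2 & (p.2%:E < T)%E]].

Definition cylinder0 Omega T : set ('rV[R]_N * R) :=
  [set p | [/\ Omega p.1, 0 <= p.2 & (p.2%:E < T)%E]].

Definition compactly_contained (omega Omega : set 'rV[R]_N) :=
  [/\ open omega, compact (closure omega) & closure omega `<=` Omega].

End cylinder.

Section test_functions.
Context {R : realType}.

Definition compact_support_in {E : normedModType R} (A : set E) (f : E -> R) :=
  compact (closure [set x | f x != 0]) /\ closure [set x | f x != 0] `<=` A.

(* f is of class C^k on a finite-dimensional E *)
Fixpoint Ck {E : normedModType R} (k : nat) (f : E -> R) : Prop :=
  if k is k'.+1 then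
    (forall x, differentiable f x) /\ (forall v, Ck k' (fun x => 'D_v f x))
  else continuous f.

(* For A open, functions with compact support in A are represented by their
   extension by 0 to the whole space. *)
Definition Cc {E : normedModType R} (A : set E) (f : E -> R) :=
  continuous f /\ compact_support_in A f.

Definition Cc_infty {E : normedModType R} (A : set E) (f : E -> R) :=
  (forall k, Ck k f) /\ compact_support_in A f.

(* C^1_c(Omega * [0, T)): class C^1 up to t = 0, i.e. the first derivatives
   taken for t > 0 extend continuously to t = 0. Only the values of phi on
   Omega * [0, T) matter. *)
Definition C1c_cylinder0 {N : nat} (Omega : set 'rV[R]_N) (T : \bar R)
    (phi : 'rV[R]_N * R -> R) :=
  [/\ {within cylinder0 Omega T, continuous phi},
      forall p, cylinder Omega T p -> differentiable phi p,
      forall v, exists2 g : 'rV[R]_N * R -> R,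
        {within cylinder0 Omega T, continuous g} &
        forall p, cylinder Omega T p -> 'D_v phi p = g p &
      exists K, [/\ compact K, K `<=` cylinder0 Omega T &
        forall p, cylinder0 Omega T p -> ~ K p -> phi p = 0]].

End test_functions.

Section differential_operators.
Context {R : realType} {N : nat}.
Implicit Types (f : 'rV[R]_N * R -> R) (p : 'rV[R]_N * R).

Definition dt f p : R := 'D_((0, 1) : 'rV[R]_N * R) f p.

Definition dx (i : 'I_N) f p : R :=
  'D_((delta_mx 0 i, 0) : 'rV[R]_N * R) f p.

Definition laplacian f p : R := \sum_i dx i (dx i f) p.

Definition dotprod (v w : 'rV[R]_N) : R := \sum_i v 0 i * w 0 i.

(* the library norm on 'rV[R]_N is the sup norm *)
Definition enorm (v : 'rV[R]_N) : R := Num.sqrt (dotprod v v).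

Definition grad f p : 'rV[R]_N := \row_i dx i f p.

End differential_operators.

Section weak_solutions.
Context {R : realType} {N : nat}.
Variables (Omega : set 'rV[R]_N) (T : \bar R) (q : R).
Local Notation Q := (cylinder Omega T).
Implicit Types (u : 'rV[R]_N * R -> R) (Du : 'rV[R]_N * R -> 'rV[R]_N).

Definition L1loc (A : set ('rV[R]_N * R)) (f : 'rV[R]_N * R -> R) :=
  forall K, compact K -> K `<=` A -> lebesgue_xt.-integrable K (EFin \o f).

(* Du is the distributional gradient of u in x *)
Definition weak_gradient u Du :=
  forall i, L1loc Q (fun p => Du p 0 i) /\
    forall phi, Cc_infty Q phi ->
      \int[lebesgue_xt]_(p in Q) (u p * dx i phi p) =
      - \int[lebesgue_xt]_(p in Q) (Du p 0 i * phi p).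

Definition nonneg_weak_solution u Du :=
  [/\ {ae lebesgue_xt, forall p, Q p -> 0 <= u p},
      L1loc Q u,
      weak_gradient u Du,
      L1loc Q (fun p => enorm (Du p) `^ q) &
      forall phi, Cc_infty Q phi ->
        \int[lebesgue_xt]_(p in Q)
          (- u p * dt phi p - u p * laplacian phi p
           + enorm (Du p) `^ q * phi p) = 0].

(* v is the representative of u in C((0,T); L^1_loc(Omega)) *)
Definition L1loc_continuous_representative u (v : 'rV[R]_N * R -> R) :=
  {ae lebesgue_xt, forall p, Q p -> v p = u p} /\
  forall omega, compactly_contained omega Omega ->
  forall t, 0 < t -> (t%:E < T)%E ->
    (lebesgue_rV N).-integrable omega (EFin \o (fun x => v (x, t))) /\
    \int[lebesgue_rV N]_(x in omega) `|v (x, s) - v (x, t)| @[s --> t] --> 0.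

(* u is in L^oo_loc([0,T); L^1_loc(Omega)) *)
Definition Linfty_loc_L1loc u :=
  forall tau, 0 < tau -> (tau%:E < T)%E ->
  forall omega, compactly_contained omega Omega ->
  exists C : R, {ae lebesgue_measure, forall t, 0 < t < tau ->
    (\int[lebesgue_rV N]_(x in omega) `|u (x, t)|%:E <= C%:E)%E}.

(* Du is in L^q_loc(Omega * [0,T)); Du is only given for t > 0, and {t = 0}
   is a null set *)
Definition Lq_loc_upto0 Du :=
  forall K, compact K -> K `<=` cylinder0 Omega T ->
  lebesgue_xt.-integrable (K `&` Q) (fun p => (enorm (Du p) `^ q)%:E).

(* A Radon measure in Omega is a Borel measure which is finite on the compact
   subsets of Omega; regularity is automatic, as Omega is open in R^N. It is
   given by a measure on R^N of which only the trace on Omega matters. *)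
Definition radon_in (u0 : {measure set 'rV[R]_N -> \bar R}) :=
  forall K, compact K -> K `<=` Omega -> (u0 K < +oo)%E.

Definition initial_trace (v : 'rV[R]_N * R -> R)
    (u0 : {measure set 'rV[R]_N -> \bar R}) :=
  radon_in u0 /\
  forall phi, Cc Omega phi ->
    \int[lebesgue_rV N]_(x in Omega) (v (x, t) * phi x) @[t --> (0 : R)^'+] -->
    \int[u0]_(x in Omega) phi x.

End weak_solutions.

(* Main.v *)
(** The weak formulation extends from smooth to C^1 test functions phi, which gives
for a.e. s < t the identity int u(t) phi(t) - int u(s) phi(s) = - int_s^t H, where
H = - u phi_t + Du . grad phi + |Du|^q phi; for the continuous representative it
holds for all s < t. If the mass of u(t) is locally bounded near t = 0, testing with
a nonnegative phi = psi(x) theta(t) and moving both space derivatives to psi bounds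
the integral of |Du|^q psi up to t = 0. Conversely, when |Du|^q is integrable up to
t = 0, so is H for phi = psi(x), since |Du| <= 1 + |Du|^q, and the identity bounds
int u(s) psi as s -> 0; it even makes it converge. By density the limit
exists for every psi in C_c, it is a positive linear functional, and the Riesz
representation theorem turns it into the measure u0. Conversely a trace bounds
the mass near 0. Letting s -> 0 in the identity gives the last formula. *)

Require Import Defs.
From HB Require Import structures.
From mathcomp Require Import all_boot all_order all_algebra.
From mathcomp Require Import all_classical all_reals all_analysis.
From mathcomp Require Import measurable_realfun ring lra.
Set Implicit Arguments.
Unset Strict Implicit.
Unset Printing Implicit Defensive.
Import Order.TTheory GRing.Theory Num.Theory.
Import numFieldNormedType.Exports.
Local Open Scope classical_set_scope.
Local Open Scope ring_scope.

(** * Smooth functions *)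

(** All hypotheses are local in the open cylinder, while the claims concern t = 0, where neither u
    nor |Du|^q is known to be integrable. This shapes three choices. Passing to C^1 tests needs
    approximants that are uniformly C^1-close and live in one fixed compact set; instead of
    mollifying, the test is sampled on a lattice and spread by tensor products of a smooth hat
    function, so that every estimate is about finite sums. Tests on Omega x [0, T) have no values
    for t < 0, so the identity between two times is proved for tests with compact support in space
    only ([slab_test]), by inserting time cutoffs whose derivatives concentrate at the two times.
    Finally u and Du are never controlled together at the start: from dissipation to mass the test
    is constant in time, which removes u from the integrand ([major] with [Ma = 0]); from mass to
    dissipation the equation is used with the Laplacian on the test, which removes Du. *)

Section Ck_closure.
Context {R : realType}.
Implicit Types E F : normedModType R.

Lemma Ck_continuous E k (f : E -> R) : Ck k f -> continuous f.
Proof.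
by case: k => // k [df _] x; exact: differentiable_continuous (df x).
Qed.

Lemma CkW E k (f : E -> R) : Ck k.+1 f -> Ck k f.
Proof.
elim: k f => [|k IH] f Cf; first exact: Ck_continuous Cf.
by case: Cf => df Df; split => // v; exact: IH.
Qed.

Lemma Ck_cst E k (c : R) : Ck k (fun _ : E => c).
Proof.
elim: k c => [|k IH] c; first exact: cst_continuous.
split=> [x|v]; first exact: differentiable_cst.
rewrite [X in Ck _ X](_ : _ = (fun _ : E => 0)); first exact: IH.
by apply/funext => x; rewrite derive_cst.
Qed.

Lemma CkD E k (f g : E -> R) : Ck k f -> Ck k g -> Ck k (fun x => f x + g x).
Proof.
elim: k f g => [f g cf cg x|k IH f g [df Df] [dg Dg]]; first by apply: cvgD; [exact: cf|exact: cg].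
split=> [x|v]; first exact: differentiableD.
rewrite [X in Ck _ X](_ : _ = (fun x => 'D_v f x + 'D_v g x)).
  by apply: IH; [exact: Df|exact: Dg].
by apply/funext => x; rewrite -deriveD//; exact: diff_derivable.
Qed.

Lemma CkM E k (f g : E -> R) : Ck k f -> Ck k g -> Ck k (fun x => f x * g x).
Proof.
elim: k f g => [f g cf cg x|k IH f g Cf Cg]; first by apply: cvgM; [exact: cf|exact: cg].
have [df Df] := Cf; have [dg Dg] := Cg.
split=> [x|v]; first exact: differentiableM.
rewrite [X in Ck _ X](_ : _ = (fun x => f x * 'D_v g x + g x * 'D_v f x)).
  apply: CkD; apply: IH; [exact: CkW|exact: Dg|exact: CkW|exact: Df].
by apply/funext => x; rewrite deriveM//; exact: diff_derivable.
Qed.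

Lemma Ck_scale E k (c : R) (f : E -> R) : Ck k f -> Ck k (fun x => c * f x).
Proof. by move=> Cf; apply: CkM => //; exact: Ck_cst. Qed.

Lemma Ck_sum E k (I : Type) (r : seq I) (f : I -> E -> R) :
  (forall i, Ck k (f i)) -> Ck k (fun x => \sum_(i <- r) f i x).
Proof.
move=> Cf; elim: r => [|i r IH].
  by under eq_fun do rewrite big_nil; exact: Ck_cst.
by under eq_fun do rewrite big_cons; exact: CkD.
Qed.

Lemma Ck_prod E k (I : Type) (r : seq I) (f : I -> E -> R) :
  (forall i, Ck k (f i)) -> Ck k (fun x => \prod_(i <- r) f i x).
Proof.
move=> Cf; elim: r => [|i r IH].
  by under eq_fun do rewrite big_nil; exact: Ck_cst.
by under eq_fun do rewrite big_cons; exact: CkM.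
Qed.

(** Affine changes of variable are the only compositions needed: all smooth tests are built from
    functions of one real variable applied to affine forms, through sums and products. *)
Lemma differentiable_comp_affine E F (L : {linear E -> F}) (c : F) (f : F -> R) x :
  continuous L -> differentiable f (L x + c) ->
  differentiable (fun p => f (L p + c)) x.
Proof.
move=> cL df; apply: (@differentiable_comp _ _ _ _ (fun p => L p + c) f) => //.
apply: (@differentiableD _ _ _ L (cst c)); first exact: linear_differentiable.
exact: differentiable_cst.
Qed.

Lemma derive_comp_affine E F (L : {linear E -> F}) (c : F) (f : F -> R) x v :
  'D_v (fun p => f (L p + c)) x = 'D_(L v) f (L x + c).
Proof.
rewrite /derive; set d := (fun _ => _); set d' := (fun _ => _).
suff -> : d = d' by [].
by apply/funext => h; rewrite /d /d' /= (linearP L) addrA.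
Qed.

Lemma Ck_comp_affine E F k (L : {linear E -> F}) (c : F) (f : F -> R) :
  continuous L -> Ck k f -> Ck k (fun p => f (L p + c)).
Proof.
move=> cL; elim: k f => [f cf x|k IH f [df Df]].
  apply: (@continuous_comp _ _ _ (fun p => L p + c) f); last exact: cf.
  by apply: continuousD; [exact: cL|exact: cst_continuous].
split=> [x|v]; first exact: differentiable_comp_affine.
rewrite [X in Ck _ X](_ : _ = (fun p => 'D_(L v) f (L p + c))).
  exact: (IH _ (Df _)).
by apply/funext => p; rewrite derive_comp_affine.
Qed.

Lemma Ck_derive E k (f : E -> R) v : (forall k, Ck k f) -> Ck k ('D_v f).
Proof. by move=> /(_ k.+1) [_]; exact. Qed.

Lemma Ck1_is_derive (k : nat) (f g : R -> R) :
  (forall x, is_derive x (1:R) f (g x)) -> Ck k g -> Ck k.+1 f.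
Proof.
move=> fg Cg.
have df x : differentiable f x by apply/derivable1_diffP; case: (fg x).
split=> // v.
rewrite [X in Ck _ X](_ : _ = (fun x => v * g x)); first exact: Ck_scale.
by apply/funext => x; rewrite deriveE// diff1E// derive1E; have [_ ->] := fg x.
Qed.

End Ck_closure.

(** * A smooth step and a smooth convex ramp on the line *)

Section smooth_step.
Context {R : realType}.
Implicit Types (x y : R) (p : {poly R}).

(* The functions p(1/x) exp(-1/x), extended by 0 to x <= 0, are stable under
   derivation. *)
Let ep p x : R := if 0 < x then p.[x^-1] * expR (- x^-1) else 0.

Let exprn_expRN n y : 0 <= y -> y ^+ n * expR (- y) <= n`!%:R.
Proof.
move=> y0; rewrite expRN ler_pdivrMr ?expR_gt0//.
case: n => [|n]; first by rewrite expr0 fact0 mul1r leNgt expR_lt1 -leNgt.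
rewrite mulrC -ler_pdivrMr ?ltr0n ?fact_gt0//.
by apply: le_trans (expR_ge1Dxn n y0); rewrite lerDr.
Qed.

Let horner_expRN_bounded p : exists2 M : R, 0 < M &
  forall y, 0 <= y -> `|p.[y] * expR (- y)| <= M.
Proof.
exists (1 + \sum_(i < size p) `|p`_i| * i`!%:R) => [|y y0].
  by rewrite ltr_pwDl// sumr_ge0// => i _; rewrite mulr_ge0.
apply: (@le_trans _ _ (\sum_(i < size p) `|p`_i| * i`!%:R)); last by rewrite lerDr.
rewrite horner_coef mulr_suml (le_trans (ler_norm_sum _ _ _))//.
apply: ler_sum => i _; rewrite -mulrA normrM ler_wpM2l//.
rewrite ger0_norm ?exprn_expRN//.
by rewrite mulr_ge0 ?expR_ge0 ?exprn_ge0.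
Qed.

Let ep_derive p x : is_derive x (1:R) (ep p) (ep ((p - p^`()) * 'X^2) x).
Proof.
have [x0|x0|->] := ltrgt0P x.
- apply: (@near_eq_is_derive _ _ _ (fun x => p.[x^-1] * expR (- x^-1))).
    near=> z; rewrite /ep ifT//; near: z; exact: lt_nbhsr.
  have xN0 : x != 0 by rewrite gt_eqF.
  have -> : (fun x => p.[x^-1] * expR (- x^-1)) =
      (fun y => p.[y] * expR (- y)) \o (fun x : R => x^-1) by [].
  have dV : is_derive x (1:R) (fun x : R => x^-1) (- x ^- 2).
    by have := @is_deriveV _ id x 1 1 xN0 (is_derive_id _ _); rewrite scaler1.
  have dp : is_derive x^-1 (1:R) (fun y => p.[y] * expR (- y))
      ((p^`() - p).[x^-1] * expR (- x^-1)).
    have dN : is_derive x^-1 (1:R) (fun y : R => expR (- y)) (- expR (- x^-1)).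
      by apply: is_derive_eq; rewrite mulrN1.
    have := is_deriveM (is_derive_poly p x^-1) dN.
    move=> d; apply: is_derive_eq.
    by rewrite /= hornerD hornerN /GRing.scale/=; ring.
  apply: is_derive_eq (is_derive1_comp dp dV) _.
  rewrite /ep x0 hornerM hornerXn !hornerD !hornerN exprVn; ring.
- apply: (@near_eq_is_derive _ _ _ (cst 0)).
    near=> z; rewrite /ep ifF//; apply/negbTE; rewrite -leNgt; apply/ltW.
    near: z; exact: lt_nbhsl.
  rewrite /ep ifF; first exact: is_derive_cst.
  by apply/negbTE; rewrite -leNgt ltW.
(* Bounding [p * 'X^2] instead of [p] gains the factor h^2: [ep p h] is O(h^2), so its difference
   quotient at 0 tends to 0. *)
- have [M M0 HM] := horner_expRN_bounded (p * 'X^2).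
  have ep0 r : ep r 0 = 0 by rewrite /ep ltxx.
  have epM h : `|ep p h| <= M * `|h| ^+ 2.
    rewrite /ep; case: ifPn => h0; last by rewrite normr0 mulr_ge0 ?exprn_ge0// ltW.
    have := HM h^-1; rewrite invr_ge0 => /(_ (ltW h0)).
    rewrite hornerM hornerXn mulrAC normrM -ler_pdivlMr; last first.
      by rewrite normr_gt0 expf_neq0// invr_eq0 gt_eqF.
    by rewrite !normrX normfV exprVn invrK.
  have cv : h^-1 *: ((ep p \o shift 0) (h *: 1) - ep p 0) @[h --> 0^'] --> 0.
    apply/cvgrPdist_le => e e0; near=> h.
    have hN0 : h != 0 by near: h; exact: nbhs_dnbhs_neq.
    rewrite sub0r normrN ep0 subr0 /= addr0 [h *: 1]mulr1 normrM normfV.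
    rewrite ler_pdivrMl ?normr_gt0// (le_trans (epM h))// expr2 mulrCA ler_wpM2l//.
    rewrite -ler_pdivlMl// mulrC.
    near: h; apply: dnbhs0_le; exact: divr_gt0.
  rewrite ep0; apply: DeriveDef; first by apply/cvg_ex; exists 0.
  exact: cvg_lim cv.
Unshelve. all: by end_near.
Qed.

Let ep_Ck k p : Ck k (ep p).
Proof.
elim: k p => [|k IH] p.
  by move=> x; apply/differentiable_continuous/derivable1_diffP; case: (ep_derive p x).
exact: Ck1_is_derive (ep_derive p) (IH _).
Qed.

Lemma primitive_exists (f : R -> R) : continuous f -> (forall x, x <= 0 -> f x = 0) ->
  exists2 F : R -> R, (forall x, is_derive x (1:R) F (f x)) & forall x, x <= 0 -> F x = 0.
Proof.
move=> cf f0.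
(* Starting at -1, where f already vanishes, makes every x >= 0 an interior point for the
   fundamental theorem of calculus. *)
pose F x := (\int[lebesgue_measure]_(t in `[- 1, x]) f t)%R.
have F0 x : x <= 0 -> F x = 0.
  move=> x0; rewrite /F (@eq_Rintegral _ _ _ _ _ (cst 0)) ?Rintegral_cst ?mul0r// => t.
  by rewrite inE/= in_itv/= => /andP[_ tx]; rewrite f0// (le_trans tx).
exists F => // x.
have [x0|x0] := ltP x 0.
  apply: (@near_eq_is_derive _ _ _ (cst 0)).
    by near=> y; rewrite F0//; apply/ltW; near: y; exact: lt_nbhsl.
  by rewrite f0 ?ltW//; exact: is_derive_cst.
have xx1 : x < x + 1 by rewrite ltrDl.
have fi : lebesgue_measure.-integrable `[- 1, x + 1] (EFin \o f).
  apply: continuous_compact_integrable; first exact: segment_compact.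
  exact: continuous_subspaceT.
have N1x : - 1 < x by apply: lt_le_trans x0; rewrite oppr_lt0.
have [dF F'] := continuous_FTC1_closed xx1 fi N1x (cf x).
by apply: (DeriveDef dF); rewrite -derive1E; exact: F'.
Unshelve. all: by end_near.
Qed.

Lemma is_derive0_cst (f df : R -> R) a : (forall x, is_derive x (1:R) f (df x)) ->
  (forall x, a < x -> df x = 0) -> forall x, a <= x -> f x = f a.
Proof.
move=> fdf df0 x; rewrite le_eqVlt => /predU1P[->//|ax].
have [//||c /[!in_itv]/= /andP[ac cx]] := @MVT R f df a x.
  by apply: derivable_within_continuous => y _; case: (fdf y).
by rewrite df0// mul0r => /eqP; rewrite subr_eq0 => /eqP.
Qed.

(** S is the normalized primitive of the bump [ep 1 x * ep 1 (1 - x)], which is positive exactly on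
    (0, 1). It yields both the time cutoffs and, integrated once more, the convex ramp. *)
Lemma smooth_step_exists : exists S s : R -> R,
  [/\ forall x, is_derive x (1:R) S (s x), forall k, Ck k S /\ Ck k s,
      forall x, 0 <= s x, forall x, ~~ (0 < x < 1) -> s x = 0 &
      (forall x, x <= 0 -> S x = 0) /\ (forall x, 1 <= x -> S x = 1)].
Proof.
pose b x := ep 1 x * ep 1 (1 - x).
have ep_ge0 x : 0 <= ep 1 x.
  by rewrite /ep; case: ifPn => // _; rewrite hornerC mul1r expR_ge0.
have b0 x : ~~ (0 < x < 1) -> b x = 0.
  rewrite negb_and /b /ep subr_gt0 => /orP[/negbTE ->|/negbTE ->]; first by rewrite mul0r.
  by rewrite mulr0.
have Cb k : Ck k b.
  apply: CkM; first exact: ep_Ck.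
  rewrite (_ : (fun x => _) = (fun x => ep 1 (( *:%R (-1) : R -> R) x + 1))); last first.
    by apply/funext => x; rewrite /= [_ *: _]mulN1r addrC.
  apply: (@Ck_comp_affine R R R k ( *:%R (-1)) 1 (ep 1)); first exact: scaler_continuous.
  exact: ep_Ck.
have [S0 S0b S00] : exists2 F : R -> R, (forall x, is_derive x (1:R) F (b x)) & forall x, x <= 0 -> F x = 0.
  apply: primitive_exists; first exact: Ck_continuous (Cb 0%N).
  by move=> x x0; apply: b0; rewrite negb_and -leNgt x0.
have S01 x : 1 <= x -> S0 x = S0 1.
  by apply: is_derive0_cst S0b _ _ => y y1; rewrite b0// negb_and -!leNgt (ltW y1) orbT.
have S1 : 0 < S0 1.
  have [|c /[!in_itv]/= /andP[c0 c1]] := MVT ltr01 (fun x _ => S0b x).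
    by apply: derivable_within_continuous => y _; case: (S0b y).
  rewrite (S00 0)// !subr0 mulr1 => ->.
  by rewrite /b /ep c0 subr_gt0 c1 !hornerC !mul1r mulr_gt0// expR_gt0.
have CS k : Ck k S0.
  apply: CkW; exact: Ck1_is_derive (Cb k).
exists (fun x => (S0 1)^-1 * S0 x), (fun x => (S0 1)^-1 * b x); split.
- by move=> x; exact: is_deriveZ.
- by move=> k; split; exact: Ck_scale.
- by move=> x; rewrite mulr_ge0 ?invr_ge0 ?(ltW S1)// mulr_ge0.
- by move=> x /b0 ->; rewrite mulr0.
- by split=> x x0; [rewrite (S00 x)// mulr0|rewrite (S01 x)// mulVf// gt_eqF].
Qed.

(** A smoothing of max(x, 0) that agrees with it exactly outside [-L, L]. Exact agreement gives the
    second differences compact support, sum 1 and an exact first moment; convexity makes them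
    nonnegative. *)
Lemma convex_ramp_exists : exists g g' : R -> R, exists2 L, 0 <= L &
  [/\ forall x, is_derive x (1:R) g (g' x), forall k, Ck k g,
      forall x y, x <= y -> g' x <= g' y,
      forall x, x <= - L -> g x = 0 /\ g' x = 0 &
      forall x, L <= x -> g x = x /\ g' x = 1].
Proof.
have [S [s [dS CS s0 s00 [S0 S1]]]] := smooth_step_exists.
have [G dG G0] : exists2 F : R -> R, (forall x, is_derive x (1:R) F (S x)) & forall x, x <= 0 -> F x = 0.
  apply: primitive_exists => //; exact: Ck_continuous (CS 0%N).1.
have G1 x : 1 <= x -> G x - x = G 1 - 1.
  have dGx y : is_derive y (1:R) (fun x => G x - x) (S y - 1).
    exact: is_deriveB.
  by apply: (is_derive0_cst dGx) => y y1; rewrite S1 ?subrr// ltW.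
(* For x >= 1 the primitive G equals x - c, so the translation by c removes the offset. *)
pose c : R := 1 - G 1.
exists (fun x => G (x + c)), (fun x => S (x + c)), (1 + `|c|); first by rewrite addr_ge0.
have cc : c <= `|c| by exact: ler_norm.
have cN : - c <= `|c| by rewrite -normrN ler_norm.
split.
- move=> x.
  have := @is_derive1_comp _ G (fun x => x + c) x (S (x + c)) 1 (dG _).
  rewrite mulr1; apply; rewrite -[X in is_derive _ _ _ X]addr0.
  exact: is_deriveD.
- move=> k; apply: (@Ck_comp_affine R R R k idfun c G); first by move=> x; exact: cvg_id.
  apply: CkW; exact: (Ck1_is_derive dG (CS k).1).
- move=> x y xy; have : x + c <= y + c by rewrite lerD2r.
  move: (x + c) (y + c) => {x xy}y' z yz.
  have [|d _ dE] := MVT_segment yz (fun x _ => dS x).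
    by apply: derivable_within_continuous => t _; case: (dS t).
  by rewrite -subr_ge0 dE mulr_ge0// subr_ge0.
- move=> x xL.
  have x0 : x + c <= 0.
    by move: (`|c|) (c) cc cN xL => m d; lra.
  by rewrite G0// S0.
- move=> x xL; have x0 : 1 <= x + c by move: (`|c|) (c) cc cN xL => m d; lra.
  rewrite S1//; split => //.
  by have := G1 _ x0; rewrite /c => ?; lra.
Qed.

End smooth_step.

(** * Smooth approximation of test functions *)

Section second_difference.
Context {R : realType}.
Implicit Types (G g : R -> R) (x y : R).

(** For G(x) = max(x, 0) this is the hat function supported in [-1, 1]. *)
Definition diff2 G x := G (x + 1) - 2 * G x + G (x - 1).

Lemma sum_diff2 G y n : \sum_(i < n) diff2 G (y - i%:R) =
  (G (y + 1) - G y) - (G (y - n%:R + 1) - G (y - n%:R)).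
Proof.
elim: n => [|n IH]; first by rewrite big_ord0 subr0 subrr.
rewrite big_ord_recr/= IH /diff2 -(natr1 n).
have -> : y - (n%:R + 1) + 1 = y - n%:R by ring.
have -> : y - n%:R - 1 = y - (n%:R + 1) by ring.
by ring.
Qed.

Lemma sum_natr_diff2 G y n : \sum_(i < n) i%:R * diff2 G (y - i%:R) =
  G y - G (y - n%:R + 1) - (n%:R - 1) * (G (y - n%:R + 1) - G (y - n%:R)).
Proof.
elim: n => [|n IH]; first by rewrite big_ord0 subr0; ring.
rewrite big_ord_recr/= IH /diff2 -(natr1 n).
have -> : y - (n%:R + 1) + 1 = y - n%:R by ring.
have -> : y - n%:R - 1 = y - (n%:R + 1) by ring.
by ring.
Qed.

(** A discrete total variation. It is applied to the derivative of the ramp, whose values lie in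
    [0, 1]: the sum is then at most 2, whatever the number of nodes. *)
Lemma sum_norm_diff2_le g y n : (forall x z, x <= z -> g x <= g z) ->
  \sum_(i < n) `|diff2 g (y - i%:R)| <=
  (g (y + 1) - g (y - n%:R + 1)) + (g y - g (y - n%:R)).
Proof.
move=> ndg; elim: n => [|n IH]; first by rewrite big_ord0 subr0 !subrr addr0.
rewrite big_ord_recr/= (le_trans (lerD IH (lexx _)))// /diff2 -(natr1 n).
have -> : y - (n%:R + 1) + 1 = y - n%:R by ring.
have -> : y - n%:R - 1 = y - (n%:R + 1) by ring.
have : g (y - n%:R) <= g (y - n%:R + 1) by apply: ndg; lra.
have : g (y - (n%:R + 1)) <= g (y - n%:R) by apply: ndg; lra.
move: (g _) (g _) (g _) => a b c ab bc.
have : `|a - 2 * b + c| <= (a - b) + (b - c).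
  rewrite (_ : a - 2 * b + c = (a - b) - (b - c)); last by ring.
  by rewrite (le_trans (ler_normB _ _))// !ger0_norm ?subr_ge0.
by move: `|_| => m; lra.
Qed.

End second_difference.

Lemma derive_sum_seq {R : realType} {E : normedModType R} {J : Type} (r : seq J)
    (f : J -> E -> R) (p v : E) : (forall j, derivable (f j) p v) ->
  'D_v (fun p => \sum_(j <- r) f j p) p = \sum_(j <- r) 'D_v (f j) p.
Proof.
move=> df.
have dsum s : derivable (fun p => \sum_(j <- s) f j p) p v.
  elim: s => [|j s IH]; first by under eq_fun do rewrite big_nil; exact: derivable_cst.
  by under eq_fun do rewrite big_cons; exact: derivableD.
elim: r => [|j r IH].
  by rewrite big_nil; under eq_fun do rewrite big_nil; exact: derive_cst.
by under eq_fun do rewrite big_cons; rewrite deriveD// IH big_cons.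
Qed.

(** The omitted factor is singled out by its index, hence the hypothesis [uniq r]. *)
Lemma derive_prod_seq {R : realType} {E : normedModType R} {J : eqType} (r : seq J)
    (f : J -> E -> R) (p v : E) : (forall j, differentiable (f j) p) -> uniq r ->
  'D_v (fun p => \prod_(j <- r) f j p) p =
  \sum_(j <- r) 'D_v (f j) p * \prod_(i <- r | i != j) f i p.
Proof.
move=> df; elim: r => [_|j r IH /= /andP[jr ur]].
  rewrite big_nil; under eq_fun do rewrite big_nil; exact: derive_cst.
have dprod s : differentiable (fun p => \prod_(j <- s) f j p) p.
  elim: s => [|i s IHs].
    by under eq_fun do rewrite big_nil; exact: differentiable_cst.
  by under eq_fun do rewrite big_cons; exact: differentiableM.
under eq_fun do rewrite big_cons.
rewrite deriveM; [|exact: diff_derivable..].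
rewrite big_cons [X in _ = _ * X + _]big_cons eqxx/= IH// addrC; congr (_ + _).
  rewrite [LHS]mulrC; congr (_ * _).
  rewrite big_seq [RHS]big_seq_cond; apply: eq_bigl => i.
  by case: (boolP (i \in r)) => //= ir; apply/esym; apply: contraNneq jr => <-.
rewrite [LHS]mulr_sumr; apply: eq_big_seq => i ir.
rewrite big_cons ifT; first by rewrite mulrCA.
by apply: contraNneq jr => ->.
Qed.

(* A quasi-interpolant: the values of [f] on the lattice of step [h] and corner
   [(a, ..., a)], spread by tensor products of the smoothed hat function
   [diff2 g]. It reproduces affine functions, because the second differences
   of [g] sum to 1 and their first moment is the identity. *)
Section quasi_interpolant.
Context {R : realType} {E : normedModType R} {J : finType}.
Variables (l : J -> {linear E -> R}) (e : J -> E).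
Hypothesis lc : forall j, continuous (l j).
Hypothesis lek : forall i j, l i (e j) = (i == j)%:R.
Hypothesis coordE : forall p, p = \sum_j l j p *: e j.
Variables (g g' : R -> R) (L : R).
Hypothesis L0 : 0 <= L.
Hypothesis dg : forall x, is_derive x (1:R) g (g' x).
Hypothesis Cg : forall k, Ck k g.
Hypothesis ndg' : forall x y, x <= y -> g' x <= g' y.
Hypothesis gL : forall x : R, x <= - L -> g x = 0 /\ g' x = 0.
Hypothesis gR : forall x : R, L <= x -> g x = x /\ g' x = 1.

Let b := diff2 g.
Let b' := diff2 g'.

(** Convexity: by the mean value theorem the increment of g over [x, x + 1] is a slope taken to the
    right of the one over [x - 1, x]. *)
Let b_ge0 x : 0 <= b x.
Proof.
have gcc y : {within `[y, y + 1], continuous g}.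
  by apply: derivable_within_continuous => z _; case: (dg z).
have x1 : x <= x + 1 by rewrite lerDl.
have x1' : x - 1 <= x by rewrite gerBl.
have [c /[!in_itv]/= /andP[c1 _] cE] := MVT_segment x1 (fun y _ => dg y) (gcc x).
have gcc' : {within `[x - 1, x], continuous g} by have := gcc (x - 1); rewrite subrK.
have [d /[!in_itv]/= /andP[_ d1] dE] := MVT_segment x1' (fun y _ => dg y) gcc'.
rewrite /b /diff2; have := ndg' (le_trans d1 c1).
have -> : g (x + 1) - 2 * g x + g (x - 1) = (g (x + 1) - g x) - (g x - g (x - 1)) by ring.
by rewrite cE dE opprB addrCA subrr addr0 (addrC x) addrK !mulr1 subr_ge0.
Qed.

Let b_far x : L + 1 <= `|x| -> b x = 0 /\ b' x = 0.
Proof.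
rewrite /b /b' /diff2 ler_normr => /orP[] xL.
  have [-> ->] : g (x + 1) = x + 1 /\ g' (x + 1) = 1 by apply: gR; lra.
  have [-> ->] : g x = x /\ g' x = 1 by apply: gR; lra.
  have [-> ->] : g (x - 1) = x - 1 /\ g' (x - 1) = 1 by apply: gR; lra.
  by split; ring.
have [-> ->] : g (x + 1) = 0 /\ g' (x + 1) = 0 by apply: gL; lra.
have [-> ->] : g x = 0 /\ g' x = 0 by apply: gL; lra.
have [-> ->] : g (x - 1) = 0 /\ g' (x - 1) = 0 by apply: gL; lra.
by split; ring.
Qed.

Let Cb k : Ck k b.
Proof.
have sh c : Ck k (fun x => g (x + c)).
  by apply: (@Ck_comp_affine R R R k idfun c g) => // x; exact: cvg_id.
apply: CkD; last exact: sh.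
apply: CkD; first exact: sh.
rewrite (_ : (fun x => _) = (fun x => (- 2) * g x)); first exact: Ck_scale.
by apply/funext => x; rewrite mulNr.
Qed.

Let db x : is_derive x (1:R) b (b' x).
Proof.
have sh c : is_derive x (1:R) (fun x => g (x + c)) (g' (x + c)).
  have := @is_derive1_comp _ g (fun x => x + c) x (g' (x + c)) 1 (dg _).
  rewrite mulr1; apply; rewrite -[X in is_derive _ _ _ X]addr0.
  exact: is_deriveD.
exact: is_deriveD.
Qed.

Variables (a h : R) (n : nat).
Hypothesis h0 : 0 < h.

Let y j (p : E) : R := (l j p - a) / h.
Let B (k : {ffun J -> 'I_n}) (p : E) : R := \prod_j b (y j p - (k j)%:R).
Let node (k : {ffun J -> 'I_n}) : E := \sum_j (a + h * (k j)%:R) *: e j.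

Definition quasi_interpolant (f : E -> R) (p : E) : R := \sum_k f (node k) * B k p.

(** Points far enough from the boundary of the lattice box for the sums over finitely many nodes to
    have their values on the infinite lattice: the end terms of the telescoping sums fall where g is
    0 or the identity. *)
Let inner p := forall j, a + h * L < l j p < a + h * (n%:R - 1 - L).

Let l_node j k : l j (node k) = a + h * (k j)%:R.
Proof.
rewrite /node linear_sum (bigD1 j)//= linearZ_LR lek eqxx /= [_ *: _]mulr1.
by rewrite big1 ?addr0// => i ij; rewrite linearZ_LR lek eq_sym (negbTE ij) [LHS]mulr0.
Qed.

Let yE j p (m : R) : y j p - m = h^-1 * l j p + (- a / h - m).
Proof. by rewrite /y; ring. Qed.

Let CB i k : Ck i (B k).
Proof.
apply: Ck_prod => j; under eq_fun do rewrite yE.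
apply: (@Ck_comp_affine R E R i (h^-1 \*: l j) _ b) => // x.
by apply: continuousZl_tmp; exact: lc.
Qed.



Let DB k v p : 'D_v (B k) p =
  \sum_j (h^-1 * l j v) * (b' (y j p - (k j)%:R) * \prod_(i | i != j) b (y i p - (k i)%:R)).
Proof.
have lin j : (fun p => b (y j p - (k j)%:R)) =
    (fun p => b ((h^-1 \*: l j) p + (- a / h - (k j)%:R))).
  by apply/funext => q; rewrite yE.
have cl j : continuous (h^-1 \*: l j).
  by move=> x; apply: continuousZl_tmp; exact: lc.
have db1 x : differentiable b x by apply/derivable1_diffP; case: (db x).
rewrite /B derive_prod_seq; last exact: index_enum_uniq.
  apply: eq_bigr => j _; rewrite mulrA; congr (_ * _).
  rewrite lin (derive_comp_affine (h^-1 \*: l j) _ b) -yE.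
  rewrite deriveE// diff1E// derive1E; have [_ ->] := db (y j p - (k j)%:R).
  by rewrite /= /GRing.scale.
move=> j; rewrite lin.
by apply: (@differentiable_comp_affine R E R (h^-1 \*: l j)) => //; exact: cl.
Qed.

(** One distant coordinate kills the whole tensor product, and in each term of its derivative either
    the differentiated factor or a remaining one. *)
Let far k p : ~ (forall j, `|l j (node k) - l j p| <= h * (L + 1)) ->
  B k p = 0 /\ forall v, 'D_v (B k) p = 0.
Proof.
move/existsNP => [j /negP]; rewrite -ltNge => hj.
have [bj b'j] : b (y j p - (k j)%:R) = 0 /\ b' (y j p - (k j)%:R) = 0.
  apply: b_far; rewrite -(ler_pM2l h0) ltW// (lt_le_trans hj)// l_node.
  rewrite -[X in X * `|_|](gtr0_norm h0) -normrM distrC.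
  suff -> : h * (y j p - (k j)%:R) = l j p - (a + h * (k j)%:R) by [].
  by rewrite /y; field; rewrite gt_eqF.
split=> [|v]; first by rewrite /B (bigD1 j)//= bj mul0r.
rewrite DB big1// => i _; have [->|ij] := eqVneq i j; first by rewrite b'j mul0r mulr0.
by rewrite (bigD1 j) 1?eq_sym//= bj mul0r !mulr0.
Qed.

Let inner_y p j : inner p -> L <= y j p /\ y j p - n%:R + 1 <= - L.
Proof.
move=> /(_ j) /andP[p1 p2]; rewrite /y; split.
  by rewrite ler_pdivlMr//; lra.
rewrite -(ler_pM2l h0).
rewrite (_ : h * _ = l j p - a - h * n%:R + h); first by lra.
by field; rewrite gt_eqF.
Qed.

Let sumB p : inner p -> \sum_k B k p = 1.
Proof.
move=> ip; rewrite /B -(bigA_distr_bigA (fun j (i : 'I_n) => b (y j p - i%:R))).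
rewrite big1// => j _; rewrite sum_diff2; have [y1 y2] := inner_y j ip.
have [-> _] := gR y1; have [-> _] : g (y j p + 1) = y j p + 1 /\ g' (y j p + 1) = 1.
  by apply: gR; lra.
have [-> _] := gL y2; have [-> _] : g (y j p - n%:R) = 0 /\ g' (y j p - n%:R) = 0.
  by apply: gL; lra.
by ring.
Qed.

Let sumlB p i : inner p -> \sum_k l i (node k) * B k p = l i p.
Proof.
move=> ip; under eq_bigr do rewrite l_node mulrDl -mulrA.
rewrite big_split/= -!mulr_sumr sumB// mulr1.
have -> : \sum_(k : {ffun J -> 'I_n}) (k i)%:R * B k p = y i p.
  (* The weight m is attached to the coordinate i alone, so the sum of products factors into one
     first moment and sums equal to 1. *)
  pose F j (m : 'I_n) := (if j == i then m%:R else 1) * b (y j p - m%:R).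
  transitivity (\sum_(k : {ffun J -> 'I_n}) \prod_j F j (k j)).
    apply: eq_bigr => k _; rewrite /F big_split/= -/(B k p); congr (_ * _).
    by rewrite (bigD1 i)//= eqxx big1 ?mulr1// => j /negbTE ->.
  rewrite -bigA_distr_bigA (bigD1 i)//= [X in _ * X]big1 ?mulr1 => [|j /negbTE ji].
    rewrite /F eqxx sum_natr_diff2; have [y1 y2] := inner_y i ip.
    have [-> _] := gR y1; have [-> _] := gL y2.
    have [-> _] : g (y i p - n%:R) = 0 /\ g' (y i p - n%:R) = 0 by apply: gL; lra.
    by ring.
  rewrite /F ji; under eq_bigr do rewrite mul1r.
  rewrite sum_diff2; have [y1 y2] := inner_y j ip.
  have [-> _] := gR y1; have [-> _] : g (y j p + 1) = y j p + 1 /\ g' (y j p + 1) = 1.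
    by apply: gR; lra.
  have [-> _] := gL y2; have [-> _] : g (y j p - n%:R) = 0 /\ g' (y j p - n%:R) = 0.
    by apply: gL; lra.
  by ring.
by rewrite /y; field; rewrite gt_eqF.
Qed.

Let inner_near p : inner p -> \forall q \near p, inner q.
Proof.
move=> ip; apply: filter_forall => j.
have /andP[i1 i2] := ip j.
have /cvgrPdist_lt cj := @lc j p.
near=> q; have : `|l j p - l j q| < Num.min (l j p - (a + h * L)) (a + h * (n%:R - 1 - L) - l j p).
  by near: q; apply: cj; rewrite lt_min !subr_gt0 i1 i2.
by rewrite lt_min ltr_norml => /andP[]; rewrite ltr_norml => /andP[? ?] ?; lra.
Unshelve. all: by end_near.
Qed.

Let diffB k p : differentiable (B k) p.
Proof. by have [] := CB 1 k. Qed.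

Let derive_sum (c : {ffun J -> 'I_n} -> R) v p :
  'D_v (fun p => \sum_k c k * B k p) p = \sum_k c k * 'D_v (B k) p.
Proof.
rewrite (derive_sum_seq _ (f := fun k p => c k * B k p)).
  by apply: eq_bigr => k _; rewrite deriveZ//; exact: diff_derivable.
by move=> k; apply: derivableZ; exact: diff_derivable.
Qed.

(** The identity [sumB] holds on a neighbourhood of p, so it may be differentiated; [sumlDB] does
    the same with [sumlB]. *)
Let sumDB p v : inner p -> \sum_k 'D_v (B k) p = 0.
Proof.
move=> ip; transitivity ('D_v (fun p => \sum_k 1 * B k p) p).
  by rewrite derive_sum; apply: eq_bigr => k _; rewrite mul1r.
rewrite (@near_eq_derive _ _ _ _ (cst (1:R))) ?derive_cst//.
near=> q; under eq_bigr do rewrite mul1r; apply: sumB; near: q; exact: inner_near.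
Unshelve. all: by end_near.
Qed.

Let sumlDB p v i : inner p -> \sum_k l i (node k) * 'D_v (B k) p = l i v.
Proof.
move=> ip; rewrite -derive_sum (@near_eq_derive _ _ _ _ (l i)).
  by rewrite deriveE ?diff_lin//; exact: linear_differentiable.
by near=> q; apply: sumlB; near: q; exact: inner_near.
Unshelve. all: by end_near.
Qed.

(** In each term one factor is differentiated and costs 2/h by [sum_norm_diff2_le]; the other
    factors are nonnegative and sum to 1. *)
Let sum_normDB p v : inner p -> \sum_k `|'D_v (B k) p| <= h^-1 * 2 * \sum_j `|l j v|.
Proof.
move=> ip.
apply: (@le_trans _ _ (\sum_(k : {ffun J -> 'I_n}) \sum_j (h^-1 * `|l j v|) *
   (`|b' (y j p - (k j)%:R)| * \prod_(i | i != j) b (y i p - (k i)%:R)))).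
  apply: ler_sum => k _; rewrite DB (le_trans (ler_norm_sum _ _ _))//.
  apply: ler_sum => j _; rewrite !normrM gtr0_norm ?invr_gt0// ler_wpM2l//.
    by rewrite mulr_ge0// invr_ge0 ltW.
  by rewrite ler_wpM2l// ger0_norm// prodr_ge0.
rewrite exchange_big/= mulr_sumr; apply: ler_sum => j _.
rewrite -mulr_sumr mulrAC -[leRHS]mulrA [leRHS]mulrC -mulrA mulrC.
rewrite ler_wpM2l ?invr_ge0 ?(ltW h0)// ler_wpM2r//.
pose F i (m : 'I_n) := if i == j then `|b' (y j p - m%:R)| else b (y i p - m%:R).
under eq_bigr => k _.
  have -> : `|b' (y j p - (k j)%:R)| * \prod_(i | i != j) b (y i p - (k i)%:R) =
      \prod_i F i (k i).
    rewrite [RHS](bigD1 j)//= /F eqxx; congr (_ * _).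
    by apply: eq_bigr => i /negbTE ->.
  over.
rewrite -bigA_distr_bigA (bigD1 j)//= [X in _ * X]big1 ?mulr1 => [|i /negbTE ij].
  rewrite /F eqxx (le_trans (sum_norm_diff2_le _ _ ndg'))//.
  have g1 x : g' x <= 1.
    have [xL|/ltW xL] := leP L x; first by have [_ ->] := gR xL.
    by rewrite (le_trans (ndg' xL))//; have [_ ->] := gR (lexx L).
  have g0 x : 0 <= g' x.
    have [xL|/ltW xL] := leP x (- L); first by have [_ ->] := gL xL.
    by rewrite (le_trans _ (ndg' xL))//; have [_ ->] := gL (lexx (- L)).
  by apply: lerD; rewrite lerBlDr (le_trans (g1 _))// lerDl.
rewrite /F ij sum_diff2; have [y1 y2] := inner_y i ip.
have [-> _] := gR y1; have [-> _] : g (y i p + 1) = y i p + 1 /\ g' (y i p + 1) = 1.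
  by apply: gR; lra.
have [-> _] := gL y2; have [-> _] : g (y i p - n%:R) = 0 /\ g' (y i p - n%:R) = 0.
  by apply: gL; lra.
by ring.
Qed.

Lemma quasi_interpolant_Ck k f : Ck k (quasi_interpolant f).
Proof. by apply: Ck_sum => i; apply: Ck_scale; exact: CB. Qed.

Lemma quasi_interpolant_ge0 f : (forall p, 0 <= f p) ->
  forall p, 0 <= quasi_interpolant f p.
Proof.
by move=> f0 p; apply: sumr_ge0 => k _; rewrite mulr_ge0// /B prodr_ge0.
Qed.

Lemma quasi_interpolant_support f p : quasi_interpolant f p != 0 ->
  exists2 x, f x != 0 & forall j, `|l j x - l j p| <= h * (L + 1).
Proof.
move=> /eqP hp; apply: contrapT => /forall2NP nx; apply: hp.
apply: big1 => k _; have [/negP/negPn/eqP ->|/far[-> _]] := nx (node k).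
  by rewrite mul0r.
by rewrite mulr0.
Qed.

Variables (f : E -> R) (P : R).
Hypothesis fP : forall p, f p != 0 -> forall j, `|l j p| <= P.
Hypothesis aP : a + h * (2 * L + 2) < - P.
Hypothesis nP : P + h * (2 * L + 2) < a + h * n%:R.

(** The margin h(2L + 2) in [aP] and [nP] pays for the reach h(L + 1) of the basis functions and for
    the margin in [inner], which is hL below and h(L + 1) above. *)
Let near_support_inner x p : f x != 0 ->
  (forall j, `|l j x - l j p| <= h * (L + 1)) -> inner p.
Proof.
move=> fx xp j; have := fP fx j; have := xp j.
rewrite !ler_norml => /andP[xp1 xp2] /andP[x1 x2].
move: aP nP xp1 xp2; rewrite !mulrDr !mulrN !mulrA !mulr1 (mulrAC h 2).
move: (l j x : R) (l j p : R) (h * L : R) (h * n%:R : R) h0 x1 x2 => A B' C D H0.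
by move=> *; apply/andP; split; lra.
Qed.

Let not_inner_zero k p : ~ inner p -> f (node k) * B k p = 0 /\
  forall v, f (node k) * 'D_v (B k) p = 0.
Proof.
move=> ip; have [->|fk] := eqVneq (f (node k)) 0.
  by split => [|v]; rewrite mul0r.
have [|-> Dk] := @far k p.
  by apply: contra_not ip => /near_support_inner; exact.
by split=> [|v]; rewrite ?Dk mulr0.
Qed.

Lemma quasi_interpolant_dist eps : 0 <= eps ->
  (forall x p, (forall j, `|l j x - l j p| <= h * (L + 1)) -> `|f x - f p| <= eps) ->
  forall p, `|quasi_interpolant f p - f p| <= eps.
Proof.
move=> eps0 fe p; have [ip|ip] := pselect (inner p); last first.
  rewrite /quasi_interpolant big1 => [|k _]; last by have [-> _] := not_inner_zero k ip.
  have [->|fp] := eqVneq (f p) 0; first by rewrite subrr normr0.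
  exfalso; apply/ip/(near_support_inner fp) => j.
  by rewrite subrr normr0 mulr_ge0 ?(ltW h0)// addr_ge0.
rewrite -[f p]mulr1 -(sumB ip) mulr_sumr -sumrB.
under eq_bigr do rewrite -mulrBl.
rewrite (le_trans (ler_norm_sum _ _ _))// -[eps]mulr1 -(sumB ip) mulr_sumr.
apply: ler_sum => k _; rewrite normrM.
have B0 : 0 <= B k p by rewrite /B prodr_ge0.
rewrite (ger0_norm B0); have [nk|/far[-> _]] := pselect (forall j, `|l j (node k) - l j p| <= h * (L + 1)).
  by rewrite ler_wpM2r// fe.
by rewrite !mulr0.
Qed.

(** Since affine functions are reproduced together with their derivatives, the first order Taylor
    polynomial of f at p can be subtracted from the samples. The remainder, at most [eps * h], beats
    the factor 1/h of [sum_normDB]. *)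
Lemma quasi_interpolant_derive_dist eps v : 0 <= eps ->
  (forall p, differentiable f p) ->
  (forall x p, (forall j, `|l j x - l j p| <= h * (L + 1)) ->
    `|f x - f p - \sum_i 'D_(e i) f p * (l i x - l i p)| <= eps * h) ->
  forall p, `|'D_v (quasi_interpolant f) p - 'D_v f p| <= eps * (2 * \sum_j `|l j v|).
Proof.
move=> eps0 df fe p; rewrite derive_sum; have [ip|ip] := pselect (inner p); last first.
  rewrite big1 => [|k _]; last by have [_ ->] := not_inner_zero k ip.
  rewrite (@near_eq_derive _ _ _ _ (cst (0:R))).
    by rewrite derive_cst subrr normr0 mulr_ge0// mulr_ge0// sumr_ge0.
  (* Away from the inner region f vanishes near p: a point of the support within h of p would force
     the j-th inequality of [inner]. *)
  have /existsNP[j ij] := ip.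
  have /cvgrPdist_lt cj := @lc j p.
  near=> q; apply: contrapT => /eqP fq; apply: ij.
  have : `|l j p - l j q| < h by near: q; exact: cj.
  have := fP fq j; rewrite ltr_norml ler_norml => /andP[q1 q2] /andP[pq1 pq2].
  have hL := mulr_ge0 (ltW h0) L0.
  move: aP nP; rewrite !mulrDr !mulrN !mulrA !mulr1 (mulrAC h 2).
  move: (l j q : R) (l j p : R) (h * L : R) (h * n%:R : R) h0 q1 q2 pq1 pq2 hL => A B' C D H0.
  by move=> *; apply/andP; split; lra.
have Dfv : 'D_v f p = \sum_i 'D_(e i) f p * l i v.
  rewrite deriveE// {1}[v]coordE linear_sum; apply: eq_bigr => i _.
  by rewrite linearZ_LR deriveE// [LHS]mulrC.
have -> : \sum_k f (node k) * 'D_v (B k) p - 'D_v f p = \sum_k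
    (f (node k) - f p - \sum_i 'D_(e i) f p * (l i (node k) - l i p)) * 'D_v (B k) p.
  under [RHS]eq_bigr do rewrite mulrBl mulrBl.
  rewrite !sumrB -[X in _ = _ - X - _]mulr_sumr sumDB// mulr0 subr0; congr (_ - _).
  under eq_bigr do rewrite mulr_suml; rewrite exchange_big/= Dfv.
  apply: eq_bigr => i _; under eq_bigr do rewrite -mulrA mulrBl.
  by rewrite -mulr_sumr sumrB -mulr_sumr sumDB// mulr0 subr0 sumlDB.
rewrite (le_trans (ler_norm_sum _ _ _))//.
apply: (@le_trans _ _ (\sum_k (eps * h) * `|'D_v (B k) p|)).
  apply: ler_sum => k _; rewrite normrM.
  have [nk|/far[_ ->]] := pselect (forall j, `|l j (node k) - l j p| <= h * (L + 1)).
    by rewrite ler_wpM2r// fe.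
  by rewrite normr0 !mulr0.
rewrite -mulr_sumr (le_trans (ler_wpM2l _ (sum_normDB v ip)))//.
  by rewrite mulr_ge0// ltW.
by rewrite -mulrA !mulrA mulfK ?gt_eqF.
Unshelve. all: by end_near.
Qed.

End quasi_interpolant.

(** * Uniform estimates on compact sets *)

Section compactness.
Context {R : realType} {E : normedModType R}.
Implicit Types (K A : set E) (f : E -> R).

Lemma compact_sub_open_dist K A : compact K -> open A -> K `<=` A ->
  exists2 d : R, 0 < d & forall x y, K x -> `|x - y| <= d -> A y.
Proof.
move=> /compact_near_coveringP cK oA KA.
have /= cKr := cK R 0^'+ (fun r x => forall y, `|x - y| <= r -> A y) _.
have /filter_ex[r [r0 Hr]] : \forall r \near (0 : R)^'+,
    0 < r /\ K `<=` (fun x => forall y, `|x - y| <= r -> A y).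
  apply: filterI; first exact: nbhs_right_gt.
  apply: cKr => x Kx.
  have /nbhs_ballP[e /= e0 eA] : nbhs x A by apply: open_nbhs_nbhs; split => //; exact: KA.
  exists (ball x (e / 2), [set r | r < e / 2]) => /=.
    split; first by apply: nbhsx_ballx; rewrite divr_gt0.
    by apply: nbhs_right_lt; rewrite divr_gt0.
  move=> [x' r] [/= xx' re] y x'y; apply: eA; rewrite -ball_normE /= in xx' *.
  rewrite [e]splitr (le_lt_trans (ler_distD x' _ _))// ltrD// (le_lt_trans x'y)//.
by exists r => // x y Kx; exact: Hr.
Qed.

Lemma uniform_continuity_near f K : continuous f -> compact K ->
  (forall p, ~ K p -> f p = 0) -> forall eps, 0 < eps ->
  \forall d \near 0^'+, forall p x, `|p - x| <= d -> `|f p - f x| <= eps.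
Proof.
move=> cf /compact_near_coveringP cK f0 eps eps0.
have /= cKr := cK R 0^'+ (fun r x => forall y, `|x - y| <= r -> `|f x - f y| <= eps) _.
have Hr : \forall r \near (0 : R)^'+,
    K `<=` (fun x => forall y, `|x - y| <= r -> `|f x - f y| <= eps).
  apply: cKr => x _.
  have /cvgrPdist_lt/(_ (eps / 2)) := cf x.
  rewrite divr_gt0// => /(_ isT)/nbhs_ballP[e /= e0 ef].
  exists (ball x (e / 2), [set r | r < e / 2]) => /=.
    split; first by apply: nbhsx_ballx; rewrite divr_gt0.
    by apply: nbhs_right_lt; rewrite divr_gt0.
  move=> [x' r] [/= xx' re] y x'y.
  rewrite -ball_normE /= in xx' ef *.
  have f1 : `|f x - f x'| < eps / 2.
    by apply: ef; rewrite /= (lt_trans xx')// gtr_pMr// invf_lt1// ltr1n.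
  have f2 : `|f x - f y| < eps / 2.
    apply: ef => /=; rewrite [e]splitr (le_lt_trans (ler_distD x' _ _))// ltrD//.
    exact: le_lt_trans x'y re.
  rewrite [eps]splitr (le_trans (ler_distD (f x) _ _))// lerD// ?ltW//.
  by rewrite distrC.
near=> d; move=> p x px.
have Hd : K `<=` (fun x => forall y, `|x - y| <= d -> `|f x - f y| <= eps) by near: d.
have [Kp|Kp] := pselect (K p); first exact: Hd.
have [Kx|Kx] := pselect (K x); first by rewrite distrC; apply: Hd => //; rewrite distrC.
by rewrite !f0// subrr normr0 ltW.
Unshelve. all: by end_near.
Qed.

(** The Heine-Borel property, kept abstract so that the same approximation theorem serves both space
    and space-time. *)
Definition proper_space := forall M : R, compact [set p : E | `|p| <= M].

Lemma compact_thicken K (d : R) : proper_space -> compact K ->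
  compact [set p | exists2 x, K x & `|x - p| <= d].
Proof.
move=> pE cK.
have -> : [set p | exists2 x, K x & `|x - p| <= d] =
    (fun z : E * E => z.1 + z.2) @` (K `*` [set p | `|p| <= d]).
  apply/seteqP; split=> [p [x Kx xp]|p [[x y] [/= Kx yd] <-]].
    by exists (x, p - x); [split => //=; rewrite distrC|rewrite /= addrC subrK].
  by exists x => //; rewrite opprD addrA subrr add0r normrN.
apply: continuous_compact; last by apply: compact_setX => //; exact: pE.
by apply: continuous_subspaceT => z; exact: add_continuous.
Qed.

Lemma compact_support_sub A f K : compact K -> K `<=` A ->
  (forall p, ~ K p -> f p = 0) -> compact_support_in A f.
Proof.
move=> cK KA f0.
have sK : closure [set x | f x != 0] `<=` K.
  have KE : K = closure K by apply/closure_id; apply: compact_closed => //; exact: norm_hausdorff.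
  rewrite [X in _ `<=` X]KE.
  by apply: closure_subset => x /= /eqP fx; apply: contrapT => /f0.
split; last exact: subset_trans KA.
apply: subclosed_compact sK => //; exact: closed_closure.
Qed.

End compactness.

(** * Coordinates and smooth approximation with control of first derivatives *)

Section scaling_line.
Context {R : realType} {E : normedModType R} (v : E).

(** Packaged as a linear map so that the lemmas on affine compositions apply to restrictions to
    lines. *)
Definition line_map (t : R) : E := t *: v.

Let line_map_linear : linear line_map.
Proof. by move=> a x y; rewrite /line_map scalerDl scalerA. Qed.

HB.instance Definition _ := GRing.isLinear.Build R R E *:%R line_map line_map_linear.

Lemma line_map_continuous : continuous line_map.
Proof. by move=> x; apply: continuousZr_tmp; exact: cvg_id. Qed.

End scaling_line.

Section coordinates.
Context {R : realType} {E : normedModType R} {J : finType}.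

Definition coordinates (l : J -> {linear E -> R}) (e : J -> E) :=
  [/\ forall j, continuous (l j), forall i j, l i (e j) = (i == j)%:R &
      forall p, p = \sum_j l j p *: e j].

Variables (l : J -> {linear E -> R}) (e : J -> E).
Hypothesis le : coordinates l e.

Lemma derive_coordinates (f : E -> R) p v : differentiable f p ->
  'D_v f p = \sum_i 'D_(e i) f p * l i v.
Proof.
move=> df; have [_ _ coordE] := le; rewrite deriveE// {1}[v]coordE linear_sum.
by apply: eq_bigr => i _; rewrite linearZ_LR deriveE// [LHS]mulrC.
Qed.

Lemma MVT_coordinates (f : E -> R) p x : (forall p, differentiable f p) ->
  exists2 z, `|p - z| <= `|p - x| &
    f x - f p = \sum_i 'D_(e i) f z * (l i x - l i p).
Proof.
move=> df.
pose F t := f (line_map (x - p) t + p).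
have dF t : is_derive t (1:R) F ('D_(x - p) f (line_map (x - p) t + p)).
  have dFt : differentiable F t.
    by apply: differentiable_comp_affine => //; exact: line_map_continuous.
  apply: DeriveDef; first exact: diff_derivable.
  by rewrite /F derive_comp_affine; congr ('D_ _ _ _); exact: scale1r.
have [|t /[!in_itv]/= /andP[t0 t1]] := MVT_segment ler01 (fun t _ => dF t).
  by apply: derivable_within_continuous => t _; case: (dF t).
rewrite subr0 mulr1 /F /line_map scale1r scale0r add0r subrK => ->.
exists (t *: (x - p) + p).
  rewrite opprD addrCA subrr addr0 normrN normrZ ger0_norm// distrC.
  by rewrite ler_piMl.
rewrite derive_coordinates//; apply: eq_bigr => i _.
by rewrite (linearB (l i)).
Qed.

Lemma norm_le_coordinates p x d : (forall j, `|l j x - l j p| <= d) ->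
  `|x - p| <= d * \sum_j `|e j|.
Proof.
move=> xp; have [_ _ coordE] := le; rewrite [x - p]coordE.
rewrite (le_trans (ler_norm_sum _ _ _))// mulr_sumr; apply: ler_sum => j _.
by rewrite normrZ linearB ler_wpM2r.
Qed.

(** The compact K comes before eps: all approximants live in it, so a locally integrable factor
    contributes one fixed constant. The same interpolant preserves the sign and, when f is C^1, also
    approximates the first derivatives. *)
Lemma smooth_approximation (A : set E) (f : E -> R) : proper_space (E := E) ->
  open A -> continuous f -> compact_support_in A f ->
  exists K, [/\ compact K, K `<=` A, forall p, ~ K p -> f p = 0 &
    forall eps, 0 < eps -> exists phi, [/\ Cc_infty A phi,
      forall p, ~ K p -> phi p = 0,
      forall p, `|phi p - f p| <= eps,
      (forall p, 0 <= f p) -> forall p, 0 <= phi p &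
      (forall p, differentiable f p) -> (forall j, continuous ('D_(e j) f)) ->
        forall p j, `|'D_(e j) phi p - 'D_(e j) f p| <= eps]].
Proof.
move=> pE oA cf [cS SA]; set S := closure _ in cS SA.
have fS p : ~ S p -> f p = 0.
  by move=> Sp; apply: contrapT => /eqP fp; apply: Sp; exact: subset_closure.
have [d0 d00 d0A] := compact_sub_open_dist cS oA SA.
exists [set p | exists2 x, S x & `|x - p| <= d0]; split.
- exact: compact_thicken.
- by move=> p [x Sx xp]; exact: d0A Sx xp.
- move=> p Kp; apply: fS => Sp; apply: Kp; exists p => //.
  by rewrite subrr normr0 ltW.
move=> eps eps0.
have [g [g' [L L0 [dg Cg ndg' gL gR]]]] := @convex_ramp_exists R.
have [lc lek coordE] := le.
(* Summed over the coordinates, with increments at most h(L + 1), the derivative oscillation [eps2]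
   gives at most (eps/2)h; the factor 2 of the derivative estimate then restores eps. *)
pose eps2 := eps / 2 / ((L + 1) * (#|J|%:R + 1)).
have LJ0 : 0 < (L + 1) * (#|J|%:R + 1) by rewrite mulr_gt0// ltr_wpDl.
have eps20 : 0 < eps2 by rewrite !divr_gt0.
have [d [d_gt0 dd0 df dDf]] : exists d : R, [/\ 0 < d, d <= d0,
    forall p x, `|p - x| <= d -> `|f p - f x| <= eps &
    (forall j, continuous ('D_(e j) f)) ->
      forall j p x, `|p - x| <= d -> `|'D_(e j) f p - 'D_(e j) f x| <= eps2].
  apply: (@filter_ex _ (0 : R)^'+).
  (* A single d must serve the unconditional and the conditional conclusions, so continuity of the
     derivatives is decided here. *)
  have [cDf|ncDf] := pselect (forall j, continuous ('D_(e j) f)); last first.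
    near=> d; split; last by move=> /ncDf.
    - by near: d; exact: nbhs_right_gt.
    - by near: d; exact: nbhs_right_le.
    - by near: d; exact: (uniform_continuity_near cf cS fS eps0).
  near=> d; split.
  - by near: d; exact: nbhs_right_gt.
  - by near: d; exact: nbhs_right_le.
  - by near: d; exact: (uniform_continuity_near cf cS fS eps0).
  move=> _; near: d; apply: filter_forall => j.
  apply: (uniform_continuity_near (cDf j) cS) => // p Sp.
  rewrite (@near_eq_derive _ _ _ _ (cst (0:R))) ?derive_cst//.
  have : nbhs p (~` S).
    by apply: open_nbhs_nbhs; split => //; apply: closed_openC; exact: closed_closure.
  by apply: filterS => q /fS.
have Ce0 : 0 <= \sum_j `|e j| by rewrite sumr_ge0.
(* Chosen so that coordinates within h(L + 1) of each other mean points within d. *)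
pose h := d / ((L + 1) * (\sum_j `|e j| + 1)).
have LC0 : 0 < (L + 1) * (\sum_j `|e j| + 1) by rewrite mulr_gt0// ltr_wpDl.
have h0 : 0 < h by rewrite divr_gt0.
have near_d x p : (forall j, `|l j x - l j p| <= h * (L + 1)) -> `|x - p| <= d.
  move=> /norm_le_coordinates /le_trans; apply.
  rewrite /h invfM mulrA (mulrAC d) -!mulrA mulrCA (mulrA _ (L + 1)) mulVf ?mul1r; last first.
    by rewrite gt_eqF// ltr_wpDl.
  rewrite ler_pdivrMl; last by rewrite ltr_wpDl.
  by rewrite mulrC ler_wpM2r ?lerDl// ltW.
have [P fP] : exists P : R, forall p, f p != 0 -> forall j, `|l j p| <= P.
  have bd j : exists M : R, forall p, S p -> `|l j p| <= M.
    have : compact (l j @` S).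
      by apply: continuous_compact => //; apply: continuous_subspaceT; exact: lc.
    move=> /compact_bounded[M [_ HM]]; exists (M + 1) => p Sp.
    by apply: (HM (M + 1)); [rewrite ltrDl|exists p].
  have /choice[M HM] := bd; exists (\sum_j `|M j|) => p fp j.
  rewrite (le_trans (HM _ _ _))//; first exact: subset_closure.
  by rewrite (bigD1 j)//= (le_trans (ler_norm _))// lerDl sumr_ge0.
(* With 2L + 3 in place of 2L + 2 the inequality [aP] is strict; n is then large enough for [nP]. *)
pose a := - P - h * (2 * L + 3).
pose n := (Num.trunc ((P + h * (2 * L + 2) - a) / h)).+1.
have aP : a + h * (2 * L + 2) < - P.
  by rewrite /a -addrA gtrDl addrC -mulrBr pmulr_rlt0//; lra.
have nP : P + h * (2 * L + 2) < a + h * n%:R.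
  by rewrite -ltrBlDl [ltRHS]mulrC -ltr_pdivrMr// truncnS_gt.
exists (quasi_interpolant l e g a h n f).
have sK p : ~ (exists2 x, S x & `|x - p| <= d0) ->
    quasi_interpolant l e g a h n f p = 0.
  move=> Kp; apply: contrapT => /eqP.
  move=> /(quasi_interpolant_support lc lek dg gL gR h0)[x fx xp].
  apply: Kp; exists x; first exact: subset_closure.
  by rewrite (le_trans _ dd0)// near_d.
split => //.
- split; first by move=> k; exact: quasi_interpolant_Ck.
  by apply: (compact_support_sub _ _ sK); [exact: compact_thicken|move=> p [x Sx]; exact: d0A].
- apply: (quasi_interpolant_dist lc lek L0 dg ndg' gL gR h0 fP aP nP) => //.
    exact: ltW.
  by move=> x p /near_d; exact: df.
- by move=> f0; exact: (quasi_interpolant_ge0 l e dg ndg' a h n f0).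
- move=> diff_f cDf p j.
  have := @quasi_interpolant_derive_dist _ _ _ _ _ lc lek coordE _ _ _ L0 dg Cg ndg' gL gR _ _ _ h0 _ _ fP aP nP (eps / 2) (e j).
  rewrite (bigD1 j)//= big1 => [|i ij]; last by rewrite lek (negbTE ij) normr0.
  rewrite lek eqxx normr1 addr0 mulr1 mulfVK//; apply => //.
    by rewrite divr_ge0// ltW.
  move=> x q xq; have [z qz ->] := MVT_coordinates q x diff_f.
  rewrite -sumrB; under eq_bigr do rewrite -mulrBl.
  rewrite (le_trans (ler_norm_sum _ _ _))//.
  apply: (@le_trans _ _ (\sum_(i : J) eps2 * (h * (L + 1)))).
    apply: ler_sum => i _; rewrite normrM ler_pM//; apply: dDf => //.
    rewrite distrC (le_trans qz)//; rewrite distrC; exact: near_d.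
  have -> : \sum_(i : J) eps2 * (h * (L + 1)) = eps / 2 * h * (#|J|%:R / (#|J|%:R + 1)).
    rewrite (_ : \sum_(i : J) _ = #|J|%:R * (eps2 * (h * (L + 1)))); last first.
      by rewrite sumr_const [RHS]mulr_natl.
    rewrite /eps2; move: (#|J|%:R : R) (ler0n R #|J|) => m m0.
    by field; rewrite !gt_eqF// ltr_wpDl.
  rewrite ler_piMr//; first by rewrite mulr_ge0 ?divr_ge0 ?ltW.
  by rewrite ler_pdivrMr ?mul1r ?lerDl// ltr_wpDl.
Unshelve. all: by end_near.
Qed.

End coordinates.

Section space_time_coordinates.
Context {R : realType} {N : nat}.
Local Notation X := 'rV[R]_N.

Definition coord_x (j : 'I_N) (v : X) : R := v 0 j.

Let coord_x_linear j : linear (coord_x j).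
Proof. by move=> a x y; rewrite /coord_x !mxE. Qed.

HB.instance Definition _ j := GRing.isLinear.Build R X R *:%R (coord_x j) (coord_x_linear j).

Definition basis_x (j : 'I_N) : X := delta_mx 0 j.

Definition coord_xt (j : option 'I_N) (p : X * R) : R :=
  if j is Some i then p.1 0 i else p.2.

Let coord_xt_linear j : linear (coord_xt j).
Proof. by case: j => [j|] a x y; rewrite /coord_xt /= ?mxE. Qed.

HB.instance Definition _ j :=
  GRing.isLinear.Build R (X * R)%type R *:%R (coord_xt j) (coord_xt_linear j).

Definition basis_xt (j : option 'I_N) : X * R :=
  if j is Some i then (delta_mx 0 i, 0) else (0, 1).

Lemma coordinates_x : coordinates (fun j : 'I_N => coord_x j : {linear X -> R}) basis_x.
Proof.
split=> [j|i j|p]; first exact: coord_continuous.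
  by rewrite /= /coord_x mxE eqxx.
by rewrite [LHS]row_sum_delta.
Qed.

Lemma coordinates_xt :
  coordinates (fun j : option 'I_N => coord_xt j : {linear (X * R)%type -> R}) basis_xt.
Proof.
split=> [[j|] p|[i|] [j|]|[x t]] //=.
- by apply: (@continuous_comp _ _ _ fst (fun v : X => v 0 j)); [exact: cvg_fst|exact: coord_continuous].
- exact: cvg_snd.
- by rewrite mxE eqxx; congr (_%:R); rewrite -[RHS]/((Some i == Some j) : nat).
- by rewrite mxE.
rewrite (bigD1 None)//= (reindex_omap Some id)/=; last by case.
rewrite (eq_bigl xpredT) => [|i]; last by rewrite eqxx.
rewrite (_ : \sum_i _ = (x, 0)).
  by congr pair; rewrite /= ?scaler0 ?add0r// [_ *: _]mulr1 addr0.
have -> : \sum_i coord_xt (Some i) (x, t) *: basis_xt (Some i) =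
    (\sum_i coord_x i x *: basis_x i, 0).
  elim/big_ind2 : _ => [//|a b c d -> ->|i _]; congr pair => /=.
    by rewrite addr0.
  by rewrite scaler0.
by have [_ _ <-] := coordinates_x.
Qed.

Lemma proper_rV : proper_space (E := X).
Proof.
move=> M; apply: bounded_closed_compact.
  by exists M; split; [exact: num_real|move=> y My p /= pM; rewrite (le_trans pM)// ltW].
rewrite (_ : [set _ | _] = (fun p : X => `|p|) @^-1` [set y | y <= M])//.
apply: closed_comp; last exact: closed_le.
by move=> p _; exact: norm_continuous.
Qed.

Lemma proper_xt : proper_space (E := (X * R)%type).
Proof.
move=> M; rewrite (_ : [set _ | _] = [set p : X | `|p| <= M] `*` [set t : R | `|t| <= M]).
  apply: compact_setX; first exact: proper_rV.
  rewrite (_ : [set _ | _] = `[- M, M]%classic); first exact: segment_compact.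
  by apply/seteqP; split=> t /=; rewrite in_itv/= ler_norml.
apply/seteqP; split=> [[x t]|[x t]] /=; rewrite prod_normE ge_max/=.
  by move=> /andP[].
by move=> [-> ->].
Qed.

End space_time_coordinates.

(** * Cutoff functions *)

Section truncated_distance.
Context {R : realType} {E : normedModType R}.
Implicit Types (A C K : set E) (f g : E -> R).

(* [min 1 (dist x C)]; adding 1 to the set keeps the infimum meaningful when
   [C] is empty *)
Definition dist1 C x : R := inf ([set 1] `|` [set `|x - y| | y in C]).

Let dist1_has_inf C x : has_inf ([set 1] `|` [set `|x - y| | y in C]).
Proof.
split; first by exists 1; left.
by exists 0 => _ [->//|[y _ <-]].
Qed.

Lemma dist1_ge0 C x : 0 <= dist1 C x.
Proof. by apply: lb_le_inf => [|_ [->//|[y _ <-]]//]; exists 1; left. Qed.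

Lemma dist1_le1 C x : dist1 C x <= 1.
Proof. by apply: ge_inf; [have [] := dist1_has_inf C x|left]. Qed.

Lemma dist1_eq0 C x : C x -> dist1 C x = 0.
Proof.
move=> Cx; apply/eqP; rewrite eq_le dist1_ge0 andbT.
apply: ge_inf; first by have [] := dist1_has_inf C x.
by right; exists x => //; rewrite subrr normr0.
Qed.

Lemma dist1_ge C x d : d <= 1 -> (forall y, C y -> d <= `|x - y|) -> d <= dist1 C x.
Proof.
move=> d1 Cd; apply: lb_le_inf; first by exists 1; left.
by move=> _ [->//|[y Cy <-]]; exact: Cd.
Qed.

Lemma dist1_gt0 C x : closed C -> ~ C x -> 0 < dist1 C x.
Proof.
move=> cC Cx.
have /nbhs_ballP[d /= d0 dC] : nbhs x (~` C).
  by apply: open_nbhs_nbhs; split => //; exact: closed_openC.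
have : Num.min 1 d <= dist1 C x.
  apply: dist1_ge; first by rewrite ge_min lexx.
  move=> y Cy; rewrite leNgt; apply/negP => xy; apply: (dC y) => //.
  by rewrite -ball_normE /= (lt_le_trans xy)// ge_min lexx orbT.
by apply: lt_le_trans; rewrite lt_min ltr01 d0.
Qed.

Lemma dist1_continuous C : continuous (dist1 C).
Proof.
have lip x y : dist1 C x <= dist1 C y + `|x - y|.
  rewrite -lerBlDr; apply: lb_le_inf; first by exists 1; left.
  move=> _ [->|[z Cz <-]]; first by rewrite lerBlDr (le_trans (dist1_le1 _ _))// lerDl.
  rewrite lerBlDr addrC; apply: le_trans (ler_distD y _ _).
  by apply: ge_inf; [have [] := dist1_has_inf C x|right; exists z].
move=> x; apply/cvgrPdist_le => e e0; near=> y.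
have xy : `|x - y| <= e by near: y; apply: cvgr_dist_le => //; exact: cvg_id.
have := lip x y; have := lip y x; rewrite distrC => yx xy'.
by rewrite ler_distl; apply/andP; split; lra.
Unshelve. all: by end_near.
Qed.

(** The functions min(1, m dist(x, complement of A)), with the distance truncated at 1. Each point
    of A is given the exact value 1 from some m on, which is what lets them split a cover in the
    Caratheodory inequality. *)
Lemma open_indicator_approx A : open A -> exists psi : nat -> E -> R,
  [/\ forall m, continuous (psi m), forall m x, 0 <= psi m x <= 1,
      {homo psi : m n / (m <= n)%N >-> forall x, m x <= n x},
      forall m x, ~ A x -> psi m x = 0 & forall x, A x -> exists m, psi m x = 1].
Proof.
move=> oA; pose D := dist1 (~` A).
have D0 x : 0 <= D x by exact: dist1_ge0.
exists (fun m x => Num.min 1 (m%:R * D x)); split.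
- move=> m x; apply: (@continuous_min _ _ (fun=> 1) (fun x => m%:R * D x)).
    exact: cst_continuous.
  by apply: cvgM; [exact: cvg_cst|exact: dist1_continuous].
- by move=> m x; rewrite le_min ler01 mulr_ge0//= ge_min lexx.
- move=> m n mn x; rewrite le_min !ge_min lexx /=; apply/orP; right.
  by rewrite ler_wpM2r// ler_nat.
- by move=> m x Ax; rewrite /D dist1_eq0// mulr0 min_r.
move=> x Ax; have Dx : 0 < D x by apply: dist1_gt0; [exact: open_closedC|exact].
exists (Num.trunc (D x)^-1).+1; apply/min_l.
by rewrite -ler_pdivrMr// mul1r ltW// truncnS_gt.
Qed.

Lemma Cc_dominated A f g : Cc A f -> continuous g ->
  (forall x, f x = 0 -> g x = 0) -> Cc A g.
Proof.
move=> [cf [cS SA]] cg fg; split => //; apply: compact_support_sub cS SA _.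
move=> x Sx; apply: fg; apply: contrapT => /eqP fx; apply: Sx.
exact: subset_closure.
Qed.

Lemma CcD A f g : Cc A f -> Cc A g -> Cc A (fun x => f x + g x).
Proof.
move=> [cf [cS SA]] [cg [cS' SA']]; split.
  by move=> x; apply: cvgD; [exact: cf|exact: cg].
apply: (@compact_support_sub _ _ _ _ _ (compactU cS cS')).
  by move=> x []; [exact: SA|exact: SA'].
move=> x /not_orP[Sx S'x].
have -> : f x = 0 by apply: contrapT => /eqP ?; apply: Sx; exact: subset_closure.
have -> : g x = 0 by apply: contrapT => /eqP ?; apply: S'x; exact: subset_closure.
exact: addr0.
Qed.

Lemma CcMl A f g : continuous f -> Cc A g -> Cc A (fun x => f x * g x).
Proof.
move=> cf Cg; apply: (Cc_dominated Cg) => [x|x ->]; last exact: mulr0.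
by apply: cvgM; [exact: cf|case: Cg => cg _; exact: cg].
Qed.

Lemma CcZ A c f : Cc A f -> Cc A (fun x => c * f x).
Proof. by apply: CcMl; exact: cst_continuous. Qed.

Lemma Cc0 A : Cc A (fun _ : E => 0).
Proof.
split; first exact: cst_continuous.
by apply: (@compact_support_sub _ _ _ _ set0); [exact: compact0|exact: sub0set|].
Qed.

Lemma Cc_sum A (I : Type) (r : seq I) (F : I -> E -> R) :
  (forall i, Cc A (F i)) -> Cc A (fun x => \sum_(i <- r) F i x).
Proof.
move=> CF; elim: r => [|i r IH]; first by under eq_fun do rewrite big_nil; exact: Cc0.
by under eq_fun do rewrite big_cons; exact: CcD.
Qed.

(** A rescaled truncated distance to the complement of the open d-neighbourhood of K. As [dist1]
    stops at 1, the scale is min(1, d); the function is at least 1 on K but may exceed 1. *)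
Lemma cutoff_exists A K : proper_space (E := E) -> open A -> compact K -> K `<=` A ->
  exists chi, [/\ Cc A chi, forall x, 0 <= chi x & forall x, K x -> 1 <= chi x].
Proof.
move=> pE oA cK KA; have [d d0 dA] := compact_sub_open_dist cK oA KA.
pose U := [set p | exists2 x, K x & `|x - p| < d].
pose m := Num.min 1 d.
have m0 : 0 < m by rewrite lt_min ltr01.
exists (fun x => m^-1 * dist1 (~` U) x); split.
- split; first by move=> x; apply: cvgM; [exact: cvg_cst|exact: dist1_continuous].
  apply: (@compact_support_sub _ _ _ _ [set p | exists2 x, K x & `|x - p| <= d]).
  + exact: compact_thicken.
  + by move=> p [x Kx]; exact: dA.
  move=> p Kp; rewrite dist1_eq0 ?mulr0// => -[x Kx xp].
  by apply: Kp; exists x => //; exact: ltW.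
- by move=> x; rewrite mulr_ge0 ?dist1_ge0// invr_ge0 ltW.
- move=> x Kx; rewrite -ler_pdivrMl ?invr_gt0// invrK mulr1.
  apply: dist1_ge; first by rewrite ge_min lexx.
  move=> y Uy; rewrite ge_min; apply/orP; right; rewrite leNgt; apply/negP => xy.
  by apply: Uy; exists x.
Qed.

Lemma Cc_bounded A f : Cc A f -> exists2 M, 0 <= M & forall x, `|f x| <= M.
Proof.
move=> [cf [cS SA]].
have : compact (f @` closure [set x | f x != 0]).
  by apply: continuous_compact => //; exact: continuous_subspaceT.
move=> /compact_bounded[M [_ HM]]; exists (`|M| + 1); first by rewrite addr_ge0.
move=> x; have [->|fx] := eqVneq (f x) 0; first by rewrite normr0 addr_ge0.
apply: (HM (`|M| + 1)); first by rewrite (le_lt_trans (ler_norm M))// ltrDl.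
by exists x => //; exact: subset_closure.
Qed.

End truncated_distance.

(** * The Riesz representation theorem *)

Lemma continuous_measurable_rV {R : realType} {N : nat} (f : 'rV[R]_N -> R) :
  continuous f -> measurable_fun setT f.
Proof.
move=> /continuousP cf.
apply: (@measurability _ _ _ _ setT f _ (RGenOpens.measurableE R)).
move=> _ [_ [a [b ->]] <-]; rewrite setTI; apply: open_rV_measurable.
by apply: cf; exact: interval_open.
Qed.

Section riesz.
Context {R : realType} {N : nat}.
Local Notation X := 'rV[R]_N.
Variables (Omega : set X) (Lam : (X -> R) -> R).
Hypothesis oOmega : open Omega.
Hypothesis LamD : forall f g, Cc Omega f -> Cc Omega g ->
  Lam (fun x => f x + g x) = Lam f + Lam g.
Hypothesis LamZ : forall c f, Cc Omega f -> Lam (fun x => c * f x) = c * Lam f.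
Hypothesis Lam_ge0 : forall f, Cc Omega f -> (forall x, 0 <= f x) -> 0 <= Lam f.

(* Covering by nondecreasing sequences of test functions, rather than by single
   ones, makes the outer measure below sigma-subadditive and meaningful for
   sets that are not relatively compact. *)
Definition monotone_cover (A : set X) (F : nat -> X -> R) :=
  [/\ forall n, Cc Omega (F n), forall n x, 0 <= F n x,
      {homo F : m n / (m <= n)%N >-> forall x, m x <= n x} &
      forall x, A x -> Omega x -> exists n, 1 <= F n x].

(** Without any cover the infimum is +oo. Only points of Omega have to be covered, so the complement
    of Omega is null. *)
Definition riesz_outer (A : set X) : \bar R :=
  ereal_inf [set c%:E | c in [set c | exists2 F, monotone_cover A F &
    forall n, Lam (F n) <= c]].

Local Notation mu := riesz_outer.

Let LamB f g : Cc Omega f -> Cc Omega g -> Lam (fun x => f x - g x) = Lam f - Lam g.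
Proof.
move=> Cf Cg.
rewrite (_ : (fun x => _) = (fun x => f x + (-1) * g x)); last first.
  by apply/funext => x; rewrite mulN1r.
by rewrite LamD ?LamZ ?mulN1r//; exact: CcZ.
Qed.

Let Lam_le f g : Cc Omega f -> Cc Omega g -> (forall x, f x <= g x) -> Lam f <= Lam g.
Proof.
move=> Cf Cg fg; rewrite -subr_ge0 -LamB//; apply: Lam_ge0; last first.
  by move=> x; rewrite subr_ge0.
rewrite (_ : (fun x => _) = (fun x => g x + (-1) * f x)); last first.
  by apply/funext => x; rewrite mulN1r.
by apply: CcD => //; exact: CcZ.
Qed.

Let Lam0 : Lam (fun=> 0) = 0.
Proof.
rewrite (_ : (fun=> 0) = (fun x : X => 0 * (fun=> 0) x)); last first.
  by apply/funext => x; rewrite mul0r.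
by rewrite LamZ ?mul0r//; exact: Cc0.
Qed.

Let Lam_sum (I : Type) (r : seq I) (F : I -> X -> R) : (forall i, Cc Omega (F i)) ->
  Lam (fun x => \sum_(i <- r) F i x) = \sum_(i <- r) Lam (F i).
Proof.
move=> CF; elim: r => [|i r IH].
  by rewrite big_nil -[RHS]Lam0; congr Lam; apply/funext => x; rewrite big_nil.
under eq_fun do rewrite big_cons; rewrite LamD//; first by rewrite IH big_cons.
exact: Cc_sum.
Qed.

Let mu_le A F c : monotone_cover A F -> (forall n, Lam (F n) <= c) -> (mu A <= c%:E)%E.
Proof. by move=> cF Fc; apply: ereal_inf_lbound; exists c => //; exists F. Qed.

Let mu_ge A (d : \bar R) : (forall F c, monotone_cover A F -> (forall n, Lam (F n) <= c) ->
  (d <= c%:E)%E) -> (d <= mu A)%E.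
Proof. by move=> H; apply: le_ereal_inf_tmp => _ [c [F cF Fc] <-]; exact: H Fc. Qed.

Let mu_ge0 A : (0 <= mu A)%E.
Proof.
apply: mu_ge => F c [CF F0 _ _] Fc; rewrite lee_fin (le_trans _ (Fc 0%N))//.
exact: Lam_ge0.
Qed.

Let mu0 : mu set0 = 0%E.
Proof.
apply/eqP; rewrite eq_le mu_ge0 andbT; apply: (@mu_le _ (fun _ _ => 0)).
  by split => //; move=> *; exact: Cc0.
by move=> n; rewrite Lam0.
Qed.

Let mu_mono : {homo mu : A B / A `<=` B >-> (A <= B)%E}.
Proof.
move=> A B AB; apply: mu_ge => F c [CF F0 ndF FB]; apply: mu_le; split => //.
by move=> x /AB; exact: FB.
Qed.

Let mu_adherent A (e : R) : 0 < e -> (mu A < +oo)%E -> exists F c,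
  [/\ monotone_cover A F, forall n, Lam (F n) <= c & (c%:E <= mu A + e%:E)%E].
Proof.
move=> e0 Aoo.
have Afin : mu A \is a fin_num by rewrite ge0_fin_numE.
have [_ [c [F cF Fc] <-] cA] := lb_ereal_inf_adherent e0 Afin.
by exists F, c; split => //; exact: ltW.
Qed.

Let mu_sigma_subadditive : sigma_subadditive mu.
Proof.
move=> A; have [[i Ai]|/forallNP Aoo] := pselect (exists i, ~ (mu (A i) < +oo)%E).
  rewrite (_ : \sum_(_ <oo) _ = +oo)%E ?leey//.
  apply: (@nneseries_pinfty _ _ xpredT i) => //.
  by move/negP : Ai; rewrite -leNgt leye_eq => /eqP.
have {}Aoo i : (mu (A i) < +oo)%E by have /contrapT := Aoo i.
apply/lee_addgt0Pr => e e0.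
have [] := leP +oo%E (\sum_(i <oo) mu (A i) + e%:E)%E.
  by rewrite leye_eq => /eqP ->; rewrite leey.
set S := (_ + _)%E => Soo.
have S0 : (0 <= S)%E by rewrite adde_ge0 ?nneseries_ge0// lee_fin ltW.
have Sfin : S \is a fin_num by rewrite ge0_fin_numE.
have /choice[Fc HFc] i : exists Fc : (nat -> X -> R) * R,
    [/\ monotone_cover (A i) Fc.1, forall n, Lam (Fc.1 n) <= Fc.2 &
      (Fc.2%:E <= mu (A i) + (e / (2 ^ i.+1)%:R)%:E)%E].
  have [|F [c [cF HF cA]]] := @mu_adherent (A i) (e / (2 ^ i.+1)%:R) _ (Aoo i).
    by rewrite divr_gt0// ltr0n expn_gt0.
  by exists (F, c).
pose F i := (Fc i).1; pose c i := (Fc i).2.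
have cc i : monotone_cover (A i) (F i) by have [] := HFc i.
have Lc i n : Lam (F i n) <= c i by have [_ + _] := HFc i; exact.
have c0 i : 0 <= c i.
  by have [CF F0 _ _] := cc i; rewrite (le_trans _ (Lc i 0%N))// Lam_ge0.
(* Diagonal cover: at stage n, the n-th functions of the first n + 1 covers are added. It is
   monotone because everything is nonnegative, and its cost is bounded by the sum of the [c i]. *)
rewrite -(fineK Sfin); apply: (@mu_le _ (fun n x => \sum_(i < n.+1) F i n x)).
  split.
  - by move=> n; apply: Cc_sum => i; have [] := cc i.
  - by move=> n x; apply: sumr_ge0 => i _; have [_ F0 _ _] := cc i.
  - move=> m n mn x; rewrite (big_ord_widen_cond n.+1 xpredT (fun i => F i m x))//.
    rewrite big_mkcond; apply: ler_sum => i _; have [_ F0 ndF _] := cc i.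
    by case: ifP => // _; exact: ndF.
  - move=> x [i _ Aix] Ox; have [_ F0 ndF FA] := cc i.
    have [n Fn] := FA x Aix Ox; exists (maxn i n).
    have im : (i < (maxn i n).+1)%N by rewrite ltnS leq_maxl.
    rewrite (bigD1 (Ordinal im))//= (le_trans Fn)//.
    apply: (@le_trans _ _ (F i (maxn i n) x)); first by apply: ndF; exact: leq_maxr.
    by rewrite lerDl sumr_ge0// => j _; have [_ + _ _] := cc j; exact.
move=> n; rewrite Lam_sum; last by move=> i; have [] := cc i.
apply: (@le_trans _ _ (\sum_(i < n.+1) c i)); first by apply: ler_sum => i _; exact: Lc.
rewrite -lee_fin (fineK Sfin) -sumEFin.
apply: le_trans (epsilon_trick xpredT (fun i => mu_ge0 (A i)) (ltW e0)).
rewrite -(big_mkord xpredT (fun i => (c i)%:E)).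
apply: (@le_trans _ _ (\sum_(0 <= i < n.+1) (mu (A i) + (e / (2 ^ i.+1)%:R)%:E))%E).
  by apply: lee_sum => i _; have [] := HFc i.
by apply: nneseries_lim_ge => i _ _; rewrite adde_ge0// lee_fin divr_ge0// ltW.
Qed.

(** On the compact support of f a single n gives f <= F n + e', by Dini's argument; a cutoff chi
    turns the constant e' into an admissible function of cost at most e. *)
Let Dini f F c : Cc Omega f -> (forall x, 0 <= f x) ->
  (forall n, Cc Omega (F n)) -> (forall n x, 0 <= F n x) ->
  {homo F : m n / (m <= n)%N >-> forall x, m x <= n x} ->
  (forall x, f x != 0 -> exists n, f x <= F n x) ->
  (forall n, Lam (F n) <= c) -> Lam f <= c.
Proof.
move=> Cf f0 CF F0 ndF fF Fc.
have [cf [cS SO]] := Cf.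
have [chi [Cchi chi0 chi1]] := cutoff_exists proper_rV oOmega cS SO.
apply/ler_addgt0Pr => e e0.
pose e' := e / (Lam chi + 1).
have L1 : 0 < Lam chi + 1 by rewrite ltr_wpDl// Lam_ge0.
have e'0 : 0 < e' by rewrite divr_gt0.
have [n fFn] : exists n, forall x, closure [set x | f x != 0] x -> f x <= F n x + e'.
  have /compact_near_coveringP cK := cS.
  have := cK nat \oo (fun n x => f x <= F n x + e') _.
  move=> /(_ _)[x Sx|n _ Hn]; last by exists n; apply: Hn => /=.
  have [n fxn] : exists n, f x <= F n x.
    by have [->|/fF//] := eqVneq (f x) 0; exists 0%N.
  have cd : {for x, continuous (fun y => f y - F n y)}.
    by apply: continuousB; [exact: cf|case: (CF n) => cFn _; exact: cFn].
  have fxe : f x - F n x < e' by rewrite (le_lt_trans _ e'0)// subr_le0.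
  exists ([set y | f y - F n y < e'], [set m | (n <= m)%N]).
    split; last by exists n.
    exact: cvgr_lt cd _ fxe.
  move=> [y m] [/= ye nm]; have := ndF _ _ nm y; move: ye.
  by move: (f y) (F n y) (F m y) => u v w; lra.
have LeK : Lam chi * e' <= e.
  rewrite /e' mulrCA ger_pMr// ler_pdivrMr// mul1r lerDl//.
apply: le_trans (lerD (Fc n) LeK).
rewrite mulrC -LamZ// -LamD//; last exact: CcZ.
apply: Lam_le => //; first by apply: CcD => //; exact: CcZ.
move=> x; have [fx|fx] := eqVneq (f x) 0.
  by rewrite fx addr_ge0// mulr_ge0// ltW.
have Sx : closure [set x | f x != 0] x by exact: subset_closure.
by rewrite (le_trans (fFn x Sx))// lerD2l ler_peMr ?chi1// ltW.
Qed.

(** A cover F of A is split by the functions psi increasing to the indicator of G. For each fixed m,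
    (1 - psi m) F covers the part outside G at cost c - Lam(psi m F m). Read backwards this bounds
    Lam(psi m F m) for all m, and the diagonal psi m F m covers the part inside G. *)
Let mu_open_split G A : open G -> (mu (A `&` G) + mu (A `&` ~` G) <= mu A)%E.
Proof.
move=> oG; have [psi [cpsi psi01 ndpsi psi0 psi1]] := open_indicator_approx oG.
apply: mu_ge => F c [CF F0 ndF FA] Fc.
have C1 m n : Cc Omega (fun x => psi m x * F n x) by exact: CcMl.
have C2 m n : Cc Omega (fun x => (1 - psi m x) * F n x).
  by apply: CcMl => // x; apply: continuousB; [exact: cst_continuous|exact: cpsi].
have p0 m x : 0 <= psi m x by case/andP : (psi01 m x).
have p1 m x : 0 <= 1 - psi m x by rewrite subr_ge0; case/andP : (psi01 m x).
have split_c m n : Lam (fun x => psi m x * F n x) + Lam (fun x => (1 - psi m x) * F n x) <= c.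
  rewrite -LamD//; apply: le_trans (Fc n); rewrite le_eqVlt; apply/orP; left.
  by apply/eqP; congr Lam; apply/funext => x; rewrite -mulrDl addrC subrK mul1r.
have GA m : (mu (A `&` ~` G) <= (c - Lam (fun x => psi m x * F m x))%:E)%E.
  apply: (@mu_le _ (fun n x => (1 - psi m x) * F (maxn m n) x)).
    split => //.
    - by move=> n x; rewrite mulr_ge0.
    - move=> k l kl x; rewrite ler_wpM2l//; apply: ndF.
      by rewrite geq_max leq_maxl/= (leq_trans kl)// leq_maxr.
    - move=> x [Ax Gx] Ox; have [n Fn] := FA x Ax Ox; exists n.
      by rewrite psi0// subr0 mul1r (le_trans Fn)// ndF// leq_maxr.
  move=> n; rewrite lerBrDl; apply: le_trans (split_c m (maxn m n)).
  by rewrite lerD2r Lam_le// => x; rewrite ler_wpM2l// ndF// leq_maxl.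
have fin2 : mu (A `&` ~` G) \is a fin_num.
  by rewrite ge0_fin_numE// (le_lt_trans (GA 0%N))// ltey.
rewrite -(fineK fin2) -leeBrDr// -EFinB.
apply: (@mu_le _ (fun n x => psi n x * F n x)).
  split => //.
  - by move=> n x; rewrite mulr_ge0.
  - by move=> k l kl x; rewrite ler_pM//; [exact: ndpsi|exact: ndF].
  - move=> x [Ax Gx] Ox; have [n Fn] := FA x Ax Ox; have [m pm] := psi1 x Gx.
    exists (maxn m n); rewrite -[1]mulr1 ler_pM//.
      by rewrite -pm ndpsi// leq_maxl.
    by rewrite (le_trans Fn)// ndF// leq_maxr.
move=> n; rewrite lerBrDr -lerBrDl -lee_fin (fineK fin2); exact: GA.
Qed.

Lemma riesz_measure_exists : exists m : {measure set X -> \bar R},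
  forall A, m A = mu A.
Proof.
pose nu : {outer_measure set X -> \bar R} := HB.pack mu
  (isOuterMeasure.Build R X mu mu0 mu_ge0 mu_mono mu_sigma_subadditive).
have onu (G : set X) : open G -> nu.-caratheodory G.
  move=> oG; apply: le_caratheodory_measurable => A; exact: mu_open_split.
have mnu (G : set X) : measurable G -> nu.-caratheodory G.
  apply: smallest_sub => //; split.
  - exact: caratheodory_measurable_set0.
  - by move=> B mB; rewrite setTD; exact: caratheodory_measurable_setC.
  - by move=> B mB; exact: caratheodory_measurable_bigcup.
have nu_sa : semi_sigma_additive (mu : set X -> \bar R).
  move=> B mB tB mUB; apply: (@caratheodory_measure_sigma_additive _ _ nu) => //.
  - by move=> i; exact: mnu.
  - exact: mnu.
pose m : {measure set X -> \bar R} := HB.pack (mu : set X -> \bar R)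
  (isMeasure.Build _ _ _ (mu : set X -> \bar R) mu0 mu_ge0 nu_sa).
by exists m.
Qed.

(** The constant sequence g covers the set where g = 1; conversely any cover of the set where g > 0
    dominates g there, so [Dini] applies. *)
Let riesz_slice g : Cc Omega g -> (forall x, 0 <= g x <= 1) ->
  (mu [set x | g x = 1%R] <= (Lam g)%:E)%E /\ ((Lam g)%:E <= mu [set x | (0 < g x)%R])%E.
Proof.
move=> Cg g01; have g0 x : 0 <= g x by case/andP : (g01 x).
have g1 x : g x <= 1 by case/andP : (g01 x).
split.
  apply: (@mu_le _ (fun _ => g)) => //; split => //.
  by move=> x gx _; exists 0%N; rewrite gx.
apply: mu_ge => F c [CF F0 ndF FA] Fc; rewrite lee_fin.
apply: (Dini Cg g0 CF F0 ndF _ Fc) => x gx.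
have Ox : Omega x.
  by have [_ [_]] := Cg; apply; exact: subset_closure.
have gx0 : 0 < g x by rewrite lt_neqAle eq_sym gx g0.
by have [n Fn] := FA x gx0 Ox; exists n; rewrite (le_trans (g1 x)).
Qed.

Let mu_bounded f : Cc Omega f -> (mu [set x | f x != 0%R] < +oo)%E.
Proof.
move=> [cf [cS SO]].
have [chi [Cchi chi0 chi1]] := cutoff_exists proper_rV oOmega cS SO.
apply: (@le_lt_trans _ _ (Lam chi)%:E); last exact: ltey.
apply: (@mu_le _ (fun _ => chi)) => //; split => //.
by move=> x fx _; exists 0%N; apply: chi1; exact: subset_closure.
Qed.

(** Layer cake: f is cut into slices of height e, each lying between the indicators of two
    consecutive superlevel sets. Then Lam f and the integral are both between the same lower and
    upper sums. *)
Let riesz_integral (m : {measure set X -> \bar R}) f : (forall A, m A = mu A) ->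
  Cc Omega f -> (forall x, 0 <= f x) -> (\int[m]_x (f x)%:E = (Lam f)%:E)%E.
Proof.
move=> mE Cf f0; have [cf _] := Cf.
have mf : measurable_fun setT (EFin \o f).
  by apply/measurable_EFinP; exact: continuous_measurable_rV.
have [M M0 fM] := Cc_bounded Cf.
pose A (e : R) k := [set x | k%:R * e < f x].
have oA e k : open (A e k) by apply: (@open_comp _ _ f [set y | k%:R * e < y]) => [x _|]; [exact: cf|exact: open_gt].
have mA e k : measurable (A e k) by exact: open_rV_measurable.
have Afin e k : 0 < e -> mu (A e k) \is a fin_num.
  move=> e0; rewrite ge0_fin_numE//; apply: le_lt_trans (mu_bounded Cf).
  by apply: mu_mono => x /= fx; rewrite gt_eqF// (le_lt_trans _ fx)// mulr_ge0// ltW.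
pose U e k := fine (mu (A e k)).
have U0 e k : 0 <= U e k by rewrite fine_ge0.
pose V := fine (mu [set x | f x != 0]).
have UV e k : 0 < e -> U e k <= V.
  move=> e0; rewrite fine_le//; first exact: Afin.
    by rewrite ge0_fin_numE//; exact: mu_bounded.
  by apply: mu_mono => x /= fx; rewrite gt_eqF// (le_lt_trans _ fx)// mulr_ge0// ltW.
have sandwich e : 0 < e -> exists n, let lo := \sum_(k < n) e * U e k.+1 in
    let up := \sum_(k < n) e * U e k in
    [/\ up - lo <= e * V, lo <= Lam f <= up &
      (lo%:E <= \int[m]_x (f x)%:E <= up%:E)%E].
  move=> e0; pose n := (Num.trunc (M / e)).+1.
  have nM : M < n%:R * e by rewrite -ltr_pdivrMr// truncnS_gt.
  exists n => lo up.
  pose s k x : R := e^-1 * (Num.min (f x) (k.+1%:R * e) - Num.min (f x) (k%:R * e)).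
  have ke k : k%:R * e <= k.+1%:R * e by rewrite ler_pM2r// ler_nat.
  have ke1 k : k.+1%:R * e = k%:R * e + e by rewrite -natr1 mulrDl mul1r.
  have fE x : f x = \sum_(k < n) e * s k x.
    under eq_bigr do rewrite /s mulrA mulfV ?gt_eqF// mul1r.
    rewrite -(big_mkord xpredT (fun k => Num.min (f x) (k.+1%:R * e) - Num.min (f x) (k%:R * e))).
    rewrite (telescope_sumr (fun k => Num.min (f x) (k%:R * e)))// mul0r (min_r (f0 x)) subr0.
    by apply/esym/min_l/ltW/(le_lt_trans (ler_norm _))/(le_lt_trans (fM x)).
  have s01 k x : 0 <= s k x <= 1.
    rewrite /s mulr_ge0 ?invr_ge0 ?(ltW e0)//=; last first.
      by rewrite subr_ge0 le_min ge_min lexx/= ge_min ke orbT.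
    rewrite ler_pdivrMl// mulr1.
    have [fk|fk] := leP (f x) (k%:R * e).
      by rewrite (min_l (le_trans fk (ke k))) subrr ltW.
    by rewrite lerBlDl ge_min ke1 lexx orbT.
  have s1 k : A e k.+1 `<=` [set x | s k x = 1].
    move=> x /= fx; rewrite /s (min_r (ltW fx)) min_r; last first.
      by rewrite (le_trans (ke k))// ltW.
    by rewrite ke1 addrAC subrr add0r mulVf// gt_eqF.
  have s0 k : [set x | 0 < s k x] `<=` A e k.
    move=> x /=; rewrite /s /A /=; have [fk|//] := leP (f x) (k%:R * e).
    by rewrite (min_l (le_trans fk (ke k))) subrr mulr0 ltxx.
  have Cs k : Cc Omega (s k).
    apply: (Cc_dominated Cf) => [x|x fx].
      have cmin c : Num.min (f y) c @[y --> x] --> Num.min (f x) c.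
        by apply: continuous_min; [exact: cf|exact: cst_continuous].
      have cB : Num.min (f y) (k.+1%:R * e) - Num.min (f y) (k%:R * e) @[y --> x] -->
          Num.min (f x) (k.+1%:R * e) - Num.min (f x) (k%:R * e).
        exact: (cvgB (cmin _) (cmin _)).
      exact: (cvgM (cvg_cst (e^-1 : R)) cB).
    by rewrite /s fx !min_l ?mulr_ge0 ?(ltW e0)// subrr mulr0.
  have Ls k : U e k.+1 <= Lam (s k) <= U e k.
    have [l1 l2] := riesz_slice (Cs k) (s01 k).
    rewrite -!lee_fin /U !fineK ?Afin//; apply/andP; split.
      by apply: le_trans l1; apply: mu_mono; exact: s1.
    by apply: le_trans l2 _; apply: mu_mono; exact: s0.
  split.
  (* The difference telescopes: only the measures of the lowest and highest superlevel sets remain,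
     so it is at most e times the measure of the set where f is not 0. *)
  - rewrite /up /lo -sumrB; under eq_bigr do rewrite -mulrBr.
    rewrite -mulr_sumr ler_wpM2l ?(ltW e0)//.
    rewrite -(big_mkord xpredT (fun k => U e k - U e k.+1)).
    rewrite (eq_bigr (fun k => (- U e k.+1) - (- U e k))); last by move=> k _; rewrite opprK addrC.
    rewrite (telescope_sumr (fun k => - U e k))// opprK.
    by rewrite (le_trans _ (UV e 0%N e0))// gerDr oppr_le0.
  - have -> : Lam f = \sum_(k < n) e * Lam (s k).
      rewrite (_ : f = (fun x => \sum_(k < n) e * s k x)); last exact/funext.
      rewrite (Lam_sum _ (F := fun (k : 'I_n) x => e * s k x)); last by move=> k; exact: CcZ.
      by apply: eq_bigr => k _; exact: LamZ.
    by apply/andP; split; apply: ler_sum => k _; rewrite ler_pM2l//; case/andP : (Ls k).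
  - have step (P : nat -> nat) : (\int[m]_x (\sum_(k < n) e * \1_(A e (P k)) x)%:E =
        (\sum_(k < n) e * U e (P k))%:E)%E.
      under eq_integral do rewrite -sumEFin.
      rewrite ge0_integral_sum//.
      + rewrite -sumEFin; apply: eq_bigr => k _.
        under eq_integral do rewrite EFinM.
        rewrite ge0_integralZl//; last 2 first.
        * by apply/measurable_EFinP; exact: measurable_indic.
        * by rewrite lee_fin ltW.
        by rewrite integral_indic// setIT mE EFinM /U fineK// Afin.
      + by move=> k; apply/measurable_EFinP; apply: measurable_funM => //.
      + by move=> k x _; rewrite lee_fin mulr_ge0 ?(ltW e0).
    have mstep (P : nat -> nat) :
        measurable_fun setT (fun x => (\sum_(k < n) e * \1_(A e (P k)) x)%:E).
      apply/measurable_EFinP; apply: measurable_sum => k.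
      by apply: measurable_funM => //.
    have step0 (P : nat -> nat) x : (0 <= (\sum_(k < n) e * \1_(A e (P k)) x)%:E)%E.
      by rewrite lee_fin sumr_ge0// => k _; rewrite mulr_ge0 ?(ltW e0).
    rewrite /lo /up -(step succn) -(step id); apply/andP; split.
    + apply: ge0_le_integral => //.
      move=> x _; rewrite lee_fin fE; apply: ler_sum => k _; rewrite ler_pM2l//.
      rewrite indicE; have [xA|xA] /= := boolP (x \in A e k.+1).
        by rewrite (s1 k x (set_mem xA)).
      by case/andP : (s01 k x).
    + apply: ge0_le_integral => //; first by move=> x _; rewrite lee_fin.
        exact: (mstep id).
      move=> x _; rewrite lee_fin [leLHS]fE; apply: ler_sum => k _; rewrite ler_pM2l//.
      rewrite indicE; have [xA|xA] /= := boolP (x \in A e k).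
        by case/andP : (s01 k x).
      by rewrite leNgt; apply: contra xA => /(s0 k); exact: mem_set.
have If : (\int[m]_x (f x)%:E)%E \is a fin_num.
  have [n [_ _ /andP[_ Iu]]] := sandwich 1 ltr01.
  rewrite ge0_fin_numE; first exact: le_lt_trans Iu (ltey _).
  by apply: integral_ge0 => x _; rewrite lee_fin.
rewrite -(fineK If); congr EFin; apply/eqP; rewrite -subr_eq0 -normr_le0.
apply/ler_addgt0Pr => e e0; rewrite add0r.
have V0 : 0 <= V by rewrite fine_ge0.
have V1 : 0 < V + 1 by rewrite ltr_wpDl.
have [n [uplo /andP[L1 L2]]] := sandwich (e / (V + 1)) (divr_gt0 e0 V1).
rewrite -(fineK If) !lee_fin => /andP[I1 I2].
have : e / (V + 1) * V <= e by rewrite mulrAC -mulrA ger_pMr// ler_pdivrMr// mul1r lerDl.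
move: uplo L1 L2 I1 I2; set lo := \sum_(k < n) _; set up := \sum_(k < n) _.
rewrite ler_norml /=; move: lo up (fine _ : R) (Lam f) (e / _ * V) => a b c d u.
by move=> *; apply/andP; split; lra.
Qed.

Lemma riesz_representation : exists m : {measure set X -> \bar R},
  radon_in Omega m /\ forall f, Cc Omega f -> \int[m]_(x in Omega) f x = Lam f.
Proof.
have [m mE] := riesz_measure_exists; exists m; split.
  move=> K cK KO; rewrite mE.
  have [chi [Cchi chi0 chi1]] := cutoff_exists proper_rV oOmega cK KO.
  apply: (@le_lt_trans _ _ (Lam chi)%:E); last exact: ltey.
  apply: (@mu_le _ (fun _ => chi)) => //; split => //.
  by move=> x Kx _; exists 0%N; exact: chi1.
move=> f Cf; have [cf [_ SO]] := Cf.
rewrite Rintegral_mkcond (_ : _ \_ _ = f); last first.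
  apply/funext => x; rewrite patchE; case: ifPn => // xO.
  apply/esym; apply: contrapT => /eqP fx; move/negP : xO; apply; apply/mem_set.
  by apply: SO; exact: subset_closure.
pose fp x := Num.max (f x) 0; pose fn x := Num.max (- f x) 0.
have Cfp : Cc Omega fp.
  apply: (Cc_dominated Cf) => [x|x fx]; last by rewrite /fp fx maxxx.
  by apply: continuous_max; [exact: cf|exact: cst_continuous].
have Cfn : Cc Omega fn.
  apply: (Cc_dominated Cf) => [x|x fx]; last by rewrite /fn fx oppr0 maxxx.
  apply: (@continuous_max _ _ (fun x => - f x) (fun=> 0)).
    by apply: continuousN; exact: cf.
  exact: cst_continuous.
have fE x : f x = fp x - fn x.
  rewrite /fp /fn; have [f0|f0] := leP 0 (f x).
    by rewrite max_r ?oppr_le0// subr0.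
  by rewrite max_l ?oppr_ge0 ?ltW// opprK add0r.
have fp0 x : 0 <= fp x by rewrite le_max lexx orbT.
have fn0 x : 0 <= fn x by rewrite le_max lexx orbT.
have int h : Cc Omega h -> (forall x, 0 <= h x) -> m.-integrable setT (EFin \o h).
  move=> Ch h0; apply/integrableP; split.
    by apply/measurable_EFinP; apply: continuous_measurable_rV; case: Ch.
  under eq_integral do rewrite /= ger0_norm//.
  by rewrite riesz_integral// ltey.
rewrite (_ : f = fun x => fp x - fn x); last exact/funext.
by rewrite RintegralB ?int// LamB// /Rintegral !riesz_integral.
Qed.

End riesz.

(** * Space-time measure *)

Lemma ae_mono d (T : measurableType d) (R : realType) (m : {measure set T -> \bar R})
    (P P' : T -> Prop) : (forall x, P x -> P' x) ->
  {ae m, forall x, P x} -> {ae m, forall x, P' x}.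
Proof. exact: (@filterS _ _ (ae_filter_ringOfSetsType m)). Qed.

Lemma ae_mono2 d (T : measurableType d) (R : realType) (m : {measure set T -> \bar R})
    (P P' P'' : T -> Prop) : (forall x, P x -> P' x -> P'' x) ->
  {ae m, forall x, P x} -> {ae m, forall x, P' x} -> {ae m, forall x, P'' x}.
Proof. exact: (@filterS2 _ _ (ae_filter_ringOfSetsType m)). Qed.

Section space_time_measure.
Context {R : realType} {N : nat}.
Local Notation X := 'rV[R]_N.
Local Notation XT := (X * measurableTypeR R)%type.
Local Notation lam := (@lebesgue_rV R N).
Local Notation ell := (@lebesgue_measure R).
Local Notation mu := (@lebesgue_xt R N).

(** Swapping the factors reduces this to [open_prod_rV_measurable], where the real coordinate comes
    first. *)
Lemma open_xt_measurable (U : set (X * R)) : open U -> measurable (U : set XT).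
Proof.
move=> oU.
have ms : measurable_fun setT (fun p : XT => (p.2, p.1) : measurableTypeR R * X).
  by apply: measurable_fun_pair.
have -> : (U : set XT) =
    (fun p : XT => (p.2, p.1)) @^-1` ((fun p : R * X => (p.2, p.1)) @^-1` U).
  by apply/seteqP; split=> [[x t]|[x t]].
rewrite -[X in measurable X]setTI; apply: ms => //.
apply: open_prod_rV_measurable; apply: open_comp => // -[t x] _ /=.
exact: (cvg_pair cvg_snd cvg_fst).
Qed.

Lemma closed_xt_measurable (C : set (X * R)) : closed C -> measurable (C : set XT).
Proof.
move=> cC; rewrite -(setCK C); apply: measurableC; apply: open_xt_measurable.
exact: closed_openC.
Qed.

Lemma closed_rV_measurable (C : set X) : closed C -> measurable C.
Proof.
move=> cC; rewrite -(setCK C); apply: measurableC; apply: open_rV_measurable.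
exact: closed_openC.
Qed.

Lemma compact_rV_measurable (K : set X) : compact K -> measurable K.
Proof.
move=> cK; apply: closed_rV_measurable; exact: compact_closed.
Qed.

Lemma compact_xt_measurable (K : set (X * R)) : compact K -> measurable (K : set XT).
Proof.
move=> cK; apply: closed_xt_measurable; exact: compact_closed.
Qed.

Lemma continuous_measurable_xt (D : set (X * R)) (f : X * R -> R) : open D ->
  (forall p, D p -> {for p, continuous f}) -> measurable_fun (D : set XT) (f : XT -> R).
Proof.
move=> oD cf.
apply: (@measurability _ _ _ _ (D : set XT) (f : XT -> R) _ (RGenOpens.measurableE R)).
move=> _ [_ [a [b ->]] <-]; apply: open_xt_measurable.
rewrite openE => p [Dp fp]; rewrite /interior; apply: filterI; first exact: open_nbhs_nbhs.
apply: (cf p Dp); apply: open_nbhs_nbhs; split => //; exact: interval_open.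
Qed.

Lemma compact_rV_finite (K : set X) : compact K -> (lam K < +oo)%E.
Proof.
move=> cK; have /compact_bounded[M [_ HM]] := cK.
(* The box formula is for half-open boxes; the bound |M| + 1 on K is enlarged to |M| + 2 so that the
   left faces are avoided. *)
pose B := [set x : X | forall i, x 0 i \in `](const_mx (- (`|M| + 2)) : X) 0 i, (const_mx (`|M| + 2) : X) 0 i]].
have mB : measurable B.
  rewrite (_ : B = \bigcap_i ((fun x : X => x 0 i) @^-1`
    `](const_mx (- (`|M| + 2)) : X) 0 i, (const_mx (`|M| + 2) : X) 0 i]%classic)); last first.
    by apply/seteqP; split=> x /= => [Bx i _|Bx i]; exact: Bx.
  apply: fin_bigcap_measurable => // i _.
  by rewrite -[X in measurable X]setTI; exact: measurable_coord.
apply: (@le_lt_trans _ _ (lam B)).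
  apply: le_measure; rewrite ?inE//; first exact: compact_rV_measurable.
  move=> x Kx i; have xM : `|x| <= `|M| + 1.
    by apply: (HM (`|M| + 1)) => //; rewrite (le_lt_trans (ler_norm M))// ltrDl.
  have xi : `|x 0 i| <= `|x|.
    by rewrite [leRHS]/Num.norm/= mx_normrE; exact: (le_bigmax _ (fun k : 'I_1 * 'I_N => `|x k.1 k.2|) (0, i)).
  have := le_trans xi xM.
  by rewrite !mxE in_itv/= ler_norml => /andP[? ?]; apply/andP; split; lra.
rewrite lebesgue_rV_box ?ltey// => i; rewrite !mxE.
by rewrite -subr_ge0 opprK addr_ge0// addr_ge0.
Qed.

Lemma compact_xt_finite (K : set (X * R)) : compact K -> (mu K < +oo)%E.
Proof.
move=> cK.
have cK1 : compact (fst @` K).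
  by apply: continuous_compact => //; apply: continuous_subspaceT => p; exact: cvg_fst.
have cK2 : compact (snd @` K).
  by apply: continuous_compact => //; apply: continuous_subspaceT => p; exact: cvg_snd.
have m1 : measurable (fst @` K) by exact: compact_rV_measurable.
have m2 : measurable (snd @` K : set (measurableTypeR R)) by exact: compact_measurable.
apply: (@le_lt_trans _ _ (mu ((fst @` K) `*` (snd @` K)))).
  apply: le_measure; rewrite ?inE.
  - exact: compact_xt_measurable.
  - exact: measurableX.
  - by move=> p Kp; split; exists p.
have -> : mu ((fst @` K) `*` (snd @` K)) = (lam (fst @` K) * ell (snd @` K))%E.
  exact: product_measure1E.
rewrite lte_mul_pinfty//.
- by rewrite ge0_fin_numE// compact_rV_finite.
- exact: compact_finite_measure.
Qed.

(** Tonelli for the indicator of a measurable null set containing the exceptional points: almost all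
    its slices are null. *)
Lemma ae_space_time (P : set XT) : {ae mu, forall p, P p} ->
  {ae ell, forall t, {ae lam, forall x, P (x, t)}}.
Proof.
move=> [A [mA A0 PA]].
have mAt (t : measurableTypeR R) : measurable [set x | A (x, t)].
  have mpt : measurable_fun setT (fun x : X => (x, t) : XT).
    by apply: measurable_fun_pair => //.
  by rewrite -[X in measurable X]setTI; exact: (mpt measurableT A mA).
have mi : measurable_fun setT (fun p : XT => (\1_A p)%:E : \bar R).
  by apply/measurable_EFinP; exact: measurable_indic.
have i0 (p : XT) : (0 <= (\1_A p)%:E :> \bar R)%E by rewrite lee_fin.
have mG := measurable_fun_fubini_tonelli_G (m1 := lam) _ mi i0.
have GE (t : measurableTypeR R) : (\int[lam]_x (\1_A (x, t))%:E = lam [set x | A (x, t)])%E.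
  rewrite (eq_integral (fun x => (\1_[set x | A (x, t)] x)%:E)) => [|x _].
    by rewrite integral_indic// setIT.
  by rewrite !indicE; congr (_%:R%:E); apply/idP/idP => /set_mem ?; exact/mem_set.
have /(ae_eq_integral_abs ell measurableT mG).1 : (\int[ell]_t `|fubini_G lam (fun p : XT => (\1_A p)%:E) t| = 0)%E.
  under eq_integral => t _.
    rewrite gee0_abs; last by apply: integral_ge0 => x _; exact: i0.
    over.
  rewrite -(fubini_tonelli2 _ mi i0).
  by rewrite integral_indic// setIT.
apply: filterS => t /(_ I) Gt.
exists [set x | A (x, t)]; split => //; first by rewrite -GE.
by move=> x /= Px; apply: PA.
Qed.

Lemma Rintegral_space_time (f : XT -> R) : mu.-integrable setT (EFin \o f) ->
  {ae ell, forall t, lam.-integrable setT (fun x => (f (x, t))%:E)} /\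
  ell.-integrable setT (fun t => (\int[lam]_x f (x, t))%:E) /\
  \int[mu]_p f p = \int[ell]_t (\int[lam]_x f (x, t))%R.
Proof.
move=> fi.
have ae2 : {ae ell, forall t, lam.-integrable setT (fun x => (f (x, t))%:E)}.
  exact: (ae_integrable2 fi).
have mf : measurable_fun setT f by apply/measurable_EFinP; exact: measurable_int fi.
have mG := measurable_fubini_G fi.
have ae_fin : {ae ell, forall t : measurableTypeR R,
    fubini_G lam (EFin \o f) t = (\int[lam]_x f (x, t))%:E}.
  apply: filterS ae2 => t ift; rewrite /Rintegral fineK//.
  exact: integrable_fin_num.
have mF : measurable_fun setT (fun t : measurableTypeR R => (\int[lam]_x f (x, t))%:E).
  apply/measurable_EFinP; apply: measurableT_comp => //.
have mabs : measurable_fun setT (fun p : XT => (`|f p|)%:E).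
  by apply/measurable_EFinP; exact: measurableT_comp.
have iF : ell.-integrable setT (fun t => (\int[lam]_x f (x, t))%:E).
  apply/integrableP; split => //.
  have /integrableP[_ fioo] := fi.
  apply: le_lt_trans fioo.
  rewrite [leRHS](_ : _ = \int[mu]_p (`|f p|)%:E)%E// /lebesgue_xt fubini_tonelli2//.
  apply: ge0_le_integral => //.
  - by apply: measurableT_comp.
  - by apply: measurable_fun_fubini_tonelli_G.
  move=> t _; rewrite /fubini_G.
  have [ift|ift] := pselect (lam.-integrable setT (fun x => (f (x, t))%:E)).
    by rewrite /= EFin_normr_Rintegral//; apply: le_abse_integral => //; have /integrableP[] := ift.
  (* At the exceptional times the slice of |f| has integral +oo, so the default value of the real
     integral cannot violate the bound. *)
  rewrite (_ : (\int[lam]_x (`|f (x, t)|)%:E)%E = +oo%E) ?leey//.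
  apply/eqP; rewrite -leye_eq leNgt; apply/negP => foo; apply: ift; apply/integrableP; split => //.
  by apply/measurable_EFinP; apply: measurableT_comp => //; exact: measurable_fun_pair.
split=> //; split => //.
rewrite [LHS]/Rintegral /lebesgue_xt -integral21_prod_meas1//.
rewrite [RHS]/Rintegral; congr fine; apply: ae_eq_integral => //.
by apply: filterS ae_fin => t + _.
Qed.

Lemma tonelli_space_time (f : XT -> R) (k : R -> R) :
  measurable_fun setT f -> (forall p, 0 <= f p) ->
  measurable_fun setT (k : measurableTypeR R -> R) -> (forall t, 0 <= k t) ->
  (\int[mu]_p (f p * k p.2)%:E = \int[ell]_t ((k t)%:E * \int[lam]_x (f (x, t))%:E))%E.
Proof.
move=> mf f0 mk k0.
rewrite /lebesgue_xt fubini_tonelli2.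
- apply: eq_integral => t _; rewrite /fubini_G -ge0_integralZl//.
  + by apply: eq_integral => x _; rewrite /= -EFinM mulrC.
  + by apply/measurable_EFinP; apply: measurableT_comp => //; exact: measurable_fun_pair.
  + by move=> x _; rewrite lee_fin.
  + by rewrite lee_fin.
- apply/measurable_EFinP; apply: measurable_funM => //.
  by apply: measurableT_comp => //.
- by move=> p; rewrite lee_fin mulr_ge0.
Qed.

End space_time_measure.

(** * Locality of differentiability and extension by zero *)

Section local_differentiability.
Context {R : realType} {E : normedModType R}.
Implicit Types (f g : E -> R) (p : E).

Lemma near_zero_differentiable f p : (\forall q \near p, f q = 0) -> differentiable f p.
Proof.
move=> f0.
have fE : f \o shift p = cst (f p) + \0 +o_ 0 id.
  apply/eqaddoP => eps eps0; near=> h.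
  rewrite (nbhs_singleton f0).
  have fh : f (h + p) = 0.
    near: h; have /= := f0; rewrite (near_shift 0 p) subr0.
    by apply: filterS => h.
  by rewrite !fctE /= fh addr0 subrr normr0 mulr_ge0// ltW.
have d0 : 'd f p = \0 :> (E -> R).
  by apply: (@diff_unique _ _ _ _ (\0 : {linear E -> R})) => //; exact: cst_continuous.
by apply/diff_locallyP; rewrite d0; split => //; exact: cst_continuous.
Unshelve. all: by end_near.
Qed.

Lemma near_eq_differentiable f g p : (\forall q \near p, f q = g q) ->
  differentiable g p -> differentiable f p.
Proof.
move=> fg dg; rewrite (_ : f = g + (f - g)); last first.
  by apply/funext => q; rewrite !fctE /=; ring.
apply: differentiableD => //; apply: near_zero_differentiable.
by apply: filterS fg => q fq; rewrite !fctE /= fq subrr.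
Qed.

Lemma derive_off_support (K : set E) f p v : closed K -> (forall q, ~ K q -> f q = 0) ->
  ~ K p -> 'D_v f p = 0.
Proof.
move=> cK f0 Kp; rewrite (@near_eq_derive _ _ _ _ (cst (0:R))) ?derive_cst//.
have : nbhs p (~` K) by apply: open_nbhs_nbhs; split => //; exact: closed_openC.
by apply: filterS => q /f0.
Qed.

(** A and the complement of K are open and cover the space; f is C^1 on the first and zero on the
    second. *)
Lemma C1_extension (A K : set E) f (J : Type) (e : J -> E) : open A -> compact K -> K `<=` A ->
  (forall p, ~ K p -> f p = 0) -> (forall p, A p -> differentiable f p) ->
  (forall j p, A p -> {for p, continuous ('D_(e j) f)}) ->
  [/\ forall p, differentiable f p, forall j, continuous ('D_(e j) f) &
      compact_support_in A f].
Proof.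
move=> oA cK KA f0 df Df.
have cl : closed K by apply: compact_closed => //; exact: norm_hausdorff.
have nK p : ~ K p -> nbhs p (~` K).
  by move=> Kp; apply: open_nbhs_nbhs; split => //; exact: closed_openC.
split; last exact: compact_support_sub cK KA f0.
  move=> p; have [Kp|Kp] := pselect (K p); first exact/df/KA.
  by apply: near_zero_differentiable; apply: filterS (nK p Kp) => q /f0.
move=> j p; have [Kp|Kp] := pselect (K p); first exact/Df/KA.
rewrite /continuous_at (derive_off_support _ cl f0 Kp).
apply: (@cvg_trans _ (cst (0:R) @ p)); last exact: cvg_cst.
apply: near_eq_cvg; apply: filterS (nK p Kp) => q Kq.
by rewrite /= (derive_off_support _ cl f0 Kq).
Qed.

End local_differentiability.

(** * Cylinders and the compact sets inside them *)

Lemma ereal_gt_between (R : realType) (t : R) (T : \bar R) : (t%:E < T)%E ->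
  exists2 t', t < t' & (t'%:E < T)%E.
Proof.
case: T => [r| |//]; last by exists (t + 1); [rewrite ltrDl|exact: ltry].
rewrite lte_fin => tr; exists ((t + r) / 2); first by rewrite midf_lt.
by rewrite lte_fin midf_lt.
Qed.

Section cylinders.
Context {R : realType} {N : nat} (Omega : set 'rV[R]_N) (T : \bar R).
Hypothesis oO : open Omega.

Lemma cylinder_open : open (cylinder Omega T).
Proof.
rewrite (_ : cylinder _ _ = (fst @^-1` Omega) `&`
    (snd @^-1` ([set t | 0 < t] `&` [set t : R | (t%:E < T)%E]))).
  apply: openI; first by apply: open_comp => // p _; exact: cvg_fst.
  apply: open_comp => [p _|]; first exact: cvg_snd.
  by apply: openI; [exact: open_gt|exact: open_ereal_lt].
by apply/seteqP; split=> [p [? ? ?]|p [? [? ?]]].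
Qed.

Lemma compact_box (L : set 'rV[R]_N) (s t : R) : compact L -> compact (L `*` `[s, t]).
Proof. by move=> cL; apply: compact_setX => //; exact: segment_compact. Qed.

Lemma box_cylinder (L : set 'rV[R]_N) (s t : R) : L `<=` Omega -> 0 < s -> (t%:E < T)%E ->
  L `*` `[s, t] `<=` cylinder Omega T.
Proof.
move=> LO s0 tT [x r] [/= /LO Ox]; rewrite in_itv/= => /andP[sr rt].
by split => //=; [exact: lt_le_trans sr|rewrite (le_lt_trans _ tT)// lee_fin].
Qed.

Lemma box_cylinder0 (L : set 'rV[R]_N) (t : R) : L `<=` Omega -> (t%:E < T)%E ->
  L `*` `[0, t] `<=` cylinder0 Omega T.
Proof.
move=> LO tT [x r] [/= /LO Ox]; rewrite in_itv/= => /andP[sr rt].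
by split => //=; rewrite (le_lt_trans _ tT)// lee_fin.
Qed.

Lemma compact_cylinder0_bounded (K : set ('rV[R]_N * R)) : (0 < T)%E -> compact K ->
  K `<=` cylinder0 Omega T ->
  exists tau, [/\ 0 < tau, (tau%:E < T)%E & forall p, K p -> p.2 < tau].
Proof.
move=> T0 cK KQ.
have cK2 : compact (snd @` K).
  by apply: continuous_compact => //; apply: continuous_subspaceT => p; exact: cvg_snd.
have [e e0 eT] := ereal_gt_between T0.
have [[p Kp]|/forallNP K0] := pselect (exists p, K p); last first.
  by exists e; split => // p /K0.
have [t [q Kq <-] tmax] : exists2 t, (snd @` K) t & forall s, (snd @` K) s -> s <= t.
  have n0 : snd @` K !=set0 by exists p.2; exists p.
  have [c cK' cmax] := @compact_EVT_max _ _ id _ n0 cK2 (@continuous_subspaceT _ _ _ _ (fun x => cvg_id)).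
  by exists c => [|s Ks]; [exact: set_mem|apply: cmax; exact: mem_set].
have [_ _ qT] := KQ _ Kq; have [r qr rT] := ereal_gt_between qT.
exists (Num.max e r); split.
- by rewrite lt_max e0.
- by case: (leP e r).
- by move=> z Kz; rewrite lt_max (le_lt_trans _ qr) ?orbT// tmax//; exists z.
Qed.

End cylinders.

(** * Lebesgue points *)

Section bumps.
Context {R : realType}.
Local Notation ell := (@lebesgue_measure R).
Implicit Types (F k : R -> R) (s t c e : R).

(** The constant C does not depend on the position or the width. The bumps are thus approximate
    identities of height C / del, which is what a Lebesgue value can be tested against. *)
Lemma bump_exists : exists (S : R -> R -> R -> R) (k : R -> R -> R -> R) (C : R),
  0 < C /\ forall a del, 0 < del -> [/\
    forall t, is_derive t (1:R) (S a del) (k a del t),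
    (forall n, Ck n (S a del)) /\ continuous (k a del),
    forall t, 0 <= k a del t <= C / del,
    forall t, ~~ (a < t < a + del) -> k a del t = 0 &
    [/\ forall t, t <= a -> S a del t = 0, forall t, a + del <= t -> S a del t = 1,
        forall t, 0 <= S a del t <= 1 & \int[ell]_t k a del t = 1]].
Proof.
have [S [s [dS CS s0 s00 [S0 S1]]]] := @smooth_step_exists R.
have cs : continuous s by exact: Ck_continuous (CS 0%N).2.
have ndS x y : x <= y -> S x <= S y.
  move=> xy; have [|z _ zE] := MVT_segment xy (fun t _ => dS t).
    by apply: derivable_within_continuous => t _; case: (dS t).
  by rewrite -subr_ge0 zE mulr_ge0// subr_ge0.
have S01 x : 0 <= S x <= 1.
  have [x0|/ltW x0] := leP x 0; first by rewrite S0// lexx ler01.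
  have [x1|/ltW x1] := leP 1 x; first by rewrite S1// lexx ler01.
  by rewrite -{1}(S0 0 (lexx _)) -(S1 1 (lexx _)) !ndS.
have [c _ cmax] : exists2 c, c \in `[0, 1]%R & forall t, t \in `[0, 1]%R -> s t <= s c.
  by apply: EVT_max => //; exact: continuous_subspaceT.
(* The added 1 makes C positive at once. *)
pose C := s c + 1.
have C0 : 0 < C by rewrite ltr_wpDl.
have sC x : s x <= C.
  have [x01|/s00 ->] := boolP (0 < x < 1); last exact: ltW.
  rewrite (le_trans (cmax _ _)) ?lerDl//.
  by case/andP : x01 => x0 x1; rewrite in_itv/= !ltW.
pose arg a del t : R := del^-1 * t + (- a / del).
have argE a del t : arg a del t = (t - a) / del by rewrite /arg; ring.
pose k a del t := del^-1 * s (arg a del t).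
pose SS a del t := S (arg a del t).
exists SS, k, C; split => // a del del0.
have dSS t : is_derive t (1:R) (SS a del) (k a del t).
  have da : is_derive t (1:R) (arg a del) del^-1.
    rewrite -[X in is_derive _ _ _ X]addr0; apply: is_deriveD.
    by rewrite -[X in is_derive _ _ _ X]mulr1; exact: is_deriveZ.
  by rewrite /k mulrC; exact: is_derive1_comp.
have ck : continuous (k a del).
  move=> t; apply: (@cvgM _ _ _ _ (fun=> del^-1)); first exact: cvg_cst.
  apply: (@continuous_comp _ _ _ (arg a del) s); last exact: cs.
  apply: (@cvgD _ _ _ _ _ (fun t => del^-1 * t) (fun=> - a / del)); last exact: cvg_cst.
  by apply: (@cvgM _ _ _ _ (fun=> del^-1) id); [exact: cvg_cst|exact: cvg_id].
have k0 t : ~~ (a < t < a + del) -> k a del t = 0.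
  move=> ta; rewrite /k s00 ?mulr0// argE; apply: contra ta => /andP[t0 t1].
  rewrite pmulr_lgt0 ?invr_gt0// subr_gt0 in t0.
  by rewrite ltr_pdivrMr// mul1r ltrBlDl in t1; rewrite t0.
have Sa t : t <= a -> SS a del t = 0.
  by move=> ta; rewrite /SS S0// argE pmulr_lle0 ?invr_gt0// subr_le0.
have Sb t : a + del <= t -> SS a del t = 1.
  by move=> ta; rewrite /SS S1// argE ler_pdivlMr// mul1r lerBrDl.
split => //.
- split => // n; apply: CkW; apply: (Ck1_is_derive dSS).
  rewrite (_ : k a del = fun t => del^-1 * s (line_map (del^-1) t + - a / del)); last first.
    by apply/funext => t; rewrite /k /arg /line_map /= [t *: _]mulrC.
  apply: Ck_scale; apply: (@Ck_comp_affine R R R n (line_map (del^-1)) (- a / del) s) => //.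
  + exact: line_map_continuous.
  + by have [] := CS n.
- move=> t; rewrite /k mulr_ge0 ?invr_ge0 ?(ltW del0)//= mulrC.
  by rewrite ler_wpM2r ?invr_ge0 ?(ltW del0).
split => //; first by move=> t; exact: S01.
have adel : a < a + del by rewrite ltrDl.
rewrite (_ : (fun t => _) = (k a del) \_ `[a, a + del]); last first.
  apply/funext => t; rewrite patchE; case: ifPn => // ta; apply: k0.
  apply: contra ta => /andP[t0 t1]; apply/mem_set.
  by rewrite /= in_itv/= !ltW.
rewrite -Rintegral_mkcond /Rintegral (@continuous_FTC2 _ _ (SS a del))//.
- by rewrite (Sa _ (lexx _)) (Sb _ (lexx _)) sube0.
- exact: continuous_subspaceT.
- split; first by move=> t _; case: (dSS t).
  + apply: cvg_at_right_filter; apply: differentiable_continuous.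
    by apply/derivable1_diffP; case: (dSS a).
  + apply: cvg_at_left_filter; apply: differentiable_continuous.
    by apply/derivable1_diffP; case: (dSS (a + del)).
- by move=> t _; rewrite derive1E; have [_ ->] := dSS t.
Qed.

(* Holds with [c = F s] at the Lebesgue points of [F], and with [c = G s] when
   [F = G] a.e. and [G] is continuous at [s]; so the slices of [u] and those of
   its continuous representative are treated together. *)
Definition lebesgue_value F s c := forall e, 0 < e -> exists2 d0, 0 < d0 &
  forall d, 0 < d -> d < d0 ->
    (\int[ell]_(t in `[(s - d)%R, (s + d)%R]) (`|F t - c|)%:E <= (e * d)%:E)%E.

Lemma bump_integrable k a del : continuous k -> (forall t, ~~ (a < t < a + del) -> k t = 0) ->
  ell.-integrable setT (EFin \o k).
Proof.
move=> ck k0.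
rewrite (_ : EFin \o k = (EFin \o k) \_ `[a, a + del]); last first.
  apply/funext => t; rewrite patchE; case: ifPn => // ta; rewrite /= k0//.
  apply: contra ta => /andP[t0 t1]; apply/mem_set.
  by rewrite /= in_itv/= !ltW.
apply/(@integrable_mkcond _ _ _ ell `[a, a + del]%classic (EFin \o k)) => //.
apply: continuous_compact_integrable; first exact: segment_compact.
exact: continuous_subspaceT.
Qed.

(** The bump may sit on either side of s, provided it stays within [del] of it: just after the
    initial time of a slab, just before its final time. Its height C / del meets the bound [e * del]
    of the mean oscillation. *)
Lemma lebesgue_value_bump F s c k C del e a : measurable_fun setT (F : measurableTypeR R -> R) ->
  0 < del -> continuous k -> (forall t, 0 <= k t <= C / del) ->
  (forall t, ~~ (a < t < a + del) -> k t = 0) ->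
  \int[ell]_t k t = 1 -> s - del <= a -> a <= s ->
  ell.-integrable setT (fun t => (k t * F t)%:E) ->
  (\int[ell]_(t in `[(s - del)%R, (s + del)%R]) (`|F t - c|)%:E <= (e * del)%:E)%E ->
  `|\int[ell]_t (k t * F t) - c| <= C * e.
Proof.
move=> mF del0 ck kC k0 ik sa as' ikF Fe.
have mk : measurable_fun setT (k : measurableTypeR R -> R) by exact: continuous_measurable_fun.
have iks : ell.-integrable setT (EFin \o k) by exact: bump_integrable ck k0.
have ikc : ell.-integrable setT (fun t => (c * k t)%:E).
  by apply: (integrableZl measurableT c iks).
have -> : \int[ell]_t (k t * F t) - c = \int[ell]_t (k t * F t - c * k t).
  by rewrite RintegralB// RintegralZl// ik mulr1.
have id : ell.-integrable setT (fun t => (k t * F t - c * k t)%:E).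
  by have := integrableB measurableT ikF ikc.
have mFc : measurable_fun setT (fun t : measurableTypeR R => `|F t - c|).
  by apply: measurableT_comp => //; apply: measurable_funB.
apply: le_trans (le_normr_Rintegral _ _) _ => //.
have C0 : 0 <= C / del by have /andP[a1 b1] := kC s; exact: le_trans b1.
rewrite -lee_fin /Rintegral fineK; last first.
  by apply: integrable_fin_num => //; have := integrable_norm id.
have -> : ((C * e)%:E = (C / del)%:E * (e * del)%:E :> \bar R)%E.
  by rewrite -EFinM; congr EFin; field; rewrite gt_eqF.
apply: le_trans (lee_wpmul2l _ Fe); last by rewrite lee_fin.
rewrite -ge0_integralZl//; last first.
  by apply/measurable_EFinP; apply: measurable_funTS.
rewrite [leRHS]integral_mkcond; apply: ge0_le_integral => //.
- apply/measurable_EFinP; apply: measurableT_comp => //.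
  by apply/measurable_EFinP; exact: measurable_int id.
- apply/(measurable_restrictT _ _).1 => //.
  by apply/measurable_EFinP; apply: measurable_funTS; apply: measurable_funM.
move=> t _; rewrite patchE; have [/andP[ka kb]|kt] := boolP (a < t < a + del).
  rewrite mem_set; last first.
    rewrite /= in_itv/=; apply/andP; split; first exact: le_trans (ltW ka).
    by rewrite (le_trans (ltW kb))// lerD2r.
  rewrite -EFinM lee_fin [c * _]mulrC -mulrBr normrM ger0_norm; last by case/andP: (kC t).
  by apply: ler_wpM2r => //; case/andP: (kC t).
rewrite k0// mul0r mulr0 subr0 normr0.
by case: ifPn => // _; rewrite -EFinM lee_fin mulr_ge0.
Qed.

Lemma lebesgue_value_ae F s c : measurable_fun setT (F : measurableTypeR R -> R) ->
  (forall e, 0 < e -> exists2 d0, 0 < d0 &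
     {ae ell, forall t, s - d0 < t < s + d0 -> `|F t - c| <= e}) ->
  lebesgue_value F s c.
Proof.
move=> mF H e e0; have [|d0 d00 ae0] := H (e / 2); first by rewrite divr_gt0.
exists d0 => // d d0' dd.
have mFc : measurable_fun setT (fun t : measurableTypeR R => `|F t - c|).
  by apply: measurableT_comp => //; apply: measurable_funB.
apply: (@le_trans _ _ (\int[ell]_(t in `[(s - d)%R, (s + d)%R]) (e / 2)%:E)%E).
  apply: ae_ge0_le_integral => //.
  - by apply/measurable_EFinP; exact: measurable_funTS.
  - by move=> t _; rewrite lee_fin divr_ge0// ltW.
  - apply: ae_mono ae0 => t Ht; rewrite /= in_itv/= => /andP[t1 t2].
    by rewrite lee_fin Ht//; apply/andP; split; lra.
rewrite integral_cst//= lebesgue_measure_itv/= lte_fin ifT; last by lra.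
by rewrite -EFinB -EFinM lee_fin; lra.
Qed.

Lemma lebesgue_value_near F G s c : (\forall t \near s, F t = G t) ->
  lebesgue_value F s c -> lebesgue_value G s c.
Proof.
move=> /nbhs_ballP[r /= r0 FG] H e e0; have [d0 d00 Hd] := H e e0.
exists (Num.min d0 r); first by rewrite lt_min d00.
move=> d dp; rewrite lt_min => /andP[dd0 dr].
have -> : (\int[ell]_(t in `[(s - d)%R, (s + d)%R]) (`|G t - c|)%:E =
    \int[ell]_(t in `[(s - d)%R, (s + d)%R]) (`|F t - c|)%:E)%E; last exact: Hd.
apply: eq_integral => t; rewrite inE/= in_itv/= => /andP[t1 t2]; rewrite FG// /ball/= ltr_norml.
by apply/andP; split; lra.
Qed.

Lemma lebesgue_pt_value F s : measurable_fun setT (F : measurableTypeR R -> R) ->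
  lebesgue_pt F s -> lebesgue_value F s (F s).
Proof.
move=> mF Fs e e0.
have e40 : 0 < e / 4 by rewrite divr_gt0.
have mFc : measurable_fun setT (fun t : measurableTypeR R => `|F t - F s|).
  by apply: measurableT_comp => //; apply: measurable_funB.
have : \forall r \near (0:R)^'+, (davg F s r < (e / 4)%:E)%E.
  by apply: (Fs [set y | (y < (e / 4)%:E)%E]); apply: (@open_ereal_lt' R 0%E); rewrite lte_fin.
move=> [r0 /= r00 Hr]; exists (r0 / 2); first by rewrite divr_gt0.
move=> d d0 dr.
(* The closed interval of radius d lies in the open ball of radius 2d, whose measure 4d accounts for
   the e / 4. *)
have := Hr (2 * d) _ _; rewrite /= sub0r normrN gtr0_norm ?mulr_gt0//.
rewrite -ltr_pdivlMl// mulrC => /(_ dr isT) /ltW.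
rewrite /davg /iavg lebesgue_measure_ball ?mulr_ge0 ?(ltW d0)// => H.
apply: (@le_trans _ _ (\int[ell]_(y in ball s (2 * d)) `|((center (F s) \o F) y)%:E|)%E).
  apply: ge0_subset_integral => //.
  - exact: measurable_ball.
  - by apply/measurable_EFinP; apply: measurable_funTS.
  - move=> t; rewrite /= in_itv/= /ball/= => /andP[t1 t2].
    by rewrite ltr_norml; apply/andP; split; lra.
have : (((2 * d *+ 2)%:E * ((2 * d *+ 2)%:E^-1 * \int[ell]_(y in ball s (2 * d)) `|((center (F s) \o F) y)%:E|)) <= (2 * d *+ 2)%:E * (e / 4)%:E)%E.
  by apply: lee_wpmul2l => //; rewrite lee_fin mulrn_wge0// mulr_ge0// ltW.
have dn0 : 2 * d *+ 2 != 0 by rewrite mulrn_eq0/= mulf_neq0// gt_eqF.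
rewrite muleA -[X in (X * _)%E](_ : 1%E = _) ?mul1e; last first.
  by rewrite inver (negbTE dn0) -EFinM mulfV.
move=> /le_trans; apply; rewrite -EFinM lee_fin.
by rewrite -mulr_natl; lra.
Qed.

End bumps.

(** * Weak formulations *)

Section slice_integral.
Context {R : realType} {N : nat}.
Local Notation X := 'rV[R]_N.
Local Notation XT := (X * measurableTypeR R)%type.
Local Notation lam := (@lebesgue_rV R N).
Local Notation ell := (@lebesgue_measure R).
Local Notation mu := (@lebesgue_xt R N).

Lemma measurable_slice_integral (f : XT -> R) : measurable_fun setT f ->
  measurable_fun setT (fun t : measurableTypeR R => \int[lam]_x f (x, t)).
Proof.
move=> mf; apply: measurableT_comp; first exact: fine_measurable.
have mEf : measurable_fun setT (EFin \o f) by exact/measurable_EFinP.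
rewrite (_ : (fun t => _) = (fun t : measurableTypeR R => \int[lam]_x ((EFin \o f)^\+)%E (x, t)) \-
   (fun t : measurableTypeR R => \int[lam]_x ((EFin \o f)^\-)%E (x, t)))%E; last first.
  by apply/funext => t; rewrite [LHS]integralE; congr (_ - _)%E; apply: eq_integral => x _; rewrite ?funeposE ?funenegE.
apply: emeasurable_funB.
- apply: (@measurable_fun_fubini_tonelli_G _ _ _ _ _ lam (EFin \o f)^\+%E) => //.
  exact: measurable_funepos.
- apply: (@measurable_fun_fubini_tonelli_G _ _ _ _ _ lam (EFin \o f)^\-%E) => //.
  exact: measurable_funeneg.
Qed.

(** The weight confines the integration to times where f is integrable, so no global integrability
    of f is required. *)
Lemma Rintegral_slice_weight (f : XT -> R) (k : R -> R) : measurable_fun setT f ->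
  mu.-integrable setT (fun p => (k p.2 * f p)%:E) ->
  measurable_fun setT (k : measurableTypeR R -> R) ->
  ell.-integrable setT (fun t => (k t * \int[lam]_x f (x, t))%:E) /\
  \int[mu]_p (k p.2 * f p) = \int[ell]_t (k t * \int[lam]_x f (x, t)).
Proof.
move=> mf ikf mk; have [ai [ii ->]] := Rintegral_space_time ikf.
have kE : ae_eq ell setT (fun t => (\int[lam]_x (k t * f (x, t)))%:E)
    (fun t => (k t * \int[lam]_x f (x, t))%:E).
  apply: ae_mono ai => t ift _ /=.
  (* Where k vanishes both sides are 0 even if the slice of f is not integrable; elsewhere dividing
     by k t shows that it is. *)
  have [->|k0] := eqVneq (k t) 0.
    by under eq_Rintegral do rewrite mul0r; rewrite mul0r Rintegral_cst//= ?mul0r.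
  rewrite RintegralZl//.
  have := integrableZl measurableT (k t)^-1 ift.
  by apply: eq_integrable => // x _; rewrite -EFinM mulrA mulVf// mul1r.
have mkF : measurable_fun setT (fun t : measurableTypeR R => k t * \int[lam]_x f (x, t)).
  by apply: measurable_funM => //; exact: measurable_slice_integral.
split; last first.
  by congr fine; apply: ae_eq_integral => //; [exact: measurable_int ii|exact/measurable_EFinP].
move/integrableP : ii => [mi fi]; apply/integrableP; split; first exact/measurable_EFinP.
rewrite (le_lt_trans _ fi)// le_eqVlt; apply/orP; left; apply/eqP.
apply: ae_eq_integral => //.
- by apply: measurableT_comp => //; apply/measurable_EFinP.
- by apply: measurableT_comp.
- apply: ae_mono kE => t H _ /=.
  by case: (H I) => ->.
Qed.

End slice_integral.

(** * The integrand of the weak formulation and its majorant *)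

Section jets.
Context {R : realType} {N : nat}.
Local Notation X := 'rV[R]_N.
Local Notation XT := (X * measurableTypeR R)%type.
Local Notation mu := (@lebesgue_xt R N).
Variables (Q : set XT) (w g : XT -> R) (d : 'I_N -> XT -> R).
Hypotheses (mQ : measurable Q) (mw : measurable_fun setT w) (mg : measurable_fun setT g)
  (md : forall i, measurable_fun setT (d i)).
Hypotheses (w0 : forall p, 0 <= w p) (g0 : forall p, 0 <= g p)
  (dg : forall i p, `|d i p| <= 1 + g p).
Hypotheses (wQ : forall p, ~ Q p -> w p = 0) (gQ : forall p, ~ Q p -> g p = 0)
  (dQ : forall i p, ~ Q p -> d i p = 0).

(* the integrand of the weak formulation, for a test function with time
   derivative [a], gradient [b] and value [c] *)
Definition jet (a : XT -> R) (b : 'I_N -> XT -> R) (c : XT -> R) (p : XT) : R :=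
  - w p * a p + \sum_i d i p * b i p + g p * c p.

(** The bound [Ma] on the time derivative is kept apart from [M]: for tests constant in time,
    [Ma = 0] and the majorant does not involve w, whose integrability near t = 0 may be what has to
    be proved. *)
Definition major (Ma M : R) (p : XT) : R := Ma * w p + M * (N%:R * (1 + g p) + g p).

Lemma jet_out a b c p : ~ Q p -> jet a b c p = 0.
Proof.
move=> Qp; rewrite /jet wQ// gQ// oppr0 !mul0r add0r addr0.
by rewrite big1// => i _; rewrite dQ// mul0r.
Qed.

Lemma jet_bound a b c Ma M p : `|a p| <= Ma -> (forall i, `|b i p| <= M) -> `|c p| <= M ->
  `|jet a b c p| <= major Ma M p.
Proof.
move=> aM bM cM; have M0 : 0 <= M by exact: le_trans cM.
rewrite /jet (le_trans (ler_normD _ _))// /major mulrDr addrA; apply: lerD; last first.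
  by rewrite normrM ger0_norm// mulrC ler_wpM2r.
rewrite (le_trans (ler_normD _ _))//; apply: lerD.
  by rewrite mulNr normrN normrM ger0_norm// mulrC ler_wpM2r.
rewrite (le_trans (ler_norm_sum _ _ _))//.
rewrite (@le_trans _ _ (\sum_(i < N) M * (1 + g p)))//.
  by apply: ler_sum => i _; rewrite normrM mulrC ler_pM.
by rewrite sumr_const card_ord mulr_natl mulrnAr.
Qed.

Lemma measurable_jet a b c : measurable_fun Q a -> (forall i, measurable_fun Q (b i)) ->
  measurable_fun Q c -> measurable_fun setT (jet a b c).
Proof.
move=> ma mb mc.
rewrite (_ : jet a b c = jet (a \_ Q) (fun i => b i \_ Q) (c \_ Q)); last first.
  apply/funext => p; have [Qp|Qp] := pselect (Q p); last by rewrite !jet_out.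
  rewrite /jet !patchE mem_set//; congr (_ + _ + _).
  by apply: eq_bigr => i _; rewrite patchE mem_set.
have mP (f : XT -> R) : measurable_fun Q f -> measurable_fun setT (f \_ Q).
  by move=> mf; exact: (measurable_restrictT f mQ).1.
apply: measurable_funD; first apply: measurable_funD.
- apply: measurable_funM; last exact: mP.
  by apply: measurableT_comp.
- by apply: measurable_sum => i; apply: measurable_funM => //; exact: mP.
- by apply: measurable_funM => //; exact: mP.
Qed.

Lemma measurable_major Ma M : measurable_fun setT (major Ma M).
Proof.
apply: measurable_funD; apply: measurable_funM => //.
apply: measurable_funD => //; apply: measurable_funM => //.
exact: measurable_funD.
Qed.

Lemma major_ge0 Ma M p : 0 <= Ma -> 0 <= M -> 0 <= major Ma M p.
Proof.
move=> Ma0 M0; rewrite /major addr_ge0// ?mulr_ge0//.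
by rewrite addr_ge0// mulr_ge0// addr_ge0.
Qed.

(** A is the set where the test and its derivatives are bounded and the majorant is integrable,
    typically a compact box; regularity is used on Q only, since the jet vanishes outside Q. *)
Lemma integrable_jet (A : set XT) Ma M (a : XT -> R) (b : 'I_N -> XT -> R) (c : XT -> R) : measurable A ->
  measurable_fun Q a -> (forall i, measurable_fun Q (b i)) -> measurable_fun Q c ->
  (forall p, Q p -> A p -> [/\ `|a p| <= Ma, (forall i, `|b i p| <= M) & `|c p| <= M]) ->
  (forall p, Q p -> ~ A p -> jet a b c p = 0) ->
  0 <= Ma -> 0 <= M ->
  (\int[mu]_(p in A) (major Ma M p)%:E < +oo)%E ->
  mu.-integrable setT (EFin \o jet a b c) /\
  `|\int[mu]_p jet a b c p| <= \int[mu]_(p in A) major Ma M p.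
Proof.
move=> mA ma mb mc bnd out Ma0 M0 fin.
have mj := measurable_jet ma mb mc.
have le p : (`|jet a b c p|%:E <= ((fun p => (major Ma M p)%:E) \_ A) p)%E.
  rewrite patchE; case: ifPn => [/set_mem Ap|/negP Ap].
    have [Qp|Qp] := pselect (Q p).
      by have [? ? ?] := bnd _ Qp Ap; rewrite lee_fin jet_bound.
    by rewrite jet_out// normr0 lee_fin major_ge0.
  have [Qp|Qp] := pselect (Q p); last by rewrite jet_out// normr0.
  by rewrite out// ?normr0// => Ap'; apply: Ap; rewrite mem_set.
have mM : measurable_fun setT ((fun p => (major Ma M p)%:E) \_ A).
  apply/(measurable_restrictT _ _).1 => //; apply: measurable_funTS.
  by apply/measurable_EFinP; exact: measurable_major.
have le2 : (\int[mu]_p `|(EFin \o jet a b c) p| <= \int[mu]_(p in A) (major Ma M p)%:E)%E.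
  rewrite [leRHS]integral_mkcond; apply: ge0_le_integral => //.
  - by apply: measurableT_comp => //; apply/measurable_EFinP.
  - by move=> p _; exact: le.
have ij : mu.-integrable setT (EFin \o jet a b c).
  by apply/integrableP; split; [exact/measurable_EFinP|exact: le_lt_trans le2 fin].
split => //; apply: le_trans (le_normr_Rintegral _ _) _ => //.
rewrite -lee_fin /Rintegral !fineK//.
  rewrite ge0_fin_numE//; apply: integral_ge0 => p _.
  by rewrite lee_fin major_ge0.
by rewrite ge0_fin_numE ?integral_ge0// (le_lt_trans le2).
Qed.

End jets.

(** * Bounds on compact sets, almost everywhere statements and comparison of integrals *)

Lemma compact_fun_bound (R : realType) (E : normedModType R) (K : set E) (f : E -> R) :
  compact K -> (forall p, K p -> {for p, continuous f}) ->
  exists2 M, 0 <= M & forall p, K p -> `|f p| <= M.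
Proof.
move=> cK cf.
have cfK : compact (f @` K).
  apply: continuous_compact => //; apply: continuous_in_subspaceT => p /set_mem; exact: cf.
have [M [_ HM]] := compact_bounded cfK.
exists (`|M| + 1); first by rewrite addr_ge0.
move=> p Kp; apply: (HM (`|M| + 1)); last by exists p.
by rewrite (le_lt_trans (ler_norm M))// ltrDl.
Qed.

Lemma near_eq_continuous (E F : topologicalType) (f h : E -> F) p :
  (\forall q \near p, f q = h q) -> {for p, continuous h} -> {for p, continuous f}.
Proof.
move=> fh ch A; have fp : f p = h p := nbhs_singleton fh.
by rewrite fp => /ch hA; apply: filterS2 fh hA => q /= ->.
Qed.

Lemma Rintegral_dominated d (T : measurableType d) (R : realType)
    (m : {measure set T -> \bar R}) (D : set T) (f : nat -> T -> R) (h k : T -> R) :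
  measurable D -> (forall n, measurable_fun D (f n)) ->
  {ae m, forall x, D x -> f n x @[n --> \oo] --> h x} -> measurable_fun D h ->
  m.-integrable D (EFin \o k) -> {ae m, forall x n, D x -> `|f n x| <= k x} ->
  \int[m]_(x in D) f n x @[n --> \oo] --> \int[m]_(x in D) h x.
Proof.
move=> mD mf fh mh ik fk.
have mEf n : measurable_fun D (EFin \o f n) by exact/measurable_EFinP.
have mEh : measurable_fun D (EFin \o h) by exact/measurable_EFinP.
have fhE : {ae m, forall x, D x -> (EFin \o f n) x @[n --> \oo] --> (EFin \o h) x}.
  apply: ae_mono fh => x fx Dx.
  by apply: cvg_EFin; [exact: nearW|exact: fx].
have fkE : {ae m, forall x n, D x -> (`|(EFin \o f n) x| <= (EFin \o k) x)%E}.
  by apply: ae_mono fk => x fx n Dx; exact: fx.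
have [ih _ cf] := dominated_convergence mD mEf mEh fhE ik fkE.
rewrite /Rintegral; apply: fine_cvg; rewrite fineK//.
exact: integrable_fin_num.
Qed.

Lemma ae_forall_nat d (T : measurableType d) (R : realType) (m : {measure set T -> \bar R})
    (P : nat -> T -> Prop) :
  (forall n, {ae m, forall x, P n x}) -> {ae m, forall x n, P n x}.
Proof.
move=> aP.
have : m.-negligible (\bigcup_n ~` [set x | P n x]) by exact: negligible_bigcup.
by apply: negligibleS => x /= /existsNP[n Pn]; exists n.
Qed.

Lemma ae_exists_in (R : realType) (P : R -> Prop) (a b : R) :
  {ae @lebesgue_measure R, forall t, P t} -> a < b -> exists2 t, a < t < b & P t.
Proof.
move=> [A [mA A0 PA]] ab; apply: contrapT => nP.
have abA : `]a, b[%classic `<=` A.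
  move=> t; rewrite /= in_itv/= => tab; apply: PA => Pt; apply: nP.
  by exists t.
have : (lebesgue_measure `]a, b[%classic <= lebesgue_measure A :> \bar R)%E.
  by apply: le_measure => //; rewrite inE.
rewrite A0 lebesgue_measure_itv/= lte_fin ab -EFinB lee_fin subr_le0.
by rewrite leNgt ab.
Qed.

Lemma derive_time (R : realType) (E : normedModType R) (theta theta' : R -> R) (p v : E * R) :
  (forall t, is_derive t (1:R) theta (theta' t)) ->
  differentiable (fun p : E * R => theta p.2) p /\
  'D_v (fun p : E * R => theta p.2) p = v.2 * theta' p.2.
Proof.
move=> dtheta.
have d1theta t : differentiable theta t by apply/derivable1_diffP; case: (dtheta t).
have thE : (fun p : E * R => theta p.2) =
    fun p => theta ((snd : {linear (E * R)%type -> R}) p + 0).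
  by apply/funext => q; rewrite addr0.
have csnd : continuous (snd : E * R -> R) by move=> q; exact: cvg_snd.
rewrite thE; split; first exact: differentiable_comp_affine.
rewrite derive_comp_affine /= addr0 deriveE//.
rewrite -[v.2 in LHS]mulr1 -[v.2 * 1]/(v.2 *: (1:R)) linearZ_LR -deriveE//.
by have [_ ->] := dtheta p.2.
Qed.

Lemma ae_le_Rintegral d (T : measurableType d) (R : realType) (m : {measure set T -> \bar R})
    (f h : T -> R) : m.-integrable setT (EFin \o f) -> m.-integrable setT (EFin \o h) ->
  (forall x, 0 <= f x) -> (forall x, 0 <= h x) -> {ae m, forall x, f x <= h x} ->
  \int[m]_x f x <= \int[m]_x h x.
Proof.
move=> fi hi f0 h0 fh; apply: fine_le; [exact: integrable_fin_num|exact: integrable_fin_num|].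
apply: ae_ge0_le_integral => //.
- by move=> x _; rewrite lee_fin.
- exact: measurable_int fi.
- by move=> x _; rewrite lee_fin.
- exact: measurable_int hi.
- by apply: ae_mono fh => x fhx _; rewrite lee_fin.
Qed.

Lemma family_bound (R : realType) (I : finType) (Y : Type) (P : set Y) (f : I -> Y -> R) :
  (forall i, exists2 M, 0 <= M & forall p, P p -> `|f i p| <= M) ->
  exists2 M, 0 <= M & forall i p, P p -> `|f i p| <= M.
Proof.
move=> H; have /choice[M HM] : forall i, exists M, 0 <= M /\ forall p, P p -> `|f i p| <= M.
  by move=> i; have [M] := H i; exists M.
have M0 i : 0 <= M i by case: (HM i).
exists (\sum_i M i) => [|i p Pp]; first by rewrite sumr_ge0.
by rewrite (le_trans ((HM i).2 p Pp))// (bigD1 i)//= lerDl sumr_ge0.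
Qed.

(** From a f - b h = f (a - b) + (f - h) b. It serves twice: with two different slices a, b for
    continuity in time, and with a = b for comparing two test functions. *)
Lemma Rintegral_prod_diff d (Y : measurableType d) (R : realType)
    (m : {measure set Y -> \bar R}) (D : set Y) (a b f h : Y -> R) M eps : measurable D ->
  m.-integrable D (EFin \o a) -> m.-integrable D (EFin \o b) ->
  measurable_fun D f -> measurable_fun D h -> 0 <= M -> 0 <= eps ->
  (forall x, D x -> `|f x| <= M) -> (forall x, D x -> `|h x| <= M) ->
  (forall x, D x -> `|f x - h x| <= eps) ->
  [/\ m.-integrable D (EFin \o (fun x => a x * f x)),
      m.-integrable D (EFin \o (fun x => b x * h x)) &
   `|\int[m]_(x in D) (a x * f x) - \int[m]_(x in D) (b x * h x)| <=
  M * \int[m]_(x in D) `|a x - b x| + eps * \int[m]_(x in D) `|b x| ].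
Proof.
move=> mD ia ib mf mh M0 eps0 fM hM fh.
have iM (c k : Y -> R) : m.-integrable D (EFin \o c) -> measurable_fun D k ->
    (forall x, D x -> `|k x| <= M) -> m.-integrable D (EFin \o (fun x => c x * k x)).
  move=> ic mk kM; have icM := integrableZl mD M ic.
  apply: le_integrable icM => //.
    apply/measurable_EFinP; apply: measurable_funM => //.
    by apply/measurable_EFinP; exact: measurable_int ic.
  move=> x Dx; rewrite /= lee_fin !normrM mulrC ler_wpM2r//.
  by rewrite (ger0_norm M0); exact: kM.
have iaf := iM _ _ ia mf fM; have ibh := iM _ _ ib mh hM.
have iab : m.-integrable D (EFin \o (fun x => a x - b x)).
  by have := integrableB mD ia ib; apply: eq_integrable.
have inab := integrable_norm iab; have inb := integrable_norm ib.
have i1 := integrableZl mD M inab; have i2 := integrableZl mD eps inb.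
split => //; rewrite -RintegralB//.
have id : m.-integrable D (EFin \o (fun x => a x * f x - b x * h x)).
  by have := integrableB mD iaf ibh; apply: eq_integrable.
apply: (le_trans (le_normr_Rintegral mD id)).
rewrite -!RintegralZl// -RintegralD//.
apply: le_Rintegral => //.
- exact: integrable_norm.
- by have := integrableD mD i1 i2; apply: eq_integrable.
move=> x Dx.
have -> : a x * f x - b x * h x = f x * (a x - b x) + (f x - h x) * b x by ring.
rewrite (le_trans (ler_normD _ _))// !normrM lerD//.
  by rewrite ler_wpM2r// fM.
by rewrite ler_wpM2r// fh.
Qed.

(** * The equation between two times and up to the initial time *)

Section pde.
Context {R : realType} {N : nat}.
Local Notation X := 'rV[R]_N.
Local Notation XT := (X * measurableTypeR R)%type.
Local Notation lam := (@lebesgue_rV R N).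
Local Notation ell := (@lebesgue_measure R).
Local Notation mu := (@lebesgue_xt R N).
Variables (Omega : set X) (T : \bar R).
Hypotheses (oO : open Omega) (T0 : (0 < T)%E).
Local Notation Q := (cylinder Omega T : set XT).
(* [w], [g] and [d i] stand for |u|, |Du|^q and D_i u, extended by 0 outside
   [Q]; then |d i| <= 1 + g because q > 1. *)
Variables (w g : XT -> R) (d : 'I_N -> XT -> R).
Hypotheses (mw : measurable_fun setT w) (mg : measurable_fun setT g)
  (md : forall i, measurable_fun setT (d i)).
Hypotheses (w0 : forall p, 0 <= w p) (g0 : forall p, 0 <= g p)
  (dg : forall i p, `|d i p| <= 1 + g p).
Hypotheses (wQ : forall p, ~ Q p -> w p = 0) (gQ : forall p, ~ Q p -> g p = 0)
  (dQ : forall i p, ~ Q p -> d i p = 0).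
Hypotheses (iw : forall K, compact K -> K `<=` Q -> (\int[mu]_(p in K) (w p)%:E < +oo)%E)
  (ig : forall K, compact K -> K `<=` Q -> (\int[mu]_(p in K) (g p)%:E < +oo)%E).
Local Notation J := (jet w g d).
Hypothesis E1 : forall phi, Cc_infty Q phi ->
  \int[mu]_p J (dt phi) (fun i => dx i phi) phi p = 0.

Let oQ : open Q. Proof. exact: cylinder_open. Qed.
Let mQ : measurable Q. Proof. exact: open_xt_measurable. Qed.

Let Jout a b c p : ~ Q p -> J a b c p = 0.
Proof. exact: jet_out. Qed.

Let iJ := integrable_jet mQ mw mg md w0 g0 dg wQ gQ dQ.

Let cmQ (f : X * R -> R) : (forall p, Q p -> {for p, continuous f}) ->
  measurable_fun Q (f : XT -> R).
Proof. exact: continuous_measurable_xt. Qed.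

(** The mass enters through its product with [Ma]: when [Ma = 0] the product is 0 even if the mass
    is infinite. *)
Lemma major_finite (A : set XT) Ma M : measurable A -> (mu A < +oo)%E ->
  (Ma%:E * \int[mu]_(p in A) (w p)%:E < +oo)%E -> (\int[mu]_(p in A) (g p)%:E < +oo)%E ->
  0 <= Ma -> 0 <= M -> (\int[mu]_(p in A) (major w g Ma M p)%:E < +oo)%E.
Proof.
move=> mA A1 wA gA Ma0 M0.
pose c1 := M * N%:R; pose c2 := M * (N%:R + 1).
have c10 : 0 <= c1 by exact: mulr_ge0.
have c20 : 0 <= c2 by rewrite mulr_ge0// addr_ge0.
have mwA : measurable_fun A (EFin \o w) by apply/measurable_EFinP; exact: measurable_funTS.
have mgA : measurable_fun A (EFin \o g) by apply/measurable_EFinP; exact: measurable_funTS.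
have -> : (\int[mu]_(p in A) (major w g Ma M p)%:E =
    \int[mu]_(p in A) (Ma%:E * (w p)%:E + (c1%:E + c2%:E * (g p)%:E)))%E.
  apply: eq_integral => p _; rewrite -!EFinM -!EFinD /major /c1 /c2.
  by congr EFin; ring.
have zE (c : R) f : measurable_fun A (EFin \o f) -> (forall p, 0 <= f p) -> 0 <= c ->
    (\int[mu]_(p in A) (c%:E * (f p)%:E) = c%:E * \int[mu]_(p in A) (f p)%:E)%E.
  by move=> mf f0 c0; apply: ge0_integralZl => // p _; rewrite lee_fin.
rewrite ge0_integralD//.
- rewrite zE//; apply: lte_add_pinfty => //.
  rewrite ge0_integralD//; last 2 first.
  + by move=> p _; rewrite -EFinM lee_fin mulr_ge0.
  + exact: measurable_funeM.
  rewrite integral_cst// zE//.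
  apply: lte_add_pinfty; apply: lte_mul_pinfty => //.
- by move=> p _; rewrite -EFinM lee_fin mulr_ge0.
- exact: measurable_funeM.
- by move=> p _; rewrite -EFinM -EFinD lee_fin addr_ge0// mulr_ge0.
- by apply: emeasurable_funD => //; exact: measurable_funeM.
Qed.

Lemma compact_major_finite K Ma M : compact K -> K `<=` Q -> 0 <= Ma -> 0 <= M ->
  (\int[mu]_(p in K) (major w g Ma M p)%:E < +oo)%E.
Proof.
move=> cK KQ Ma0 M0; apply: major_finite => //.
- exact: compact_xt_measurable.
- exact: compact_xt_finite.
- by apply: lte_mul_pinfty => //; exact: iw.
- exact: ig.
Qed.

Lemma integrable_jet_compact K (a : XT -> R) (b : 'I_N -> XT -> R) (c : XT -> R) :
  compact K -> K `<=` Q ->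
  (forall p, Q p -> {for p, continuous (a : X * R -> R)}) ->
  (forall i p, Q p -> {for p, continuous (b i : X * R -> R)}) ->
  (forall p, Q p -> {for p, continuous (c : X * R -> R)}) ->
  (forall p, Q p -> ~ K p -> J a b c p = 0) ->
  mu.-integrable setT (EFin \o J a b c).
Proof.
move=> cK KQ ca cb cc out.
have [Ma Ma0 aM] := compact_fun_bound cK (fun p Kp => ca p (KQ p Kp)).
have [Mc Mc0 cM] := compact_fun_bound cK (fun p Kp => cc p (KQ p Kp)).
have [Mb Mb0 bM] := family_bound (fun i => compact_fun_bound cK (fun p Kp => cb i p (KQ p Kp))).
have [] // := @iJ K Ma (Mc + Mb) a b c.
- exact: compact_xt_measurable.
- exact: cmQ.
- by move=> i; apply: cmQ => p; exact: cb.
- exact: cmQ.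
- move=> p _ Kp; split; [exact: aM| |].
  + by move=> i; rewrite (le_trans (bM i p Kp))// lerDr.
  + by rewrite (le_trans (cM p Kp))// lerDl.
- exact: addr_ge0.
- by apply: compact_major_finite => //; exact: addr_ge0.
Qed.

(** The jet is linear in the test function, so the error is the jet of the difference, at most eps
    times the integral of [major w g 1 1] over a compact K fixed in advance. *)
Lemma weak_C1 (phi : X * R -> R) : (forall p, differentiable phi p) ->
  (forall j, continuous ('D_(basis_xt j) phi)) -> compact_support_in Q phi ->
  \int[mu]_p J (dt phi) (fun i => dx i phi) phi p = 0.
Proof.
move=> dphi Dphi sphi.
have cphi : continuous phi by move=> p; apply: differentiable_continuous.
have [K [cK KQ phiK app]] := smooth_approximation (@coordinates_xt R N) (@proper_xt R N) oQ cphi sphi.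
have Dt : continuous (dt phi) by exact: (Dphi None).
have Dx i : continuous (dx i phi) by exact: (Dphi (Some i)).
have clK : closed K by exact: compact_closed.
have ij f : (forall p, ~ K p -> f p = 0) -> continuous f -> continuous (dt f) ->
    (forall i, continuous (dx i f)) ->
    mu.-integrable setT (EFin \o J (dt f) (fun i => dx i f) f).
  move=> fK cf cdt cdx; apply: (integrable_jet_compact cK KQ) => //.
  - by move=> p _; exact: cdt.
  - by move=> i p _; exact: cdx.
  - by move=> p _; exact: cf.
  - move=> p Qp Kp; rewrite /jet fK// /dt (derive_off_support _ clK fK Kp) !mulr0 addr0 add0r.
    by rewrite big1// => i _; rewrite /dx (derive_off_support _ clK fK Kp) mulr0.
have iphi := ij _ phiK cphi Dt Dx.
pose I := \int[mu]_(p in K) major w g 1 1 p.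
apply/eqP; rewrite -normr_le0; apply/ler_addgt0Pl => e e0; rewrite addr0.
have I0 : 0 <= I by apply: Rintegral_ge0 => p _; exact: major_ge0.
pose eps := e / (I + 1).
have I10 : 0 < I + 1 by rewrite ltr_wpDl.
have eps0 : 0 < eps by rewrite divr_gt0.
have [psi [[Cpsi spsi] psiK dist _ /(_ dphi Dphi) Ddist]] := app eps eps0.
have Cpsi1 := (Cpsi 2%N).
have cpsi : continuous psi by exact: (Cpsi 0%N).
have Dpsi v : continuous ('D_v psi) by exact: ((Cpsi 1%N).2 v).
have dpsi p : differentiable psi p by exact: (Cpsi 1%N).1.
have ipsi := ij _ psiK cpsi (Dpsi _) (fun i => Dpsi _).
have Epsi := E1 (conj Cpsi spsi).
rewrite -[X in `|X|]subr0 -Epsi -RintegralB//.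
pose h p := phi p - psi p.
have dh p v : 'D_v h p = 'D_v phi p - 'D_v psi p by apply: deriveB; exact: diff_derivable.
have -> : \int[mu]_p (J (dt phi) (fun i => dx i phi) phi p - J (dt psi) (fun i => dx i psi) psi p)
    = \int[mu]_p J (dt h) (fun i => dx i h) h p.
  apply: eq_Rintegral => p _; rewrite /jet /dt dh /h.
  rewrite [X in _ = _ + X + _](_ : _ = \sum_i d i p * dx i phi p - \sum_i d i p * dx i psi p).
    by ring.
  by rewrite -sumrB; apply: eq_bigr => i _; rewrite /dx dh mulrBr.
have hK p : ~ K p -> h p = 0 by move=> Kp; rewrite /h phiK// psiK// subrr.
have ch : continuous h by move=> p; exact: (cvgB (cphi p) (cpsi p)).
have cDh v j : v = basis_xt j -> continuous ('D_v h).
  move=> ->; rewrite (_ : 'D_(basis_xt j) h = fun p => 'D_(basis_xt j) phi p - 'D_(basis_xt j) psi p).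
    by move=> p; exact: (cvgB (Dphi j p) (Dpsi _ p)).
  by apply/funext => p; rewrite dh.
have [] // := @iJ K eps eps (dt h) (fun i => dx i h) h.
- exact: compact_xt_measurable.
- by apply: cmQ => p _; exact: (cDh _ None).
- by move=> i; apply: cmQ => p _; exact: (cDh _ (Some i)).
- by apply: cmQ => p _; exact: ch.
- move=> p _ _; split.
  + by rewrite /dt dh distrC; exact: (Ddist p None).
  + by move=> i; rewrite /dx dh distrC; exact: (Ddist p (Some i)).
  + by rewrite /h distrC.
- move=> p Qp Kp; rewrite /jet hK// /dt (derive_off_support _ clK hK Kp) !mulr0 addr0 add0r.
  by rewrite big1// => i _; rewrite /dx (derive_off_support _ clK hK Kp) mulr0.
- exact: ltW.
- exact: ltW.
- by apply: compact_major_finite => //; exact: ltW.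
move=> _ /le_trans; apply.
have -> : \int[mu]_(p in K) major w g eps eps p = eps * I.
  rewrite -RintegralZl//.
  - by apply: eq_Rintegral => p _; rewrite /major; ring.
  - exact: compact_xt_measurable.
  apply/integrableP; split.
    by apply/measurable_EFinP; apply: measurable_funTS; exact: measurable_major.
  under eq_integral do rewrite gee0_abs ?lee_fin ?major_ge0//.
  exact: compact_major_finite.
by rewrite /eps mulrAC ler_pdivrMr// ler_pM2l// lerDl.
Qed.

(* the support of such a test function is compact in space only *)
Definition slab_test (L : set X) (phi : X * R -> R) :=
  [/\ compact L, L `<=` Omega, forall p, Q p -> differentiable phi p,
      forall j p, Q p -> {for p, continuous ('D_(basis_xt j) phi)} &
      forall p, Q p -> ~ L p.1 -> phi p = 0].

Definition slab (s t : R) : set XT := [set p | s < p.2 < t].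

Lemma measurable_slab s t : measurable (slab s t).
Proof.
apply: (@open_xt_measurable R N [set p | s < p.2 < t]).
rewrite (_ : [set _ | _] = snd @^-1` (`]s, t[%classic : set R)).
  by apply: open_comp => [p _|]; [exact: cvg_snd|exact: interval_open].
by apply/seteqP; split=> p; rewrite /= in_itv.
Qed.

Lemma slab_test_derive L phi v p : slab_test L phi -> Q p -> ~ L p.1 -> 'D_v phi p = 0.
Proof.
move=> [cL _ _ _ phi0] Qp Lp; rewrite (@near_eq_derive _ _ _ _ (cst (0:R))) ?derive_cst//.
have cl : closed L by exact: compact_closed.
have oA : open (Q `&` fst @^-1` (~` L)).
  apply: openI => //; apply: open_comp; last exact: closed_openC.
  by move=> q _; exact: cvg_fst.
by have := open_nbhs_nbhs (conj oA (conj Qp Lp)); apply: filterS => q [] /phi0.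
Qed.

Let H phi := J (dt phi) (fun i => dx i phi) phi.

Lemma slab_test_jet0 L phi p : slab_test L phi -> ~ L p.1 -> H phi p = 0.
Proof.
move=> Lphi Lp; have [Qp|Qp] := pselect (Q p); last by rewrite /H Jout.
have [_ _ _ _ phi0] := Lphi.
rewrite /H /jet phi0// /dt (slab_test_derive _ Lphi)// !mulr0 addr0 add0r.
by rewrite big1// => i _; rewrite /dx (slab_test_derive _ Lphi)// mulr0.
Qed.

Let slab_cont L phi : slab_test L phi -> forall p, Q p -> {for p, continuous phi}.
Proof. by move=> [_ _ dphi _ _] p /dphi; exact: differentiable_continuous. Qed.

(** What slice integrals require. Initial traces are tested against merely continuous functions, so
    differentiability is not asked. *)
Definition cont_test (L : set X) (phi : X * R -> R) :=
  [/\ compact L, L `<=` Omega, forall p, Q p -> {for p, continuous phi} &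
      forall p, Q p -> ~ L p.1 -> phi p = 0].

Lemma slab_cont_test L phi : slab_test L phi -> cont_test L phi.
Proof. by move=> Lphi; have [cL LO _ _ phi0] := Lphi; split => //; exact: slab_cont Lphi. Qed.

Lemma lift_cont_test L (f : X -> R) : compact L -> L `<=` Omega -> continuous f ->
  (forall x, ~ L x -> f x = 0) -> cont_test L (fun p => f p.1).
Proof.
move=> cL LO cf f0; split => // [p _|p _]; last exact: f0.
by apply: (@continuous_comp _ _ _ fst f); [exact: cvg_fst|exact: cf].
Qed.

Lemma measurable_weight (phi : X * R -> R) : (forall p, Q p -> {for p, continuous phi}) ->
  measurable_fun setT (fun p : XT => w p * phi p).
Proof.
move=> cphi; rewrite (_ : (fun p => _) = J (fun p => - phi p) (fun _ => cst 0) (cst 0)).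
  apply: (measurable_jet mQ mw mg md wQ gQ dQ) => //.
  by apply: (cmQ (f := fun p => - phi p)) => p Qp; exact: (cvgN (cphi p Qp)).
by apply/funext => p; rewrite /jet big1 => [|i _]; [rewrite /=; ring|rewrite /= mulr0].
Qed.

Lemma integrable_weight L (phi : X * R -> R) (k : R -> R) s tau : cont_test L phi ->
  0 < s -> (tau%:E < T)%E -> continuous k ->
  (forall t, ~~ (s <= t <= tau) -> k t = 0) ->
  mu.-integrable setT (fun p => (k p.2 * (w p * phi p))%:E).
Proof.
move=> [cL LO cphi phi0] s0 tauT ck k0.
have WE : (fun p => k p.2 * (w p * phi p)) = J (fun p => - (k p.2 * phi p))
    (fun _ => cst 0) (cst 0).
  apply/funext => p; rewrite /jet big1 => [|i _]; first by rewrite /=; ring.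
  by rewrite /= mulr0.
have ckp : continuous (fun p : X * R => k p.2).
  by move=> p; apply: (@continuous_comp _ _ _ snd k); [exact: cvg_snd|exact: ck].
rewrite -[X in integrable _ _ X]/(EFin \o (fun p => k p.2 * (w p * phi p))) WE.
have KQ : L `*` `[s, tau]%classic `<=` Q by exact: box_cylinder.
apply: (integrable_jet_compact (compact_box (s := s) (t := tau) cL) KQ).
- by move=> p Qp; exact: (cvgN (cvgM (ckp p) (cphi p Qp))).
- by move=> i p Qp; exact: cvg_cst.
- by move=> p Qp; exact: cvg_cst.
- move=> p Qp Kp; rewrite -WE; have [Lp|Lp] := pselect (L p.1); last first.
    by rewrite phi0// !mulr0.
  by rewrite k0 ?mul0r//; apply/negP => st; apply: Kp; split => //; rewrite /= in_itv.
Qed.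

(** Multiplying by theta(t), supported in [s, tau], makes the support compact in Q. The result is
    the distributional form of d/dt (integral of w phi) = - (integral of H). *)
Lemma weak_separated L phi (theta theta' : R -> R) s tau : slab_test L phi -> 0 < s -> (tau%:E < T)%E ->
  (forall t, is_derive t (1:R) theta (theta' t)) -> continuous theta' ->
  (forall t, ~~ (s <= t <= tau) -> theta t = 0 /\ theta' t = 0) ->
  [/\ mu.-integrable setT (fun p => (theta p.2 * H phi p)%:E),
      mu.-integrable setT (fun p => (theta' p.2 * (w p * phi p))%:E) &
      \int[mu]_p (theta' p.2 * (w p * phi p)) = \int[mu]_p (theta p.2 * H phi p)].
Proof.
move=> Lphi s0 tauT dtheta ctheta' theta0.
have [cL LO dphi Dphi phi0] := Lphi.
pose K := L `*` `[s, tau]%classic.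
have cK : compact K by exact: compact_box.
have KQ : K `<=` Q by exact: box_cylinder.
pose th (p : X * R) := theta p.2.
have dth p : differentiable th p by have [] := derive_time p p dtheta.
have Dth p v : 'D_v th p = v.2 * theta' p.2 by have [] := derive_time p v dtheta.
have cth : continuous th by move=> p; exact: differentiable_continuous.
have cth' : continuous (fun p : X * R => theta' p.2).
  by move=> p; apply: (@continuous_comp _ _ _ snd theta'); [exact: cvg_snd|exact: ctheta'].
(* The values of phi outside Q are arbitrary, so the product is cut to 0 there before [C1_extension]
   is used. *)
pose Phi p := if `[< Q p >] then phi p * th p else 0.
have PhiE p : Q p -> \forall q \near p, Phi q = (phi * th) q.
  move=> Qp; have := open_nbhs_nbhs (conj oQ Qp); apply: filterS => q Qq.
  by rewrite /Phi asboolT.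
have DPhi p v : Q p -> 'D_v Phi p = phi p * (v.2 * theta' p.2) + th p * 'D_v phi p.
  move=> Qp; rewrite (near_eq_derive _ (PhiE p Qp)) deriveM ?Dth//.
    by apply: diff_derivable; exact: dphi.
  exact: diff_derivable.
have PhiK p : ~ K p -> Phi p = 0.
  move=> Kp; rewrite /Phi; case: asboolP => // Qp.
  have [Lp|Lp] := pselect (L p.1); last by rewrite phi0// mul0r.
  rewrite /th (theta0 p.2 _).1 ?mulr0//; apply/negP => st; apply: Kp.
  by split => //; rewrite /= in_itv.
have [] := @C1_extension _ _ Q K Phi _ (@basis_xt R N) oQ cK KQ PhiK.
- by move=> p Qp; apply: (near_eq_differentiable (PhiE p Qp)); apply: differentiableM => //; exact: dphi.
- move=> j p Qp.
  apply: (@near_eq_continuous _ _ _ (fun q => phi q * ((basis_xt j).2 * theta' q.2) + th q * 'D_(basis_xt j) phi q)).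
    by have := open_nbhs_nbhs (conj oQ Qp); apply: filterS => q /DPhi.
  have c1 : {for p, continuous (fun q : X * R => (basis_xt j).2 * theta' q.2)}.
    by apply: (@cvgM _ _ _ _ (fun=> (basis_xt j).2)); [exact: cvg_cst|exact: cth'].
  exact: (cvgD (cvgM (slab_cont Lphi Qp) c1) (cvgM (cth p) (Dphi j p Qp))).
move=> dPhi DPhic sPhi; have E := weak_C1 dPhi DPhic sPhi.
have outK p : Q p -> ~ K p -> H phi p * th p = 0.
  move=> Qp Kp; have [Lp|Lp] := pselect (L p.1); last first.
    by rewrite (slab_test_jet0 Lphi)// mul0r.
  rewrite /th (theta0 p.2 _).1 ?mulr0//.
  by apply/negP => st; apply: Kp; split => //; rewrite /= in_itv.
have HE : (fun p => theta p.2 * H phi p) = J (fun p => th p * dt phi p)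
    (fun i p => th p * dx i phi p) (fun p => th p * phi p).
  apply/funext => p; rewrite /H /jet /th !mulrDr mulr_sumr; congr (_ + _ + _).
  - by ring.
  - by apply: eq_bigr => i _; rewrite mulrCA.
  - by ring.
have i1 : mu.-integrable setT (fun p => (theta p.2 * H phi p)%:E).
  rewrite -[X in integrable _ _ X]/(EFin \o (fun p => theta p.2 * H phi p)) HE.
  apply: (integrable_jet_compact cK KQ).
  - by move=> p Qp; exact: (cvgM (cth p) (Dphi None p Qp)).
  - by move=> i p Qp; exact: (cvgM (cth p) (Dphi (Some i) p Qp)).
  - by move=> p Qp; exact: (cvgM (cth p) (slab_cont Lphi Qp)).
  - by move=> p Qp Kp; rewrite -HE mulrC (outK p Qp Kp).
have i2 : mu.-integrable setT (fun p => (theta' p.2 * (w p * phi p))%:E).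
  by apply: (@integrable_weight L phi theta' s tau) => //; [exact: slab_cont_test|move=> t /theta0[]].
split => //; apply/eqP; rewrite -subr_eq0 -oppr_eq0 opprB; apply/eqP.
rewrite -RintegralB// -[RHS]E; apply: eq_Rintegral => p _.
have [Qp|Qp] := pselect (Q p); last first.
  by rewrite !Jout// /H Jout// wQ//; ring.
rewrite /H /jet /dt DPhi//= [X in _ = _ + X + _](_ : _ = th p * \sum_i d i p * dx i phi p).
  rewrite /Phi asboolT// /th; ring.
rewrite mulr_sumr; apply: eq_bigr => i _; rewrite /dx DPhi//=.
by ring.
Qed.

(** Covers s = 0: the slab is open in time, so bounds on the test are asked only inside Q, where its
    derivatives exist. *)
Lemma slab_integrable L phi s tau Ma M : slab_test L phi ->
  (forall p, Q p -> slab s tau p -> L p.1 ->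
    [/\ `|dt phi p| <= Ma, forall i, `|dx i phi p| <= M & `|phi p| <= M]) ->
  0 <= Ma -> 0 <= M ->
  (\int[mu]_(p in L `*` `[s, tau]%classic) (major w g Ma M p)%:E < +oo)%E ->
  mu.-integrable (slab s tau) (EFin \o H phi) /\
  `|\int[mu]_(p in slab s tau) H phi p| <=
    \int[mu]_(p in L `*` `[s, tau]%classic) major w g Ma M p.
Proof.
move=> Lphi bnd Ma0 M0 fin; have [cL LO dphi Dphi phi0] := Lphi.
pose S := slab s tau; have mS : measurable S by exact: measurable_slab.
have HE : (H phi) \_ S = J ((dt phi : XT -> R) \_ S) (fun i => (dx i phi : XT -> R) \_ S) ((phi : XT -> R) \_ S).
  apply/funext => p; rewrite /H /jet !patchE; case: ifPn => Sp.
    by congr (_ + _ + _); apply: eq_bigr => i _; rewrite patchE Sp.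
  rewrite !mulr0 addr0 add0r big1// => i _.
  by rewrite patchE (negbTE Sp) mulr0.
have mres (f : X * R -> R) : (forall p, Q p -> {for p, continuous f}) ->
    measurable_fun Q ((f : XT -> R) \_ S).
  move=> cf; apply: (measurable_restrict (f : XT -> R) mS mQ).1.
  by apply: measurable_funS (cmQ cf) => // p [].
have [] // := @iJ (L `*` `[s, tau]%classic) Ma M ((dt phi : XT -> R) \_ S)
   (fun i => (dx i phi : XT -> R) \_ S) ((phi : XT -> R) \_ S).
- exact: (compact_xt_measurable (compact_box (s := s) (t := tau) cL)).
- exact: (mres _ (Dphi None)).
- by move=> i; exact: (mres _ (Dphi (Some i))).
- exact: (mres _ (slab_cont Lphi)).
- move=> p Qp [Lp _]; rewrite !patchE; case: ifPn => Sp.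
    have [b1 b2 b3] := bnd p Qp (set_mem Sp) Lp; split => // i.
    by rewrite patchE Sp.
  by rewrite normr0; split => // i; rewrite patchE (negbTE Sp) normr0.
- move=> p Qp Kp; rewrite -HE patchE; case: ifPn => // /set_mem Sp.
  apply: (slab_test_jet0 Lphi) => Lp; apply: Kp; split => //=.
  by case/andP: Sp => /ltW s1 /ltW s2; rewrite in_itv/= s1.
rewrite -HE => i1 i2; split; last by rewrite Rintegral_mkcond.
by apply/integrable_mkcond => //; rewrite restrict_EFin.
Qed.

Lemma slab_integrable_in L phi s tau : slab_test L phi -> 0 < s -> (tau%:E < T)%E ->
  mu.-integrable (slab s tau) (EFin \o H phi).
Proof.
move=> Lphi s0 tauT; have [cL LO dphi Dphi phi0] := Lphi.
have cK := compact_box (s := s) (t := tau) cL.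
have KQ : L `*` `[s, tau]%classic `<=` Q by exact: box_cylinder.
have [Ma Ma0 aM] := compact_fun_bound cK (fun p Kp => Dphi None p (KQ p Kp)).
have [Mc Mc0 cM] := compact_fun_bound cK (fun p Kp => slab_cont Lphi (KQ p Kp)).
have [Mb Mb0 bM] := family_bound
  (fun i : 'I_N => compact_fun_bound cK (fun p Kp => Dphi (Some i) p (KQ p Kp))).
have [] // := @slab_integrable L phi s tau Ma (Mc + Mb) => //.
- move=> p Qp Sp Lp; have Kp : (L `*` `[s, tau]%classic) p.
    by split => //=; case/andP: Sp => /ltW s1 /ltW s2; rewrite in_itv/= s1.
  split; [exact: aM| |].
  + by move=> i; rewrite (le_trans (bM i p Kp))// lerDr.
  + by rewrite (le_trans (cM p Kp))// lerDl.
- exact: addr_ge0.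
- by apply: compact_major_finite => //; exact: addr_ge0.
Qed.

Let F phi (t : R) := \int[lam]_x (w (x, t) * phi (x, t)).

(* Test with phi * theta where theta increases to the indicator of (s, tau): its
   derivative is a bump at s minus a bump at tau, against which the slice
   integral of w * phi tends to its Lebesgue values. *)
Lemma slab_values L phi s tau cs ct : slab_test L phi -> 0 < s -> s < tau -> (tau%:E < T)%E ->
  lebesgue_value (F phi) s cs -> lebesgue_value (F phi) tau ct ->
  cs - ct = \int[mu]_(p in slab s tau) H phi p.
Proof.
move=> Lphi s0 stau tauT Fs Ft; have [cL LO dphi Dphi phi0] := Lphi.
have [S [k [C [C0 HS]]]] := @bump_exists R.
(* Half the length of the slab: with widths at most D, the rise after s ends before the descent to
   tau begins. *)
pose D := (tau - s) / 2; have D0 : 0 < D by rewrite divr_gt0// subr_gt0.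
pose del n := D * n.+1%:R^-1.
have del0 n : 0 < del n by rewrite mulr_gt0// invr_gt0.
have delsmall d0 : 0 < d0 -> \forall n \near \oo, del n < d0.
  move=> d00; have dD : 0 < d0 / D by rewrite divr_gt0.
  have := near_infty_natSinv_lt (PosNum dD); apply: filterS => n /=.
  by rewrite /del ltr_pdivlMr// mulrC.
have delD n : del n <= D by rewrite ler_piMr ?(ltW D0)// invf_le1// ler1n.
have sdel n : s + del n <= tau - del n by have := delD n; rewrite /D; lra.
pose th n t := S s (del n) t - S (tau - del n) (del n) t.
pose th' n t := k s (del n) t - k (tau - del n) (del n) t.
have dth n t : is_derive t (1:R) (th n) (th' n t).
  have [d1 _ _ _ _] := HS s (del n) (del0 n).
  have [d2 _ _ _ _] := HS (tau - del n) (del n) (del0 n).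
  exact: is_deriveB.
have cth' n : continuous (th' n).
  have [_ [_ c1] _ _ _] := HS s (del n) (del0 n).
  have [_ [_ c2] _ _ _] := HS (tau - del n) (del n) (del0 n).
  by move=> t; exact: (cvgB (c1 t) (c2 t)).
have k1 n t : ~~ (s <= t <= tau) -> k s (del n) t = 0.
  have [_ _ _ k0 _] := HS s (del n) (del0 n).
  move=> st; apply: k0; apply: contra st => /andP[t1 t2].
  by have := sdel n; have := del0 n; move: (del n) t1 t2 => a *; apply/andP; split; lra.
have k2 n t : ~~ (s <= t <= tau) -> k (tau - del n) (del n) t = 0.
  have [_ _ _ k0 _] := HS (tau - del n) (del n) (del0 n).
  move=> st; apply: k0; apply: contra st => /andP[t1 t2].
  by have := sdel n; have := del0 n; move: (del n) t1 t2 => a *; apply/andP; split; lra.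
have th0 n t : ~~ (s < t < tau) -> th n t = 0.
  have [_ _ _ _ [a1 a2 _ _]] := HS s (del n) (del0 n).
  have [_ _ _ _ [b1 b2 _ _]] := HS (tau - del n) (del n) (del0 n).
  have d1 := sdel n; have d2 := del0 n.
  rewrite negb_and -!leNgt => /orP[ts|ts]; rewrite /th.
    by rewrite a1// b1 ?subrr//; move: (del n) d1 d2 => a *; lra.
  by rewrite a2 ?b2 ?subrr//; move: (del n) d1 d2 => a *; lra.
have th0' n t : ~~ (s <= t <= tau) -> th n t = 0 /\ th' n t = 0.
  move=> st; split; last by rewrite /th' k1// k2// subrr.
  by apply: th0; apply: contra st => /andP[/ltW -> /ltW ->].
have th1 n t : `|th n t| <= 1.
  have [_ _ _ _ [_ _ a _]] := HS s (del n) (del0 n).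
  have [_ _ _ _ [_ _ b _]] := HS (tau - del n) (del n) (del0 n).
  move: (a t) (b t); rewrite /th ler_norml; move: (S _ _ _) (S _ _ _) => x y.
  by move=> /andP[? ?] /andP[? ?]; apply/andP; split; lra.
have W n := weak_separated Lphi s0 tauT (dth n) (cth' n) (th0' n).
have mwphi := measurable_weight (slab_cont Lphi).
have mF : measurable_fun setT (F phi : measurableTypeR R -> R) by exact: measurable_slice_integral mwphi.
pose u n := \int[mu]_p (th n p.2 * H phi p).
have u1 : u n @[n --> \oo] --> \int[mu]_(p in slab s tau) H phi p.
  rewrite Rintegral_mkcond.
  have iH := slab_integrable_in Lphi s0 tauT.
  have iHn : mu.-integrable setT (EFin \o ((fun p => `|H phi p|) \_ (slab s tau))).
    rewrite -restrict_EFin; apply/(@integrable_mkcond _ _ _ mu (slab s tau) (EFin \o (fun p => `|H phi p|))).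
      exact: measurable_slab.
    exact: (integrable_norm iH).
  apply: (@Rintegral_dominated _ _ _ mu setT (fun n p => th n p.2 * H phi p) _ ((fun p => `|H phi p|) \_ (slab s tau))) => //.
  - by move=> n; have [i1 _ _] := W n; apply/measurable_EFinP; exact: measurable_int i1.
  - apply: aeW => p _; rewrite patchE; case: ifPn => [/set_mem/andP[sp pt]|Sp].
      apply: cvg_near_cst; near=> n.
      have [_ _ _ _ [_ a2 _ _]] := HS s (del n) (del0 n).
      have [_ _ _ _ [b1 _ _ _]] := HS (tau - del n) (del n) (del0 n).
      have dn1 : del n < p.2 - s by near: n; apply: delsmall; rewrite subr_gt0.
      have dn2 : del n < tau - p.2 by near: n; apply: delsmall; rewrite subr_gt0.
      by rewrite /th a2 ?b1 ?subr0 ?mul1r//; move: (del n) dn1 dn2 => a *; lra.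
    apply: cvg_near_cst; near=> n; rewrite th0 ?mul0r//.
    by apply: contra Sp => Sp; rewrite mem_set.
  - apply: ((measurable_restrictT (H phi) (measurable_slab s tau)).1).
    by apply/measurable_EFinP; exact: measurable_int iH.
  - apply: aeW => p n _; rewrite patchE; case: ifPn => Sp.
      by rewrite normrM ler_piMl.
    rewrite th0 ?mul0r ?normr0//.
    by apply: contra Sp => Sp; rewrite mem_set.
have u2 : u n @[n --> \oo] --> cs - ct.
  apply/cvgrPdist_le => e e0.
  have e1 : 0 < e / (2 * C) by rewrite divr_gt0// mulr_gt0.
  have [d1 d10 H1] := Fs _ e1; have [d2 d20 H2] := Ft _ e1.
  near=> n.
  have dn1 : del n < d1 by near: n; exact: delsmall.
  have dn2 : del n < d2 by near: n; exact: delsmall.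
  have [_ _ WE] := W n.
  have [_ [_ ck1] kC1 kz1 [_ _ _ ik1]] := HS s (del n) (del0 n).
  have [_ [_ ck2] kC2 kz2 [_ _ _ ik2]] := HS (tau - del n) (del n) (del0 n).
  have ck k' : continuous k' -> measurable_fun setT (k' : measurableTypeR R -> R).
    by move=> ck'; exact: continuous_measurable_fun.
  have j1 := integrable_weight (slab_cont_test Lphi) s0 tauT ck1 (k1 n).
  have j2 := integrable_weight (slab_cont_test Lphi) s0 tauT ck2 (k2 n).
  have [l1 E1'] := Rintegral_slice_weight mwphi j1 (ck _ ck1).
  have [l2 E2'] := Rintegral_slice_weight mwphi j2 (ck _ ck2).
  have b1 : `|\int[ell]_t (k s (del n) t * F phi t) - cs| <= C * (e / (2 * C)).
    apply: (lebesgue_value_bump mF (del0 n) ck1 kC1 kz1 ik1) => //.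
    - by rewrite gerBl ltW.
    - exact: H1.
  have b2 : `|\int[ell]_t (k (tau - del n) (del n) t * F phi t) - ct| <= C * (e / (2 * C)).
    apply: (lebesgue_value_bump mF (del0 n) ck2 kC2 kz2 ik2) => //.
    - by rewrite gerBl ltW.
    - exact: H2.
  have CE : C * (e / (2 * C)) = e / 2 by field; rewrite gt_eqF.
  have -> : u n = \int[ell]_t (k s (del n) t * F phi t) - \int[ell]_t (k (tau - del n) (del n) t * F phi t).
    rewrite /u -WE -E1' -E2' -RintegralB//; apply: eq_Rintegral => p _.
    by rewrite /th' mulrBl.
  rewrite CE in b1 b2; move: b1 b2.
  move: (\int[ell]_t (k s _ _ * _)) (\int[ell]_t (k (tau - _) _ _ * _)) => x y.
  rewrite !ler_norml => /andP[? ?] /andP[? ?]; apply/andP; split; lra.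
exact: (cvg_unique _ u2 u1).
Unshelve. all: by end_near.
Qed.

(** Slice integrals are only known to be locally integrable on (0, T), so Lebesgue differentiation
    is applied after multiplying by cutoffs that equal 1 on (2 a_n, tau), and the countably many
    null sets are united. *)
Lemma ae_slice_value L (phi : X * R -> R) tau : cont_test L phi -> (tau%:E < T)%E ->
  {ae ell, forall t, 0 < t < tau -> lebesgue_value (F phi) t (F phi t) /\
     lam.-integrable setT (fun x => (w (x, t) * phi (x, t))%:E)}.
Proof.
move=> tphi tauT; have [_ _ cphi _] := tphi.
have [tau0|tau0] := leP tau 0.
  by apply: aeW => t /andP[/lt_trans h /h]; rewrite ltNge tau0.
have [tau' tt' tau'T] := ereal_gt_between tauT.
have [S [k [C [C0 HS]]]] := @bump_exists R.
pose a n := tau / 2 * n.+1%:R^-1.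
have a0 n : 0 < a n by rewrite mulr_gt0// ?invr_gt0// divr_gt0.
have a2 n : a n + a n <= tau.
  have : a n <= tau / 2 by rewrite ler_piMr// ?invf_le1 ?ler1n// divr_ge0// ltW.
  by lra.
have b0 : 0 < tau' - tau by rewrite subr_gt0.
pose th n t := S (a n) (a n) t - S tau (tau' - tau) t.
have cth n : continuous (th n).
  have [_ [/(_ 0%N) c1 _] _ _ _] := HS (a n) (a n) (a0 n).
  have [_ [/(_ 0%N) c2 _] _ _ _] := HS tau (tau' - tau) b0.
  by move=> t; exact: (cvgB (c1 t) (c2 t)).
have th0 n t : ~~ (a n <= t <= tau') -> th n t = 0.
  have [_ _ _ _ [c1 c2 _ _]] := HS (a n) (a n) (a0 n).
  have [_ _ _ _ [d1 d2 _ _]] := HS tau (tau' - tau) b0.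
  have := a2 n; have := a0 n; rewrite negb_and -!ltNge /th => an0 an /orP[ta|ta].
    by rewrite c1 ?d1 ?subrr//; move: (a n) an0 an ta => x *; lra.
  by rewrite c2 ?d2 ?subrr//; move: (a n) an0 an => x *; lra.
have th1 n t : a n + a n < t < tau -> th n t = 1.
  have [_ _ _ _ [c1 c2 _ _]] := HS (a n) (a n) (a0 n).
  have [_ _ _ _ [d1 d2 _ _]] := HS tau (tau' - tau) b0.
  by move=> /andP[/ltW t1 /ltW t2]; rewrite /th c2// d1// subr0.
have mwphi := measurable_weight cphi.
have mF : measurable_fun setT (F phi : measurableTypeR R -> R) by exact: measurable_slice_integral mwphi.
have mth n : measurable_fun setT (th n : measurableTypeR R -> R) by exact: continuous_measurable_fun.
have main n : {ae ell, forall t, a n + a n < t < tau -> lebesgue_value (F phi) t (F phi t) /\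
     lam.-integrable setT (fun x => (w (x, t) * phi (x, t))%:E)}.
  have j1 := integrable_weight tphi (a0 n) tau'T (cth n) (th0 n).
  have [l1 _] := Rintegral_slice_weight mwphi j1 (mth n).
  have [ai _] := Rintegral_space_time j1.
  have lp : {ae ell, forall t, lebesgue_pt (fun t => th n t * F phi t) t}.
    by apply: lebesgue_differentiation; apply: open_integrable_locally => //; exact: openT.
  apply: ae_mono2 ai lp => t it lpt tan.
  split; last by move: it => /=; under eq_fun do rewrite th1// mul1r.
  have mthF : measurable_fun setT ((fun t => th n t * F phi t) : measurableTypeR R -> R).
    exact: measurable_funM.
  have := lebesgue_pt_value mthF lpt; rewrite th1// mul1r; apply: lebesgue_value_near.
  have tin : t \in `](a n + a n), tau[ by rewrite in_itv.
  have := near_in_itvoo tin; apply: filterS => r; rewrite in_itv/= => /th1 ->; exact: mul1r.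
apply: ae_mono (ae_forall_nat main) => t Ht /andP[t0 tt].
have e0 : 0 < t / tau by rewrite divr_gt0.
(* Here 2 a_n = tau / (n + 1), which is below t for this n. *)
have [n _ /(_ n (leqnn n))/= Hn] := near_infty_natSinv_lt (PosNum e0).
apply: (Ht n); rewrite tt andbT /a.
move: Hn; rewrite ltr_pdivlMr//; move: (n.+1%:R^-1 : R) => x *; lra.
Qed.

Lemma slab_test_lift (psi : X -> R) S : Cc_infty Omega psi -> compact S -> S `<=` Omega ->
  (forall x, ~ S x -> psi x = 0) -> slab_test S (fun p => psi p.1) /\
  exists2 M, 0 <= M & forall p, [/\ dt (fun p => psi p.1) p = 0,
      forall i, `|dx i (fun p => psi p.1) p| <= M & `|psi p.1| <= M].
Proof.
move=> Cpsi cS SO psiS.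
pose phi p : R := psi (p : X * R).1.
have phiE : phi = fun p => psi ((fst : {linear (X * R)%type -> X}) p + 0).
  by apply/funext => p; rewrite addr0.
have cfst : continuous (fst : X * R -> X) by move=> p; exact: cvg_fst.
have Dphi v p : 'D_v phi p = 'D_(v.1) psi p.1.
  by rewrite phiE derive_comp_affine /= addr0.
have Cphi n : Ck n phi by rewrite phiE; apply: Ck_comp_affine => //; exact: Cpsi.1.
have clS : closed S by exact: compact_closed.
have [Mc Mc0 cM] := compact_fun_bound cS (fun p _ => (Cpsi.1 0%N : continuous psi) p).
have [Mb Mb0 bM] := family_bound (fun i : 'I_N => compact_fun_bound cS
  (fun p _ => ((Cpsi.1 1%N).2 (delta_mx 0 i) : continuous _) p)).
split.
  split => //.
  + by move=> p _; exact: (Cphi 1%N).1.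
  + by move=> j p _; exact: ((Cphi 1%N).2 (basis_xt j) : continuous _).
  + by move=> p _; exact: psiS.
exists (Mc + Mb); first exact: addr_ge0.
move=> p; split.
- rewrite /dt Dphi /= deriveE; last exact: (Cpsi.1 1%N).1.
  by rewrite linear0.
- move=> i; rewrite /dx Dphi/=; have [Sp|Sp] := pselect (S p.1); last first.
    by rewrite (derive_off_support _ clS psiS Sp) normr0 addr_ge0.
  by rewrite (le_trans (bM i _ Sp))// lerDr.
- have [Sp|Sp] := pselect (S p.1); last by rewrite psiS// normr0 addr_ge0.
  by apply: le_trans (cM _ Sp) _; rewrite lerDl.
Qed.

Lemma smooth_cutoff L : compact L -> L `<=` Omega -> exists (psi : X -> R) S,
  [/\ Cc_infty Omega psi, forall x, 0 <= psi x, forall x, L x -> 1 <= psi x,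
    compact S /\ S `<=` Omega & forall x, ~ S x -> psi x = 0].
Proof.
move=> cL LO.
have [chi [Cchi chi0 chi1]] := cutoff_exists (@proper_rV R N) oO cL LO.
(* Doubling chi leaves room for an approximation error of 1: on L the smooth function is at least 2
   - 1. *)
have [c2 s2] : Cc Omega (fun x => 2 * chi x) by exact: CcZ.
have [S [cS SO _ app]] := smooth_approximation (@coordinates_x R N) (@proper_rV R N) oO c2 s2.
have [psi [Cpsi psiS dist pos _]] := app 1 ltr01.
exists psi, S; split => //; first by apply: pos => x; rewrite mulr_ge0.
move=> x /chi1 c1; have := dist x; rewrite ler_norml => /andP[+ _].
by move: (psi x) (chi x) c1 => a b *; lra.
Qed.

(** * Mass and dissipation up to the initial time *)

Definition bounded_mass := forall tau, 0 < tau -> (tau%:E < T)%E ->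
  forall L, compact L -> L `<=` Omega -> exists C : R,
  {ae ell, forall t, 0 < t < tau -> (\int[lam]_(x in L) (w (x, t))%:E <= C%:E)%E}.

Definition finite_dissipation := forall K : set (X * R), compact K -> K `<=` cylinder0 Omega T ->
  (\int[mu]_(p in K) (g p)%:E < +oo)%E.

Let mslice t : measurable_fun setT (fun x : X => w (x, t)).
Proof.
have mpt : measurable_fun setT (fun x : X => (x, t) : XT) by apply: measurable_fun_pair.
exact: measurableT_comp mw mpt.
Qed.

Lemma slice_mass_le L (phi : X * R -> R) t : compact L ->
  (forall x, 0 <= phi (x, t)) -> (forall x, L x -> 1 <= phi (x, t)) ->
  lam.-integrable setT (fun x => (w (x, t) * phi (x, t))%:E) ->
  (\int[lam]_(x in L) (w (x, t))%:E <= (F phi t)%:E)%E.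
Proof.
move=> cL phi0 phi1 it; have mL := compact_rV_measurable cL.
rewrite /F fineK; last exact: integrable_fin_num.
rewrite [leLHS]integral_mkcond; apply: ge0_le_integral => //.
- by move=> x _; rewrite patchE; case: ifPn => // _; rewrite lee_fin.
- apply: (measurable_restrictT (EFin \o (fun x => w (x, t))) mL).1.
  by apply/measurable_EFinP; exact: measurable_funTS.
- exact: measurable_int it.
move=> x _; rewrite patchE; case: ifPn => [/set_mem Lx|_]; last by rewrite lee_fin mulr_ge0.
by rewrite lee_fin ler_peMr// phi1.
Qed.

(** A test psi(x) constant in time makes the integrand depend on Du only, which is integrable up to
    t = 0. The integral of w psi at time s is then its value at a later fixed time plus a bounded
    term. *)
Lemma bounded_mass_of_dissipation : finite_dissipation -> bounded_mass.
Proof.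
move=> fd tau tau0 tauT L cL LO.
have [psi [S [Cpsi psi0 psi1 [cS SO] psiS]]] := smooth_cutoff cL LO.
have [Spsi [M M0 bnd]] := slab_test_lift Cpsi cS SO psiS.
have [tau' tt' tau'T] := ereal_gt_between tauT.
pose phi (p : X * R) := psi p.1.
have av := ae_slice_value (slab_cont_test Spsi) tau'T.
(* The reference time t1 lies after tau and is one where the slice integral is its own Lebesgue
   value. *)
have [t1 /andP[tt1 t1t'] Ht1] := ae_exists_in av tt'.
have [|t1v _] := Ht1; first by rewrite (lt_trans tau0).
have t1T : (t1%:E < T)%E by rewrite (lt_trans _ tau'T)// lte_fin.
pose B := \int[mu]_(p in S `*` `[0, t1]%classic) major w g 0 M p.
have finS s : 0 <= s -> (\int[mu]_(p in S `*` `[s, t1]%classic) (major w g 0 M p)%:E < +oo)%E.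
  move=> s0; have cK := compact_box (s := s) (t := t1) cS.
  have KQ : S `*` `[s, t1]%classic `<=` cylinder0 Omega T.
    apply: (@subset_trans _ (S `*` `[0, t1]%classic)); last exact: box_cylinder0.
    move=> [x r] [/= Sx]; rewrite !in_itv/= => /andP[sr ->]; split => //=.
    by rewrite (le_trans s0 sr).
  apply: major_finite => //.
  - exact: compact_xt_measurable.
  - exact: compact_xt_finite.
  - by rewrite mul0e.
  - exact: fd.
exists (F phi t1 + B).
apply: ae_mono av => s Hs /andP[s0 st].
have [|sv si] := Hs; first by rewrite s0 (lt_trans st).
apply: (le_trans (@slice_mass_le L phi s cL _ _ si)) => //.
rewrite lee_fin -lerBlDl (slab_values Spsi s0 (lt_trans st tt1) t1T sv t1v).
have [] := @slab_integrable S phi s t1 0 M Spsi => //.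
- by move=> p _ _ _; have [-> ? ?] := bnd p; rewrite normr0.
- by apply: finS; exact: ltW.
move=> _ /(le_trans (ler_norm _)) /le_trans; apply.
rewrite -lee_fin /B /Rintegral !fineK.
- apply: ge0_subset_integral.
  + exact: (compact_xt_measurable (compact_box cS)).
  + exact: (compact_xt_measurable (compact_box cS)).
  + by apply: measurable_funTS; apply/measurable_EFinP; exact: measurable_major.
  + by move=> p _; rewrite lee_fin major_ge0.
  + move=> [x r] [/= Sx]; rewrite !in_itv/= => /andP[sr ->]; split => //=.
    by rewrite (le_trans (ltW s0) sr).
- rewrite ge0_fin_numE; first exact: finS.
  by apply: integral_ge0 => p _; rewrite lee_fin major_ge0.
- rewrite ge0_fin_numE; first by apply: finS; exact: ltW.
  by apply: integral_ge0 => p _; rewrite lee_fin major_ge0.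
Qed.

Lemma mass_finite L (tau : R) : bounded_mass -> compact L -> L `<=` Omega -> (tau%:E < T)%E ->
  (\int[mu]_(p in L `*` `[0%R, tau]%classic) (w p)%:E < +oo)%E.
Proof.
move=> bm cL LO tauT.
have [tau0|tau0] := ltP tau 0.
  rewrite set_itv_ge ?bnd_simp -?ltNge//.
  by rewrite setX0 integral_set0.
have [tau' tt' tau'T] := ereal_gt_between tauT.
have [C aC] := bm tau' (le_lt_trans tau0 tt') tau'T L cL LO.
have mL := compact_rV_measurable cL.
have mLt : measurable (L `*` setT : set XT) by exact: measurableX.
have mI : measurable (`[0%R, tau]%classic : set (measurableTypeR R)) by exact: measurable_itv.
pose f : XT -> R := w \_ (L `*` setT).
have f0 p : 0 <= f p by rewrite /f patchE; case: ifPn.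
have mf : measurable_fun setT f.
  by apply: (measurable_restrictT w mLt).1; exact: measurable_funTS.
pose k : R -> R := \1_(`[0%R, tau]%classic : set R).
have k0 t : 0 <= k t by rewrite /k indicE.
have mk : measurable_fun setT (k : measurableTypeR R -> R) by exact: measurable_indic.
have -> : (\int[mu]_(p in L `*` `[0%R, tau]%classic) (w p)%:E = \int[mu]_p (f p * k p.2)%:E)%E.
  rewrite integral_mkcond; apply: eq_integral => p _; rewrite patchE /f /k patchE indicE.
  case: ifPn => [/set_mem[Lp tp]|]; first by rewrite !mem_set ?mulr1.
  case: ifPn => [/set_mem[Lp _]|]; last by rewrite mul0r.
  case: (boolP (p.2 \in `[0%R, tau]%classic)) => [/set_mem tp /negP []|_ _]; first by rewrite mem_set.
  by rewrite mulr0.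
rewrite tonelli_space_time//.
apply: (@le_lt_trans _ _ (\int[ell]_t (`|C| * k t)%:E)%E); last first.
  under eq_integral do rewrite EFinM.
  rewrite ge0_integralZl//; first last.
  - by move=> t _; rewrite lee_fin.
  - by apply/measurable_EFinP.
  apply: lte_mul_pinfty => //; rewrite integral_indic// setIT.
  rewrite -[ltLHS]/(lebesgue_measure (`[0%R, tau]%classic : set R)) lebesgue_measure_itv/=.
  by case: ifP => _ //; rewrite -EFinB ltry.
apply: ae_ge0_le_integral => //.
- by move=> t _; rewrite mule_ge0// ?lee_fin// integral_ge0// => x _; rewrite lee_fin.
- apply: emeasurable_funM; first exact/measurable_EFinP.
  by apply: (@measurable_fun_fubini_tonelli_G _ _ _ _ _ lam (EFin \o f)) => //; exact/measurable_EFinP.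
- by move=> t _; rewrite lee_fin mulr_ge0.
- by apply/measurable_EFinP; exact: measurable_funM.
apply: ae_mono aC => t Ct _.
rewrite /k indicE; case: (boolP (t \in _)) => [/set_mem|_]; last by rewrite mul0e mulr0.
rewrite /= in_itv/= => /andP[t0 tt]; rewrite mul1e mulr1.
have -> : (\int[lam]_x (f (x, t))%:E = \int[lam]_(x in L) (w (x, t))%:E)%E.
  rewrite [RHS]integral_mkcond; apply: eq_integral => x _; rewrite /f !patchE.
  case: ifPn => [/set_mem[/= Lx _]|]; first by rewrite mem_set.
  case: ifPn => // /set_mem Lx /negP[]; rewrite mem_set//.
(* The mass bound is for t > 0 only; at t = 0 the slice lies outside Q and w vanishes. *)
have [t00|t00] := leP t 0.
  rewrite integral0_eq ?lee_fin// => x _; rewrite wQ// => -[/= _].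
  by rewrite ltNge t00.
apply: (le_trans (Ct _)); first by rewrite t00 (le_lt_trans tt).
by rewrite lee_fin ler_norm.
Qed.

Lemma slice_integral_bound S (phi : X * R -> R) M C t : compact S -> 0 <= M ->
  (forall x, ~ S x -> phi (x, t) = 0) -> (forall x, `|phi (x, t)| <= M) ->
  measurable_fun setT (fun x => w (x, t) * phi (x, t)) ->
  (\int[lam]_(x in S) (w (x, t))%:E <= C%:E)%E -> `|F phi t| <= M * C.
Proof.
move=> cS M0 phi0 phiM mphi wC; have mS := compact_rV_measurable cS.
have le : (\int[lam]_x `|(w (x, t) * phi (x, t))%:E| <= (M * C)%:E)%E.
  apply: (@le_trans _ _ (M%:E * \int[lam]_(x in S) (w (x, t))%:E)%E); last first.
    by rewrite EFinM lee_wpmul2l.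
  rewrite -ge0_integralZl//; last first.
  - by move=> x _; rewrite lee_fin.
  - by apply/measurable_EFinP; exact: measurable_funTS.
  rewrite [leRHS]integral_mkcond; apply: ge0_le_integral => //.
  - by apply/measurable_EFinP; exact: measurableT_comp.
  - apply: (measurable_restrictT (fun x => M%:E * (w (x, t))%:E)%E mS).1.
    by apply/measurable_EFinP; apply: measurable_funTS; exact: measurable_funM.
  move=> x _; rewrite patchE; case: ifPn => [_|/negP Sx].
    by rewrite -EFinM lee_fin normrM ger0_norm// mulrC ler_wpM2r.
  by rewrite phi0 ?mulr0 ?abse0// => Sx'; apply: Sx; rewrite mem_set.
have it : lam.-integrable setT (EFin \o (fun x => w (x, t) * phi (x, t))).
  by apply/integrableP; split; [exact/measurable_EFinP|apply: le_lt_trans le _; exact: ltry].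
apply: (le_trans (le_normr_Rintegral _ it)) => //.
rewrite -lee_fin /Rintegral fineK// ge0_fin_numE; first by apply: le_lt_trans le _; exact: ltry.
by apply: integral_ge0 => x _; rewrite lee_fin.
Qed.

(** The equation before integration by parts. Unlike [E1] it contains no Du except through g, so its
    other terms are controlled by the mass alone. *)
Hypothesis E2 : forall phi, Cc_infty Q phi ->
  \int[mu]_p (- w p * dt phi p - w p * laplacian phi p + g p * phi p) = 0.

(* Test with psi * theta where theta = 1 on [2a, b]: of the two terms coming from
   theta', the one near [tau] has the good sign, and the one near [a] is an
   average of slice integrals, which are bounded. *)
Lemma dissipation_bound (psi : X -> R) S M (b tau C : R) : compact S ->
  slab_test S (fun p => psi p.1) -> Cc_infty Omega psi -> (forall x, 0 <= psi x) ->
  (forall x, ~ S x -> psi x = 0) ->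
  (forall x, `|psi x| <= M) -> bounded_mass ->
  b < tau -> (tau%:E < T)%E ->
  {ae ell, forall t, 0 < t < tau -> (\int[lam]_(x in S) (w (x, t))%:E <= C%:E)%E} ->
  exists B : R, forall a, 0 < a -> a + a <= b ->
    (\int[mu]_(p in [set p : XT | (a + a <= p.2 <= b)%R]) (g p * psi p.1)%:E <= B%:E)%E.
Proof.
move=> cS Spsi Cpsi psi0 psiS psiM bm bt tauT aC.
have [_ SO _ _ _] := Spsi.
have clS : closed S by exact: compact_closed.
pose phi (p : X * R) := psi p.1.
have phiE : phi = fun p => psi ((fst : {linear (X * R)%type -> X}) p + 0).
  by apply/funext => p; rewrite addr0.
have cfst : continuous (fst : X * R -> X) by move=> p; exact: cvg_fst.
have Cphi n : Ck n phi by rewrite phiE; apply: Ck_comp_affine => //; exact: Cpsi.1.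
have clS' : closed (fst @^-1` S : set (X * R)).
  by apply: preimage_closed => //; exact: continuous_subspaceT.
have phiS p : ~ (fst @^-1` S) p -> phi p = 0 by exact: psiS.
have CD i n : Ck n (dx i phi) by exact: Ck_derive.
have CDD i n : Ck n (dx i (dx i phi)) by exact: Ck_derive.
have clap : continuous (laplacian phi).
  by apply: (@Ck_sum _ _ 0); exact: (fun i => CDD i 0%N).
have lapS p : ~ S p.1 -> laplacian phi p = 0.
  move=> Sp; rewrite /laplacian big1// => i _; rewrite /dx.
  apply: (derive_off_support _ clS') => // q Sq.
  exact: (derive_off_support _ clS').
have [M2 M20 lapM] := compact_fun_bound (compact_box (s := 0) (t := tau) cS) (fun p _ => clap p).
have [St [kt [Ct [Ct0 HS]]]] := @bump_exists R.
have b0 : 0 < tau - b by rewrite subr_gt0.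
pose W := fine (\int[mu]_(p in S `*` `[0%R, tau]%classic) (w p)%:E).
have M0 : 0 <= M by exact: le_trans (psiM 0).
(* The first term bounds the average of slice integrals near a, the second the Laplacian term over
   the whole box down to t = 0; neither depends on a. *)
exists (M * C + M2 * W) => {}a a0 aab.
have [dS1 [CS1 ck1] kC1 kz1 [S1a S1b S1c ik1]] := HS a a a0.
have [dS2 [CS2 ck2] kC2 kz2 [S2a S2b S2c ik2]] := HS b (tau - b) b0.
rewrite subrKC in kz2 S2b.
pose th t := St a a t - St b (tau - b) t.
pose th' t := kt a a t - kt b (tau - b) t.
have dth t : is_derive t (1:R) th (th' t) by exact: is_deriveB.
have cth' : continuous th' by move=> t; exact: (cvgB (ck1 t) (ck2 t)).
have Cth n : Ck n th.
  rewrite (_ : th = fun t => St a a t + -1 * St b (tau - b) t).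
    by apply: CkD => //; exact: Ck_scale.
  by apply/funext => t; rewrite mulN1r.
have k10 t : ~~ (a <= t <= tau) -> kt a a t = 0.
  by move=> h; apply: kz1; apply: contra h => /andP[h1 h2]; apply/andP; split; lra.
have k20 t : ~~ (a <= t <= tau) -> kt b (tau - b) t = 0.
  by move=> h; apply: kz2; apply: contra h => /andP[h1 h2]; apply/andP; split; lra.
have th0 t : ~~ (a <= t <= tau) -> th t = 0.
  rewrite negb_and -!ltNge => /orP[ta|ta]; rewrite /th.
    by rewrite S1a ?S2a ?subrr//; lra.
  by rewrite S1b ?S2b ?subrr//; lra.
have th1 t : a + a <= t <= b -> th t = 1.
  by move=> /andP[t1 t2]; rewrite /th S1b// S2a// subr0.
have th_ge0 t : 0 <= th t.
  rewrite /th; have [tb|/ltW bt'] := leP t b.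
    by rewrite (S2a _ tb) subr0; case/andP: (S1c t).
  by rewrite (S1b t) ?subr_ge0; [case/andP: (S2c t)|lra].
have th_le1 t : th t <= 1.
  by case/andP: (S1c t) (S2c t) => _ h1 /andP[h2 _]; rewrite /th; lra.
pose Phi (p : X * R) := phi p * th p.2.
have cthp : continuous (fun p : X * R => th p.2).
  by move=> p; apply: differentiable_continuous; have [] := derive_time p p dth.
have CPhi : Cc_infty Q Phi.
  split.
    move=> n; apply: CkM => //.
    rewrite (_ : (fun p => th p.2) = fun p => th ((snd : {linear (X * R)%type -> R}) p + 0)).
      by apply: Ck_comp_affine => //; move=> p; exact: cvg_snd.
    by apply/funext => p; rewrite addr0.
  have KQ : S `*` `[a, tau]%classic `<=` Q by exact: box_cylinder.
  apply: (compact_support_sub (compact_box (s := a) (t := tau) cS) KQ) => p Kp.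
  rewrite /Phi; have [Sp|Sp] := pselect (S p.1); last by rewrite /phi psiS// mul0r.
  by rewrite th0 ?mulr0//; apply/negP => h; apply: Kp; split => //=; rewrite in_itv.
have DM (f : X * R -> R) v p : differentiable f p ->
    'D_v (fun p : X * R => f p * th p.2) p = f p * (v.2 * th' p.2) + th p.2 * 'D_v f p.
  move=> df; have [dt1 <-] := derive_time p v dth.
  by rewrite -[LHS]/('D_v (f * (fun p : X * R => th p.2)) p) deriveM//; exact: diff_derivable.
have dphi p : differentiable phi p by exact: (Cphi 1%N).1.
have dtPhi p : dt Phi p = phi p * th' p.2.
  rewrite /dt DM//= mul1r [X in _ + _ * X](_ : _ = 0) ?mulr0 ?addr0//.
  rewrite phiE derive_comp_affine /= deriveE; last exact: (Cpsi.1 1%N).1.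
  by rewrite linear0.
have dxM (f : X * R -> R) i : (forall p, differentiable f p) ->
    dx i (fun p : X * R => f p * th p.2) = fun p => dx i f p * th p.2.
  by move=> df; apply/funext => p; rewrite /dx DM//= mul0r mulr0 add0r mulrC.
have lapPhi p : laplacian Phi p = laplacian phi p * th p.2.
  rewrite /laplacian mulr_suml; apply: eq_bigr => i _.
  by rewrite dxM// dxM// => q; exact: (CD i 1%N).1.
have cphi : continuous phi by exact: (Cphi 0%N).
have cth : continuous th by exact: (Cth 0%N).
have tlap : cont_test S (laplacian phi) by split => // [p _|p _]; [exact: clap|exact: lapS].
have j0 k' := @integrable_weight S phi k' a tau (slab_cont_test Spsi) a0 tauT.
have i1 : mu.-integrable setT (fun p => (th' p.2 * (w p * phi p))%:E).
  by apply: j0 => // t h; rewrite /th' k10// k20// subrr.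
have i2 : mu.-integrable setT (fun p => (th p.2 * (w p * laplacian phi p))%:E).
  exact: (integrable_weight tlap a0 tauT cth th0).
have i3 : mu.-integrable setT (fun p => (g p * Phi p)%:E).
  have gE : (fun p => g p * Phi p) = J (cst 0) (fun _ => cst 0) Phi.
    apply/funext => p; rewrite /jet /= mulr0 big1 ?add0r// => i _.
    by rewrite mulr0.
  rewrite -[X in integrable _ _ X]/(EFin \o (fun p => g p * Phi p)) gE.
  have KQ : S `*` `[a, tau]%classic `<=` Q by exact: box_cylinder.
  apply: (integrable_jet_compact (compact_box (s := a) (t := tau) cS) KQ).
  - by move=> p _; exact: cvg_cst.
  - by move=> i p _; exact: cvg_cst.
  - by move=> p _; exact: (cvgM (cphi p) (cthp p)).
  - move=> p _ Kp; rewrite -gE /Phi.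
    have [Sp|Sp] := pselect (S p.1); last by rewrite /phi psiS// mul0r mulr0.
    by rewrite th0 ?mulr0//; apply/negP => h; apply: Kp; split => //=; rewrite in_itv.
have E := E2 CPhi.
have gE : \int[mu]_p (g p * Phi p) =
    \int[mu]_p (th' p.2 * (w p * phi p)) + \int[mu]_p (th p.2 * (w p * laplacian phi p)).
  rewrite -RintegralD//; apply/eqP; rewrite -subr_eq0 -RintegralB//; last first.
    by have := integrableD measurableT i1 i2; apply: eq_integrable.
  apply/eqP; rewrite -[RHS]E; apply: eq_Rintegral => p _.
  by rewrite dtPhi lapPhi /Phi; ring.
have b2 : \int[mu]_p (th p.2 * (w p * laplacian phi p)) <= M2 * W.
  pose K : set XT := S `*` `[0%R, tau]%classic.
  have mK : measurable K by exact: (compact_xt_measurable (compact_box (s := 0) (t := tau) cS)).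
  have iwK : mu.-integrable K (EFin \o w).
    apply/integrableP; split; first by apply/measurable_EFinP; exact: measurable_funTS.
    under eq_integral do rewrite gee0_abs ?lee_fin//.
    exact: mass_finite.
  rewrite (_ : \int[mu]_p _ = \int[mu]_(p in K) (th p.2 * (w p * laplacian phi p))); last first.
    rewrite [RHS]Rintegral_mkcond; apply: eq_Rintegral => p _; rewrite patchE; case: ifPn => // /negP Kp.
    have [Sp|Sp] := pselect (S p.1); last by rewrite lapS// !mulr0.
    rewrite th0 ?mul0r//; apply/negP => /andP[h1 h2]; apply: Kp; rewrite mem_set//; split => //=.
    by rewrite in_itv/= h2 (le_trans _ h1)// ltW.
  rewrite /W -[fine _]/(\int[mu]_(p in K) w p) -RintegralZl//; apply: le_Rintegral => //.
  - exact: integrableS i2.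
  - by have := integrableZl mK M2 iwK; apply: eq_integrable.
  - move=> p Kp; have := lapM p Kp; rewrite ler_norml => /andP[_ lp].
    rewrite mulrCA [M2 * _]mulrC ler_wpM2l// (le_trans (ler_wpM2l (th_ge0 p.2) lp))//.
    by rewrite ler_piMl.
have mphi : measurable_fun setT (fun p : XT => w p * phi p).
  by apply: measurable_weight => p _; exact: cphi.
have mFm k' : continuous k' -> measurable_fun setT (k' : measurableTypeR R -> R).
  by move=> ck'; exact: continuous_measurable_fun.
have b1 : \int[mu]_p (th' p.2 * (w p * phi p)) <= M * C.
  have jA := j0 _ ck1 k10; have jB := j0 _ ck2 k20.
  have [lA EA] := Rintegral_slice_weight mphi jA (mFm _ ck1).
  have [lB EB] := Rintegral_slice_weight mphi jB (mFm _ ck2).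
  have F0 t : 0 <= F phi t by apply: Rintegral_ge0 => x _; exact: mulr_ge0 (w0 _) (psi0 _).
  have -> : \int[mu]_p (th' p.2 * (w p * phi p)) =
      \int[ell]_t (kt a a t * F phi t) - \int[ell]_t (kt b (tau - b) t * F phi t).
    rewrite -EA -EB -RintegralB//; apply: eq_Rintegral => p _.
    by rewrite /th' mulrBl.
  apply: (@le_trans _ _ (\int[ell]_t (kt a a t * F phi t))).
    rewrite gerBl; apply: Rintegral_ge0 => t _; rewrite mulr_ge0//.
    by case/andP: (kC2 t).
  have C0 : 0 <= C.
    have tau0 : 0 < tau by lra.
    have [t t0 /(_ t0)] := ae_exists_in aC tau0; rewrite -lee_fin; apply: le_trans.
    by apply: integral_ge0 => x _; rewrite lee_fin.
  have ik : ell.-integrable setT (fun t => (kt a a t)%:E) by exact: bump_integrable ck1 kz1.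
  rewrite -[leRHS]mulr1 -ik1 -RintegralZl//; apply: ae_le_Rintegral => //.
  - by have := integrableZl measurableT (M * C) ik; apply: eq_integrable.
  - by move=> t; rewrite mulr_ge0//; case/andP: (kC1 t).
  - by move=> t; rewrite mulr_ge0 ?mulr_ge0//; case/andP: (kC1 t).
  apply: ae_mono aC => t Cat.
  have [/andP[at1 at2]|tt] := boolP (a < t < a + a); last by rewrite kz1// mul0r mulr0.
  rewrite mulrC ler_wpM2r//; first by case/andP: (kC1 t).
  apply: (le_trans (ler_norm _)).
  apply: (slice_integral_bound cS M0) => //.
  - have mpt : measurable_fun setT (fun x : X => (x, t) : XT) by apply: measurable_fun_pair.
    exact: measurableT_comp mphi mpt.
  - by apply: Cat; apply/andP; split; lra.
apply: (@le_trans _ _ (\int[mu]_p (g p * Phi p)%:E)%E).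
  have mD : measurable [set p : XT | (a + a <= p.2 <= b)%R].
    apply: closed_xt_measurable.
    rewrite (_ : [set _ | _] = snd @^-1` (`[a + a, b]%classic : set R)).
      by apply: preimage_closed; [by move=> p _; exact: cvg_snd|exact: itv_closed].
    by apply/seteqP; split=> p; rewrite /= in_itv.
  have mgphi : measurable_fun setT (fun p : XT => g p * psi p.1).
    by apply: measurable_funM => //; exact: (continuous_measurable_xt openT (fun p _ => cphi p)).
  rewrite integral_mkcond; apply: ge0_le_integral => //.
  - by move=> p _; rewrite patchE; case: ifPn => // _; rewrite lee_fin mulr_ge0.
  - apply: (measurable_restrictT (fun p : XT => (g p * psi p.1)%:E) mD).1.
    by apply/measurable_EFinP; exact: measurable_funTS.
  - exact: measurable_int i3.
  - move=> p _; rewrite patchE; case: ifPn => [/set_mem pD|_]; last first.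
      by rewrite lee_fin mulr_ge0//; exact: mulr_ge0 (psi0 _) (th_ge0 _).
    by rewrite lee_fin /Phi th1// mulr1.
rewrite -(fineK (integrable_fin_num _ i3))//.
rewrite lee_fin -[fine _]/(\int[mu]_p (g p * Phi p)) gE; exact: lerD.
Qed.

(** The bound of [dissipation_bound] is uniform in a, so monotone convergence applies along the
    parts of K with t >= 2 a_n; the part of K at t = 0 contributes nothing because g vanishes
    outside Q. *)
Lemma dissipation_of_bounded_mass : bounded_mass -> finite_dissipation.
Proof.
move=> bm K cK KQ.
have [b [b0 bT Kb]] := compact_cylinder0_bounded T0 cK KQ.
have [tau bt tauT] := ereal_gt_between bT.
pose L := fst @` K.
have cL : compact L.
  by apply: continuous_compact => //; apply: continuous_subspaceT => p; exact: cvg_fst.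
have LO : L `<=` Omega by move=> _ [p Kp <-]; have [] := KQ p Kp.
have [psi [S [Cpsi psi0 psi1 [cS SO] psiS]]] := smooth_cutoff cL LO.
have [Spsi [M M0 bnd]] := slab_test_lift Cpsi cS SO psiS.
have [C aC] := bm tau (lt_trans b0 bt) tauT S cS SO.
have psiM x : `|psi x| <= M by have [_ _] := bnd (x, 0).
have [B HB] := dissipation_bound cS Spsi Cpsi psi0 psiS psiM bm bt tauT aC.
have mK : measurable (K : set XT) by exact: compact_xt_measurable.
pose a n := b / 2 * n.+1%:R^-1.
have a0 n : 0 < a n by rewrite mulr_gt0// ?invr_gt0// divr_gt0.
have a2 n : a n + a n <= b.
  have : a n <= b / 2 by rewrite ler_piMr// ?invf_le1 ?ler1n// divr_ge0// ltW.
  by lra.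
pose A n : set XT := K `&` [set p : XT | a n + a n <= p.2].
have mge c : measurable [set p : XT | c <= p.2].
  apply: closed_xt_measurable; rewrite (_ : [set _ | _] = snd @^-1` [set t : R | c <= t])//.
  by apply: preimage_closed; [by move=> p _; exact: cvg_snd|exact: closed_ge].
have mA n : measurable (A n) by apply: measurableI.
have ndA : nondecreasing_seq A.
  move=> m n mn; apply/subsetPset => p [Kp /= pa]; split => //=.
  apply: le_trans pa; suff h : a n <= a m by exact: lerD.
  by rewrite ler_pM2l ?divr_gt0// lef_pV2 ?posrE// ler_nat.
have UA : \bigcup_n A n = K `&` [set p | 0 < p.2].
  apply/seteqP; split => [p [n _ [Kp /= pa]]|p [Kp /= p0]].
    by split => //=; have := a0 n; move: (a n) pa => x *; lra.
  have e0 : 0 < p.2 / b by rewrite divr_gt0.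
  have [n _ /(_ n (leqnn n))/= Hn] := near_infty_natSinv_lt (PosNum e0).
  exists n => //; split => //=; rewrite /a.
  by move: Hn; rewrite ltr_pdivlMr//; move: (n.+1%:R^-1 : R) => x *; lra.
have mgK D : measurable_fun D (fun p : XT => (g p)%:E).
  by apply/measurable_EFinP; exact: measurable_funTS.
have -> : (\int[mu]_(p in K) (g p)%:E = \int[mu]_(p in \bigcup_n A n) (g p)%:E)%E.
  rewrite UA integral_mkcond [RHS]integral_mkcond; apply: eq_integral => p _; rewrite !patchE.
  case: ifPn => [/set_mem Kp|Kp]; last first.
    by case: ifPn => // /set_mem[Kp' _]; move: Kp; rewrite mem_set.
  case: ifPn => // /negP p0; rewrite gQ// => -[_ p0' _]; apply: p0.
  by rewrite mem_set.
have cA : (\int[mu]_(p in A n) (g p)%:E)%E @[n --> \oo] --> (\int[mu]_(p in \bigcup_n A n) (g p)%:E)%E.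
  by apply: ge0_nondecreasing_set_cvg_integral => // n p _; rewrite lee_fin.
rewrite -(cvg_lim _ cA)//; apply: (@le_lt_trans _ _ B%:E); last exact: ltry.
apply: lime_le; first by apply/cvg_ex; eexists; exact: cA.
apply: nearW => n; apply: le_trans (HB (a n) (a0 n) (a2 n)).
have mD : measurable [set p : XT | (a n + a n <= p.2 <= b)%R].
  rewrite (_ : [set _ | _] = [set p : XT | a n + a n <= p.2] `&` ~` [set p : XT | b < p.2]).
    apply: measurableI => //; apply: measurableC; apply: open_xt_measurable.
    rewrite (_ : [set _ | _] = snd @^-1` [set t : R | b < t])//.
    by apply: open_comp; [move=> p _; exact: cvg_snd|exact: open_gt].
  apply/seteqP; split=> p /=; first by move=> /andP[-> pb]; split => //; apply/negP; rewrite -leNgt.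
  by move=> [-> /negP]; rewrite -leNgt.
rewrite integral_mkcond [leRHS]integral_mkcond; apply: ge0_le_integral => //.
- by move=> p _; rewrite patchE; case: ifPn => // _; rewrite lee_fin.
- by apply: (measurable_restrictT (fun p : XT => (g p)%:E) (mA n)).1.
- apply: (measurable_restrictT (fun p : XT => (g p * psi p.1)%:E) mD).1.
  apply/measurable_EFinP; apply: measurable_funTS; apply: measurable_funM => //.
  apply: (continuous_measurable_xt (f := fun p : X * R => psi p.1) openT) => p _.
  by apply: (@continuous_comp _ _ _ fst psi); [exact: cvg_fst|exact: (Cpsi.1 0%N)].
move=> p _; rewrite !patchE; case: ifPn => [/set_mem[Kp /= pa]|_]; last first.
  by case: ifPn => // _; rewrite lee_fin mulr_ge0.
rewrite mem_set/=; last by rewrite pa ltW// Kb.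
by rewrite lee_fin ler_peMr// psi1//; exists p.
Qed.

(** Translates between compact sets, which suit test functions, and relatively compact open sets, on
    which the representative is L^1-continuous. *)
Lemma compactly_contained_nbhs L : compact L -> L `<=` Omega ->
  exists2 omega, compactly_contained omega Omega & L `<=` omega.
Proof.
move=> cL LO.
have [chi [[cchi [cS SO]] chi0 chi1]] := cutoff_exists (@proper_rV R N) oO cL LO.
exists [set x | 1 / 2 < chi x]; last first.
  by move=> x /chi1 h; rewrite /= (lt_le_trans _ h)// ltr_pdivrMr// mul1r ltr1n.
have sub : closure [set x | 1 / 2 < chi x] `<=` closure [set x | chi x != 0].
  apply: closure_subset => x /= h; rewrite gt_eqF// (lt_trans _ h)//.
split.
- rewrite (_ : [set _ | _] = chi @^-1` [set t | 1 / 2 < t])//.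
  by apply: open_comp; [move=> x _; exact: cchi|exact: open_gt].
- by apply: subclosed_compact cS sub; exact: closed_closure.
- exact: subset_trans sub SO.
Qed.

(** * The continuous representative and the initial trace *)

Variable v : X * R -> R.
Hypothesis vw : L1loc_continuous_representative Omega T w v.

(** The counterpart of [F] for the continuous representative; it is meaningful at every time in (0,
    T), and agrees with [F] at almost every one. *)
Let V (phi : X * R -> R) (t : R) := \int[lam]_(x in Omega) (v (x, t) * phi (x, t)).

Let iv omega t : compactly_contained omega Omega -> 0 < t -> (t%:E < T)%E ->
  lam.-integrable omega (EFin \o (fun x => v (x, t))).
Proof. by move=> oc t0 tT; have [] := vw.2 _ oc t t0 tT. Qed.

Let momega omega : compactly_contained omega Omega -> measurable omega.
Proof. by case=> oo _ _; exact: open_rV_measurable. Qed.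

Let subomega omega : compactly_contained omega Omega -> omega `<=` Omega.
Proof. by case=> _ _; apply: subset_trans; exact: subset_closure. Qed.

Lemma measurable_test_slice (phi : X * R -> R) t D : (forall p, Q p -> {for p, continuous phi}) ->
  measurable D -> D `<=` Omega -> 0 < t -> (t%:E < T)%E ->
  measurable_fun D (fun x => phi (x, t)).
Proof.
move=> cphi mD DO t0 tT.
have mpt : measurable_fun setT (fun x : X => (x, t) : XT) by apply: measurable_fun_pair.
have mp := (measurable_restrictT (phi : XT -> R) mQ).1 (cmQ cphi).
have := measurableT_comp mp mpt; move/(measurable_funTS (D := D)).
apply: eq_measurable_fun => x /set_mem Dx /=; rewrite patchE mem_set//.
by split => //; exact: DO.
Qed.

Lemma test_integral_restrict omega L (phi : X * R -> R) (f : X * R -> R) t :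
  (forall p, Q p -> ~ L p.1 -> phi p = 0) -> L `<=` omega -> omega `<=` Omega ->
  0 < t -> (t%:E < T)%E ->
  \int[lam]_(x in Omega) (f (x, t) * phi (x, t)) = \int[lam]_(x in omega) (f (x, t) * phi (x, t)).
Proof.
move=> phi0 Lo oO' t0 tT; rewrite Rintegral_mkcond [RHS]Rintegral_mkcond.
apply: eq_Rintegral => x _; rewrite !patchE.
case: ifPn => [/set_mem Ox|/negP Ox]; last first.
  by case: ifPn => // /set_mem /oO' Ox'; case: Ox; rewrite mem_set.
case: ifPn => // /negP ox; rewrite phi0 ?mulr0// => Lx; apply: ox.
by rewrite mem_set//; exact: Lo.
Qed.

Lemma ae_test_integral L (phi : X * R -> R) : cont_test L phi ->
  {ae ell, forall t, 0 < t -> (t%:E < T)%E -> V phi t = F phi t}.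
Proof.
move=> [cL LO cphi phi0]; have [omega oc Lo] := compactly_contained_nbhs cL LO.
have mo := momega oc; have so := subomega oc.
apply: ae_mono (ae_space_time vw.1) => t At t0 tT.
rewrite /V (test_integral_restrict v phi0 Lo so t0 tT).
have -> : F phi t = \int[lam]_(x in omega) (w (x, t) * phi (x, t)).
  rewrite /F [RHS]Rintegral_mkcond; apply: eq_Rintegral => x _; rewrite patchE.
  case: ifPn => // /negP ox; have [Ox|Ox] := pselect (Omega x).
    by rewrite phi0 ?mulr0// => Lx; apply: ox; rewrite mem_set//; exact: Lo.
  by rewrite wQ ?mul0r// => -[].
have mphi := measurable_test_slice cphi mo so t0 tT.
congr fine; apply: ae_eq_integral => //.
- apply/measurable_EFinP; apply: measurable_funM => //.
  by apply/measurable_EFinP; exact: measurable_int (iv oc t0 tT).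
- by apply/measurable_EFinP; apply: measurable_funM => //; exact: measurable_funTS (mslice t).
- apply: ae_mono At => x Ax ox /=.
  by rewrite Ax//; split => //; exact: so.
Qed.

(** The slices of v are continuous in L^1 near the spatial support, and phi(., s) converges
    uniformly to phi(., t) there by compactness. *)
Lemma test_integral_continuous L (phi : X * R -> R) t : cont_test L phi ->
  0 < t -> (t%:E < T)%E -> {for t, continuous (V phi)}.
Proof.
move=> [cL LO cphi phi0] t0 tT; have [omega oc Lo] := compactly_contained_nbhs cL LO.
have mo := momega oc; have so := subomega oc.
have unif e : 0 < e -> \forall s \near t, forall x, L x -> `|phi (x, s) - phi (x, t)| <= e.
  move=> e0; have := compact_near_coveringP L; move=> [+ _] => /(_ cL).
  move=> /(_ _ (nbhs t) (fun s x => `|phi (x, s) - phi (x, t)| <= e)) H0.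
  apply: H0 => x Lx.
  have Qx : Q (x, t) by split => //; exact: LO.
  have e20 : 0 < e / 2 by rewrite divr_gt0.
  have := cphi _ Qx; move/cvgrPdist_le => /(_ _ e20) [[A B] /= [nA nB] AB].
  exists (A, B) => //= -[y s] /= [Ay Bs].
  have h1 := AB (y, s) (conj Ay Bs); have h2 := AB (y, t) (conj Ay (nbhs_singleton nB)).
  move: h1 h2 => /=; move: (phi (x, t)) (phi (y, s)) (phi (y, t)) => a b c.
  by rewrite !ler_norml => /andP[? ?] /andP[? ?]; apply/andP; split; lra.
have [tau tt tauT] := ereal_gt_between tT.
have cK := compact_box (s := t / 2) (t := tau) cL.
have t20 : 0 < t / 2 by rewrite divr_gt0.
have KQ : L `*` `[t / 2, tau]%classic `<=` Q by exact: box_cylinder.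
have [M M0 HM] := compact_fun_bound cK (fun p Kp => cphi p (KQ p Kp)).
have bM s x : t / 2 <= s <= tau -> omega x -> `|phi (x, s)| <= M.
  move=> /andP[s1 s2] ox; have [Lx|Lx] := pselect (L x).
    by apply: HM; split => //=; rewrite in_itv/= s1.
  rewrite phi0 ?normr0//; split => //=; [exact: so|exact: lt_le_trans s1|].
  by rewrite (le_lt_trans _ tauT).
pose I := \int[lam]_(x in omega) `|v (x, t)|.
have I0 : 0 <= I by apply: Rintegral_ge0.
apply/cvgrPdist_le => e e0.
have e1 : 0 < e / (2 * (M + 1)) by rewrite divr_gt0// mulr_gt0// ltr_wpDl.
have e2 : 0 < e / (2 * (I + 1)) by rewrite divr_gt0// mulr_gt0// ltr_wpDl.
have [_ /cvgrPdist_le /(_ _ e1) cv] := vw.2 _ oc t t0 tT.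
near=> s.
have s1 : t / 2 <= s.
  by apply: ltW; near: s; apply: lt_nbhsr; rewrite gtr_pMr// invf_lt1// ltr1n.
have s2 : s <= tau by apply: ltW; near: s; exact: lt_nbhsl.
have s0 : 0 < s by exact: lt_le_trans s1.
have sT : (s%:E < T)%E by rewrite (le_lt_trans _ tauT).
rewrite /V (test_integral_restrict v phi0 Lo so t0 tT) (test_integral_restrict v phi0 Lo so s0 sT) distrC.
have st : forall x, L x -> `|phi (x, s) - phi (x, t)| <= e / (2 * (I + 1)).
  by near: s; exact: unif.
have cvs : `|0 - \int[lam]_(x in omega) `|v (x, s) - v (x, t)| | <= e / (2 * (M + 1)) by near: s.
have B1 x : omega x -> `|phi (x, s)| <= M by apply: bM; rewrite s1.
have B2 x : omega x -> `|phi (x, t)| <= M.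
  by apply: bM; rewrite (ltW tt) andbT ler_piMr ?invf_le1 ?ler1n// ltW.
have B3 x : omega x -> `|phi (x, s) - phi (x, t)| <= e / (2 * (I + 1)).
  move=> ox; have [Lx|Lx] := pselect (L x); first exact: st.
  by rewrite !phi0 ?subrr ?normr0 ?(ltW e2)//; split => //=; exact: so.
have [_ _ /le_trans] := @Rintegral_prod_diff _ _ _ lam omega (fun x => v (x, s))
  (fun x => v (x, t)) (fun x => phi (x, s)) (fun x => phi (x, t)) M (e / (2 * (I + 1))) mo
  (iv oc s0 sT) (iv oc t0 tT) (measurable_test_slice cphi mo so s0 sT)
  (measurable_test_slice cphi mo so t0 tT) M0 (ltW e2) B1 B2 B3.
apply; rewrite -/I.
have frac (c : R) : 0 <= c -> c * (e / (2 * (c + 1))) <= e / 2.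
  move=> c0; have c1 : 0 < c + 1 by rewrite ltr_wpDl.
  rewrite (_ : c * _ = e / 2 * (c / (c + 1))); last by field; rewrite gt_eqF.
  by rewrite ler_piMr ?divr_ge0// ?(ltW e0)// ler_pdivrMr// mul1r lerDl.
rewrite [leRHS](splitr e) lerD//; last by rewrite mulrC; exact: frac.
rewrite (le_trans _ (frac M M0))// ler_wpM2l//.
by rewrite sub0r normrN in cvs; exact: le_trans (ler_norm _) cvs.
Unshelve. all: by end_near.
Qed.

(** [F] equals the continuous function [V] almost everywhere, so its Lebesgue value at every t is
    [V phi t]; the identity of [slab_values] thus holds between any two times. *)
Lemma test_integral_value L (phi : X * R -> R) t : cont_test L phi ->
  0 < t -> (t%:E < T)%E -> lebesgue_value (F phi) t (V phi t).
Proof.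
move=> tphi t0 tT; have [_ _ cphi _] := tphi.
have mF : measurable_fun setT (F phi : measurableTypeR R -> R).
  exact: measurable_slice_integral (measurable_weight cphi).
apply: lebesgue_value_ae => // e e0.
have [tau tt tauT] := ereal_gt_between tT.
have cV := test_integral_continuous tphi t0 tT.
have /nbhs_ballP[d0 /= d00 Hd] : \forall s \near t, [/\ 0 < s, s < tau & `|V phi t - V phi s| <= e].
  near=> s; split; near: s; [exact: lt_nbhsr|exact: lt_nbhsl|].
  by move/cvgrPdist_le : cV => /(_ _ e0).
exists d0 => //.
apply: ae_mono (ae_test_integral tphi) => s Vs /andP[s1 s2].
have [|p1 p2 p3] := Hd s; first by rewrite /ball/= ltr_norml; apply/andP; split; lra.
rewrite -(Vs p1) 1?distrC//.
by rewrite (lt_trans _ tauT)// lte_fin.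
Unshelve. all: by end_near.
Qed.

Lemma test_integral_identity L (phi : X * R -> R) s tau : slab_test L phi ->
  0 < s -> s < tau -> (tau%:E < T)%E ->
  V phi s - V phi tau = \int[mu]_(p in slab s tau) H phi p.
Proof.
move=> Lphi s0 st tauT; have tphi := slab_cont_test Lphi.
apply: (slab_values Lphi s0 st tauT).
- by apply: (test_integral_value tphi s0); rewrite (lt_trans _ tauT)// lte_fin.
- by apply: (test_integral_value tphi _ tauT); exact: lt_trans st.
Qed.

(** A given slice of v has no known sign; [V] is continuous and agrees almost everywhere with the
    nonnegative [F]. *)
Lemma test_integral_ge0 L (phi : X * R -> R) t : cont_test L phi ->
  (forall p, 0 <= phi p) -> 0 < t -> (t%:E < T)%E -> 0 <= V phi t.
Proof.
move=> tphi phi_ge0 t0 tT; rewrite leNgt; apply/negP => Vt.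
have [tau tt tauT] := ereal_gt_between tT.
have cV := test_integral_continuous tphi t0 tT.
have /nbhs_ballP[d0 /= d00 Hd] : \forall s \near t, [/\ 0 < s, s < tau & V phi s < 0].
  near=> s; split; near: s; [exact: lt_nbhsr|exact: lt_nbhsl|].
  by apply: (cV [set x | x < 0]); apply: open_nbhs_nbhs; split => //; exact: open_lt.
have [|s /andP[s1 s2] Vs] := ae_exists_in (ae_test_integral tphi) (a := t) (b := t + d0).
  by rewrite ltrDl.
have [|p1 p2 p3] := Hd s; first by rewrite /ball/= ltr_norml; apply/andP; split; lra.
have : F phi s < 0 by rewrite -Vs// (lt_trans _ tauT)// lte_fin.
by rewrite ltNge Rintegral_ge0// => x _; rewrite mulr_ge0.
Unshelve. all: by end_near.
Qed.

(** Upgrades an almost everywhere bound to every time: by L^1 continuity at t, some nearby time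
    satisfying the bound has a slice at distance at most 1, whence C + 1. *)
Lemma slice_mass_bound omega tau : bounded_mass -> compactly_contained omega Omega ->
  0 < tau -> (tau%:E < T)%E ->
  exists2 C, 0 <= C & forall t, 0 < t < tau -> \int[lam]_(x in omega) `|v (x, t)| <= C.
Proof.
move=> bm oc tau0 tauT; have [oo co cO] := oc; have mo := momega oc; have so := subomega oc.
have [C aC] := bm tau tau0 tauT _ co cO.
have C0 : 0 <= C.
  have [t t0 /(_ t0)] := ae_exists_in aC tau0; rewrite -lee_fin; apply: le_trans.
  by apply: integral_ge0 => x _; rewrite lee_fin.
exists (C + 1); first by rewrite addr_ge0.
move=> t /andP[t0 tt].
have tT : (t%:E < T)%E by rewrite (lt_trans _ tauT)// lte_fin.
have [_ /cvgrPdist_le /(_ _ ltr01) [d0 /= d00 Hd]] := vw.2 _ oc t t0 tT.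
have [s /andP[s1 s2] [Cs As]] : exists2 s, t < s < Num.min tau (t + d0) &
    (0 < s < tau -> (\int[lam]_(x in closure omega) (w (x, s))%:E <= C%:E)%E) /\
    {ae lam, forall x, Q (x, s) -> v (x, s) = w (x, s)}.
  apply: ae_exists_in; last by rewrite lt_min tt ltrDl.
  by apply: ae_mono2 aC (ae_space_time vw.1).
move: s2; rewrite lt_min => /andP[s2 s3].
have s0 : 0 < s by exact: lt_trans s1.
have sT : (s%:E < T)%E by rewrite (lt_trans _ tauT)// lte_fin.
have ivs := iv oc s0 sT; have ivt := iv oc t0 tT.
have dts : \int[lam]_(x in omega) `|v (x, s) - v (x, t)| <= 1.
  have := Hd s; rewrite /= sub0r normrN => /(_ _) /(le_trans (ler_norm _)); apply.
  by rewrite ltr_norml; apply/andP; split; lra.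
have vsC : \int[lam]_(x in omega) `|v (x, s)| <= C.
  have ws := (measurable_EFinP omega (fun x => w (x, s))).2 (measurable_funTS (mslice s)).
  rewrite /Rintegral (_ : (\int[lam]_(x in omega) _ = \int[lam]_(x in omega) (w (x, s))%:E)%E).
    rewrite -lee_fin fineK.
      apply: le_trans (Cs _); last by rewrite s0.
      apply: ge0_subset_integral => //; last exact: subset_closure.
      - exact: compact_rV_measurable.
      - by apply/measurable_EFinP; exact: measurable_funTS (mslice s).
      - by move=> x _; rewrite lee_fin.
    rewrite ge0_fin_numE; last by apply: integral_ge0 => x _; rewrite lee_fin.
    apply: (@le_lt_trans _ _ C%:E); last exact: ltry.
    apply: le_trans (Cs _); last by rewrite s0.
    apply: ge0_subset_integral => //; last exact: subset_closure.
    - exact: compact_rV_measurable.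
    - by apply/measurable_EFinP; exact: measurable_funTS (mslice s).
    - by move=> x _; rewrite lee_fin.
  apply: ae_eq_integral => //.
  - by apply/measurable_EFinP; apply: measurableT_comp => //; apply/measurable_EFinP; exact: measurable_int ivs.
  - apply: ae_mono As => x Ax ox /=.
    by rewrite Ax ?ger0_norm//; split => //; exact: so.
have ind : lam.-integrable omega (EFin \o (fun x => `|v (x, s) - v (x, t)|)).
  by have := integrable_norm (integrableB mo ivs ivt); apply: eq_integrable.
have ins := integrable_norm ivs; have int' := integrable_norm ivt.
apply: (@le_trans _ _ (\int[lam]_(x in omega) (`|v (x, s)| + `|v (x, s) - v (x, t)|))).
  apply: le_Rintegral => //.
    by have := integrableD mo ins ind; apply: eq_integrable.
  move=> x _; rewrite -[v (x, t) in leLHS](subKr (v (x, s))).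
  by rewrite (le_trans (ler_normB _ _)).
by rewrite RintegralD// lerD.
Qed.

(** In the identity between s and tau only the slab depends on s, and dominated convergence lets it
    grow to the slab starting at 0. *)
Lemma test_integral_limit L (phi : X * R -> R) tau : slab_test L phi -> 0 < tau -> (tau%:E < T)%E ->
  mu.-integrable (slab 0 tau) (EFin \o H phi) ->
  V phi s @[s --> (0 : R)^'+] --> V phi tau + \int[mu]_(p in slab 0 tau) H phi p.
Proof.
move=> Lphi tau0 tauT iH; apply/cvg_at_rightP => u [u0 cu].
have iHn : mu.-integrable setT (EFin \o ((fun p => `|H phi p|) \_ (slab 0 tau))).
  rewrite -restrict_EFin; apply/(@integrable_mkcond _ _ _ mu (slab 0 tau) (EFin \o (fun p => `|H phi p|))).
    exact: measurable_slab.
  exact: (integrable_norm iH).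
have mH : measurable_fun (slab 0 tau) (H phi) by apply/measurable_EFinP; exact: measurable_int iH.
have sub n : slab (u n) tau `<=` slab 0 tau.
  by move=> p /andP[p1 p2]; apply/andP; split => //; exact: lt_trans p1.
have c1 : \int[mu]_(p in slab (u n) tau) H phi p @[n --> \oo] --> \int[mu]_(p in slab 0 tau) H phi p.
  rewrite Rintegral_mkcond; under eq_fun do rewrite Rintegral_mkcond.
  apply: (@Rintegral_dominated _ _ _ mu setT (fun n => (H phi) \_ (slab (u n) tau)) _ ((fun p => `|H phi p|) \_ (slab 0 tau))) => //.
  - move=> n; apply: ((measurable_restrictT (H phi) (measurable_slab (u n) tau)).1).
    by apply: measurable_funS mH; [exact: measurable_slab|exact: sub].
  - apply: aeW => p _; rewrite patchE; case: ifPn => [/set_mem/andP[p0 pt]|/negP Sp].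
      apply: cvg_near_cst; near=> n; rewrite patchE mem_set//; apply/andP; split => //.
      near: n; apply: (cu [set x | x < p.2]); exact: lt_nbhsl.
    apply: cvg_near_cst; near=> n; rewrite patchE; case: ifPn => // /set_mem /sub Sp'.
    by case: Sp; rewrite mem_set.
  - by apply: ((measurable_restrictT (H phi) (measurable_slab 0 tau)).1).
  - apply: aeW => p n _; rewrite !patchE; case: ifPn => [/set_mem/sub Sp|_]; first by rewrite mem_set.
    by rewrite normr0; case: ifPn.
apply: (@cvg_trans _ (V phi tau + \int[mu]_(p in slab (u n) tau) H phi p @[n --> \oo])).
  apply: near_eq_cvg; near=> n; rewrite -(test_integral_identity Lphi (u0 n) _ tauT) ?subrKC//.
  by near: n; apply: (cu [set x | x < tau]); exact: lt_nbhsl.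
by apply: cvgD => //; exact: cvg_cst.
Unshelve. all: by end_near.
Qed.

Lemma test_slice_integrable L (phi : X * R -> R) t : cont_test L phi ->
  0 < t -> (t%:E < T)%E -> lam.-integrable Omega (EFin \o (fun x => v (x, t) * phi (x, t))).
Proof.
move=> [cL LO cphi phi0] t0 tT; have [omega oc Lo] := compactly_contained_nbhs cL LO.
have mo := momega oc; have so := subomega oc.
have cK := compact_box (s := t) (t := t) cL.
have KQ : L `*` `[t, t]%classic `<=` Q by exact: box_cylinder.
have [M M0 HM] := compact_fun_bound cK (fun p Kp => cphi p (KQ p Kp)).
have bM x : omega x -> `|phi (x, t)| <= M.
  move=> ox; have [Lx|Lx] := pselect (L x); last first.
    by rewrite phi0 ?normr0//; split => //=; exact: so.
  by apply: HM; split => //=; rewrite in_itv/= lexx.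
have mp := measurable_test_slice cphi mo so t0 tT.
have [|i1 _ _] := Rintegral_prod_diff mo (iv oc t0 tT) (iv oc t0 tT) mp mp M0 (lexx 0) bM bM.
  by move=> x _; rewrite subrr normr0.
apply/(integrable_mkcond _ (open_rV_measurable oO)); move/(integrable_mkcond _ mo) : i1.
apply: eq_integrable => // x _; rewrite !patchE; case: ifPn => [/set_mem ox|/negP ox].
  by rewrite mem_set//; exact: so.
case: ifPn => // /set_mem Ox; rewrite /= phi0 ?mulr0// => Lx; apply: ox.
by rewrite mem_set//; exact: Lo.
Qed.

(* Smooth tests have a limit by test_integral_limit; they are uniformly dense,
   and the mass is bounded near 0. *)
Lemma test_integral_cvg (f : X -> R) : bounded_mass -> Cc Omega f ->
  cvg (V (fun p => f p.1) s @[s --> (0 : R)^'+]).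
Proof.
move=> bm [cf sf]; have fd := dissipation_of_bounded_mass bm.
have [K [cK KO fK app]] := smooth_approximation (@coordinates_x R N) (@proper_rV R N) oO cf sf.
have [omega oc Ko] := compactly_contained_nbhs cK KO.
have [tau tau0 tauT] := ereal_gt_between T0.
have [C C0 HC] := slice_mass_bound bm oc tau0 tauT.
have mo := momega oc; have so := subomega oc.
apply/cauchy_cvgP; apply: cauchy_exP => e e0.
pose eps := e / (4 * (C + 1)).
have eps0 : 0 < eps by rewrite divr_gt0// mulr_gt0// ltr_wpDl.
have [psi [Cpsi psiK dist _ _]] := app eps eps0.
have [Spsi [M M0 bnd]] := slab_test_lift Cpsi cK KO psiK.
have [] // := @slab_integrable K (fun p => psi p.1) 0 tau 0 M Spsi.
- by move=> p _ _ _; have [-> ? ?] := bnd p; rewrite normr0.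
- have cB := compact_box (s := 0) (t := tau) cK.
  apply: major_finite => //.
  + exact: compact_xt_measurable.
  + exact: compact_xt_finite.
  + by rewrite mul0e.
  + by apply: fd => //; exact: box_cylinder0.
move=> iH _; have := test_integral_limit Spsi tau0 tauT iH; set l := (_ + _) => cl.
exists l; have e20 : 0 < e / 2 by rewrite divr_gt0.
move/cvgrPdist_lt : cl => /(_ _ e20) cl.
rewrite /nbhs/=; near=> s.
have s0 : 0 < s by near: s; exact: nbhs_right_gt.
have st : s < tau by near: s; exact: nbhs_right_lt.
have sT : (s%:E < T)%E by rewrite (lt_trans _ tauT)// lte_fin.
have h1 : `|l - V (fun p => psi p.1) s| < e / 2 by near: s.
have [_ _ cfl fl0] := lift_cont_test cK KO cf fK.
have [_ _ cpl pl0] := lift_cont_test cK KO (Cpsi.1 0%N) psiK.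
(* The same slice is tested against f and psi, so the error is eps times the mass, uniformly in
   s. *)
have h2 : `|V (fun p => f p.1) s - V (fun p => psi p.1) s| <= e / 4.
  rewrite /V (test_integral_restrict v fl0 Ko so s0 sT) (test_integral_restrict v pl0 Ko so s0 sT).
  have [Mf Mf0 fM] := compact_fun_bound cK (fun p _ => cf p).
  have [Mp Mp0 pM] := compact_fun_bound cK (fun p _ => (Cpsi.1 0%N : continuous psi) p).
  have m1 := measurable_test_slice cfl mo so s0 sT.
  have m2 := measurable_test_slice cpl mo so s0 sT.
  have b1 x : omega x -> `|f x| <= Mf + Mp.
    move=> _; have [Kx|Kx] := pselect (K x); last by rewrite fK// normr0 addr_ge0.
    by rewrite (le_trans (fM x Kx))// lerDl.
  have b2 x : omega x -> `|psi x| <= Mf + Mp.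
    move=> _; have [Kx|Kx] := pselect (K x); last by rewrite psiK// normr0 addr_ge0.
    by rewrite (le_trans (pM x Kx))// lerDr.
  have b3 x : omega x -> `|f x - psi x| <= eps by move=> _; rewrite distrC.
  have [_ _ /le_trans] := Rintegral_prod_diff mo (iv oc s0 sT) (iv oc s0 sT) m1 m2
     (addr_ge0 Mf0 Mp0) (ltW eps0) b1 b2 b3.
  apply; under eq_Rintegral do rewrite subrr normr0.
  rewrite Rintegral_cst// mul0r mulr0 add0r.
  apply: (@le_trans _ _ (eps * C)); first by rewrite ler_wpM2l ?(ltW eps0)// HC// s0.
  rewrite /eps (_ : _ * C = e / 4 * (C / (C + 1))); last by field; rewrite gt_eqF// ltr_wpDl.
  by rewrite ler_piMr ?divr_ge0 ?(ltW e0)// ?addr_ge0// ler_pdivrMr ?ltr_wpDl// mul1r lerDl.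
rewrite /ball/=; move: h1 h2; move: (V _ s) (V _ s) => a b.
rewrite ltr_norml ler_norml ltr_norml => /andP[? ?] /andP[? ?]; apply/andP; split; lra.
Unshelve. all: by end_near.
Qed.

Lemma initial_trace_exists : bounded_mass -> exists u0, initial_trace Omega v u0.
Proof.
move=> bm.
have [tau tau0 tauT] := ereal_gt_between T0.
pose Lam (f : X -> R) := lim (V (fun p => f p.1) s @[s --> (0 : R)^'+]).
have cL f : Cc Omega f -> V (fun p => f p.1) s @[s --> (0 : R)^'+] --> Lam f by exact: test_integral_cvg.
have supp f : Cc Omega f -> exists L, [/\ compact L, L `<=` Omega & forall x, ~ L x -> f x = 0].
  move=> [_ [cS SO]]; exists (closure [set x | f x != 0]); split => // x Sx.
  by apply: contrapT => /eqP fx; apply: Sx; exact: subset_closure.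
have near0 (P : R -> Prop) : (forall s, 0 < s -> (s%:E < T)%E -> P s) -> \forall s \near (0 : R)^'+, P s.
  move=> HP; near=> s; apply: HP; first by near: s; exact: nbhs_right_gt.
  rewrite (lt_trans _ tauT)// lte_fin; near: s; exact: nbhs_right_lt.
have isl f s : Cc Omega f -> 0 < s -> (s%:E < T)%E ->
    lam.-integrable Omega (EFin \o (fun x => v (x, s) * f x)).
  move=> Cf s0 sT; have [L [cL' LO fL]] := supp f Cf.
  exact: (test_slice_integrable (lift_cont_test cL' LO Cf.1 fL)).
have mO := open_rV_measurable oO.
have LamD f h : Cc Omega f -> Cc Omega h -> Lam (fun x => f x + h x) = Lam f + Lam h.
  move=> Cf Ch; apply: cvg_lim => //.
  apply: cvg_trans (cvgD (cL f Cf) (cL h Ch)); apply: near_eq_cvg.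
  apply: near0 => s s0 sT.
  rewrite -[LHS]/(V (fun p => f p.1) s + V (fun p => h p.1) s) /V -RintegralD//; [|exact: isl|exact: isl].
  by apply: eq_Rintegral => x _; rewrite mulrDr.
have LamZ c f : Cc Omega f -> Lam (fun x => c * f x) = c * Lam f.
  move=> Cf; apply: cvg_lim => //.
  apply: cvg_trans (cvgM (cvg_cst c) (cL f Cf)); apply: near_eq_cvg.
  apply: near0 => s s0 sT.
  rewrite -[LHS]/(c * V (fun p => f p.1) s) /V -RintegralZl//; last exact: isl.
  by apply: eq_Rintegral => x _; rewrite mulrCA.
have Lam_ge0 f : Cc Omega f -> (forall x, 0 <= f x) -> 0 <= Lam f.
  move=> Cf f0; apply: (cvgr_to_ge (cL f Cf)); apply: near0 => s s0 sT.
  have [L [cL' LO fL]] := supp f Cf.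
  by apply: (test_integral_ge0 (lift_cont_test cL' LO Cf.1 fL)).
have [m [rm mE]] := riesz_representation oO LamD LamZ Lam_ge0.
by exists m; split => // f Cf; rewrite mE//; exact: cL.
Unshelve. all: by end_near.
Qed.

(** Against a cutoff at least 1 on L, the slice integrals are bounded close to 0 by convergence and
    on the remaining compact interval of times by continuity. *)
Lemma bounded_mass_of_trace u0 : initial_trace Omega v u0 -> bounded_mass.
Proof.
move=> [_ tr] tau tau0 tauT L cL LO.
have [chi [Cchi chi0 chi1]] := cutoff_exists (@proper_rV R N) oO cL LO.
have [cchi [cS SO]] := Cchi.
pose phi (p : X * R) := chi p.1.
have tphi : cont_test (closure [set x | chi x != 0]) phi.
  apply: lift_cont_test => // x Sx.
  by apply: contrapT => /eqP fx; apply: Sx; exact: subset_closure.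
have [del del0 Hdel] : exists2 del, 0 < del & forall s, 0 < s -> s < del ->
    V phi s <= \int[u0]_(x in Omega) chi x + 1.
  have := tr _ Cchi; move/cvgrPdist_le => /(_ _ ltr01) [del /= del0 Hd].
  exists del => // s s0 sd; have := Hd s; rewrite /= sub0r normrN gtr0_norm// => /(_ sd s0).
  rewrite ler_norml -/(V phi s) => /andP[h _]; rewrite -lerBlDl.
  by rewrite -lerN2 opprB.
have [M M0 HM] : exists2 M, 0 <= M & forall t, `[del / 2, tau]%classic t -> `|V phi t| <= M.
  apply: compact_fun_bound; first exact: segment_compact.
  move=> t; rewrite /= in_itv/= => /andP[t1 t2].
  apply: (test_integral_continuous tphi).
    by rewrite (lt_le_trans _ t1)// divr_gt0.
  by rewrite (le_lt_trans _ tauT).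
exists (Num.max (\int[u0]_(x in Omega) chi x + 1) M).
apply: ae_mono2 (ae_slice_value tphi tauT) (ae_test_integral tphi) => t Ht Vt t0t.
have [_ it] := Ht t0t; have /andP[t0 tt] := t0t.
apply: le_trans (@slice_mass_le L phi t cL _ _ it) _ => //.
rewrite -Vt//; last by rewrite (lt_trans _ tauT)// lte_fin.
rewrite lee_fin le_max.
have [td|dt'] := ltP t del; first by rewrite Hdel.
apply/orP; right; apply: (le_trans (ler_norm _)); apply: HM; rewrite /= in_itv/= (ltW tt) andbT.
by rewrite (le_trans _ dt')// ler_pdivrMr// ler_peMr ?(ltW del0)// ler1n.
Qed.

(** The trace gives the limit of slice integrals only against a fixed function. As phi(., s) tends
    uniformly to phi0 and the mass stays bounded, phi(., s) may replace phi0; the result is compared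
    with the limit from [test_integral_limit]. *)
Lemma initial_trace_identity u0 L (phi : X * R -> R) (phi0 : X -> R) tau :
  initial_trace Omega v u0 -> slab_test L phi -> 0 < tau -> (tau%:E < T)%E ->
  mu.-integrable (slab 0 tau) (EFin \o H phi) ->
  Cc Omega phi0 -> (forall x, ~ L x -> phi0 x = 0) ->
  (forall e, 0 < e -> \forall s \near (0 : R)^'+, forall x, L x -> `|phi (x, s) - phi0 x| <= e) ->
  V phi tau + \int[mu]_(p in slab 0 tau) H phi p = \int[u0]_(x in Omega) phi0 x.
Proof.
move=> tr Lphi tau0 tauT iH Cphi0 phi0L unif.
have bm := bounded_mass_of_trace tr.
have [cL LO _ _ phiL] := Lphi; have cphi := slab_cont Lphi.
have [omega oc Lo] := compactly_contained_nbhs cL LO.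
have mo := momega oc; have so := subomega oc.
have [C C0 HC] := slice_mass_bound bm oc tau0 tauT.
have [M M0 HM] := Cc_bounded Cphi0.
have c1 := test_integral_limit Lphi tau0 tauT iH.
have c2 := tr.2 _ Cphi0.
suff c3 : V phi s - V (fun p => phi0 p.1) s @[s --> (0 : R)^'+] --> 0.
  have c4 : V phi s @[s --> (0 : R)^'+] --> \int[u0]_(x in Omega) phi0 x.
    rewrite -[X in _ --> X]addr0; apply: cvg_trans (cvgD c2 c3).
    apply: near_eq_cvg; near=> s.
    rewrite -[LHS]/(V (fun p => phi0 p.1) s + (V phi s - V (fun p => phi0 p.1) s)).
    by rewrite addrC subrK.
  exact: (cvg_unique _ c1 c4).
apply/cvgrPdist_le => e e0.
(* The minimum with 1 also bounds phi(., s) by M + 1, uniformly in s. *)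
pose eps := Num.min 1 (e / (C + 1)).
have eps0 : 0 < eps by rewrite lt_min ltr01 divr_gt0// ltr_wpDl.
near=> s.
have s0 : 0 < s by near: s; exact: nbhs_right_gt.
have st : s < tau by near: s; exact: nbhs_right_lt.
have sT : (s%:E < T)%E by rewrite (lt_trans _ tauT)// lte_fin.
have us : forall x, L x -> `|phi (x, s) - phi0 x| <= eps by near: s; exact: unif.
have [_ _ cl phi0L'] := lift_cont_test cL LO Cphi0.1 phi0L.
rewrite sub0r normrN /V (test_integral_restrict v phiL Lo so s0 sT).
rewrite (test_integral_restrict v phi0L' Lo so s0 sT).
have b3 x : omega x -> `|phi (x, s) - phi0 x| <= eps.
  move=> ox; have [Lx|Lx] := pselect (L x); first exact: us.
  rewrite phiL ?phi0L ?subrr ?normr0 ?(ltW eps0)//; split => //=; exact: so.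
have b2 x : omega x -> `|phi0 x| <= M + 1 by move=> _; rewrite (le_trans (HM x))// lerDl.
have b1 x : omega x -> `|phi (x, s)| <= M + 1.
  move=> ox; rewrite -[phi _](subrK (phi0 x)) (le_trans (ler_normD _ _))// addrC lerD//.
  by rewrite (le_trans (b3 x ox))// ge_min lexx.
have m1 := measurable_test_slice cphi mo so s0 sT.
have m2 := measurable_test_slice cl mo so s0 sT.
have [_ _ /le_trans] := Rintegral_prod_diff mo (iv oc s0 sT) (iv oc s0 sT) m1 m2
   (addr_ge0 M0 ler01) (ltW eps0) b1 b2 b3.
apply; under eq_Rintegral do rewrite subrr normr0.
rewrite Rintegral_cst// mul0r mulr0 add0r.
apply: (@le_trans _ _ (eps * C)); first by rewrite ler_wpM2l ?(ltW eps0)// HC// s0.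
apply: (@le_trans _ _ (e / (C + 1) * C)); first by rewrite ler_wpM2r// ge_min lexx orbT.
by rewrite mulrAC ler_pdivrMr ?ltr_wpDl// ler_pM2l// lerDl.
Unshelve. all: by end_near.
Qed.

End pde.

(** * Weak solutions *)

Section local_integrability.
Context {R : realType} {N : nat}.
Local Notation X := 'rV[R]_N.
Local Notation XT := (X * measurableTypeR R)%type.
Local Notation mu := (@lebesgue_xt R N).

(** Used to obtain measurability on the whole open set from integrability on its compact subsets. *)
Lemma open_compact_exhaustion (A : set (X * R)) : open A ->
  exists K : nat -> set (X * R), [/\ forall n, compact (K n), forall n, K n `<=` A &
    A = \bigcup_n K n].
Proof.
move=> oA; pose D := dist1 (~` A).
have clA : closed (~` A) by exact: open_closedC.
exists (fun n => [set p | `|p| <= n%:R] `&` [set p | n.+1%:R^-1 <= D p]); split.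
- move=> n; apply: subclosed_compact (@proper_xt R N n%:R) _; last by move=> p [].
  apply: closedI.
    by apply: compact_closed; [exact: norm_hausdorff|exact: proper_xt].
  by apply: (@preimage_closed _ _ D [set t | n.+1%:R^-1 <= t]); [move=> p _; exact: dist1_continuous|exact: closed_ge].
- move=> n p [_ /= Dp]; apply: contrapT => Ap; move: Dp.
  by rewrite /D dist1_eq0// leNgt invr_gt0 ltr0Sn.
apply/seteqP; split => [p Ap|p [n _ [_ /= Dp]]]; last first.
  by apply: contrapT => Ap; move: Dp; rewrite /D dist1_eq0// leNgt invr_gt0 ltr0Sn.
have Dp : 0 < D p by apply: dist1_gt0 => //; exact.
have [n1 _ /(_ (n1 + Num.trunc `|p|)%N (leq_addr _ _))/= Hn] := near_infty_natSinv_lt (PosNum Dp).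
exists (n1 + Num.trunc `|p|).+1 => //; split => /=.
  rewrite -addnS natrD ler_wpDl// ltW// truncnS_gt//.
apply: le_trans (ltW Hn); rewrite lef_pV2 ?posrE ?ltr0Sn// ler_nat; exact: leqnSn.
Qed.

Variables (A : set (X * R)) (oA : open A).

Lemma L1loc_measurable (f : X * R -> R) : L1loc A f -> measurable_fun (A : set XT) (f : XT -> R).
Proof.
move=> fi; have [K [cK KA ->]] := open_compact_exhaustion oA.
apply/(@measurable_fun_bigcup _ _ _ _ (K : nat -> set XT)) => [n|n].
  exact: compact_xt_measurable.
by apply/measurable_EFinP; exact: measurable_int (fi _ (cK n) (KA n)).
Qed.

Lemma L1loc_mul_integrable (f h : X * R -> R) : L1loc A f -> continuous h ->
  compact_support_in A h -> mu.-integrable (A : set XT) (EFin \o (fun p => f p * h p)).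
Proof.
move=> fi ch [cK KA]; set K := closure _ in cK KA.
have h0 p : ~ K p -> h p = 0.
  by move=> Kp; apply: contrapT => /eqP fp; apply: Kp; exact: subset_closure.
have mK : measurable (K : set XT) by exact: compact_xt_measurable.
have mA : measurable (A : set XT) by exact: open_xt_measurable.
have [M M0 HM] := compact_fun_bound cK (fun p _ => ch p).
have ifK := fi K cK KA.
have iM := integrableZl mK M ifK.
have i1 : mu.-integrable (K : set XT) (EFin \o (fun p => f p * h p)).
  apply: le_integrable iM => //.
    apply/measurable_EFinP; apply: measurable_funM.
      by apply/measurable_EFinP; exact: measurable_int ifK.
    apply: measurable_funTS.
    exact: (continuous_measurable_xt openT (fun p _ => ch p)).
  move=> p Kp; rewrite /= lee_fin !normrM mulrC ler_wpM2r// (ger0_norm M0); exact: HM.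
apply/(integrable_mkcond _ mA); move/(integrable_mkcond _ mK) : i1.
apply: eq_integrable => // p _; rewrite !patchE; case: ifPn => [/set_mem Kp|/negP Kp].
  by rewrite mem_set//; exact: KA.
case: ifPn => // _; rewrite /= h0 ?mulr0// => Kp'; apply: Kp; exact: mem_set.
Qed.

End local_integrability.

Lemma continuous_at_dist (R : realType) (E : normedModType R) (f : E -> R) x :
  (forall e, 0 < e -> exists2 A, nbhs x A & forall y, A y -> `|f x - f y| <= e) ->
  {for x, continuous f}.
Proof.
move=> H; apply/cvgrPdist_le => e /H[A nA HA].
by apply: filterS nA => y /HA.
Qed.

(** * Test functions that are C^1 up to the initial time *)

Section cylinder0_tests.
Context {R : realType} {N : nat}.
Local Notation X := 'rV[R]_N.
Local Notation XT := (X * measurableTypeR R)%type.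
Variables (Omega : set X) (T : \bar R).
Hypotheses (oO : open Omega) (T0 : (0 < T)%E).

Let oQ : open (cylinder Omega T). Proof. exact: cylinder_open. Qed.

Let sub0 : cylinder Omega T `<=` cylinder0 Omega T.
Proof. by move=> p [Op p0 pT]; split => //; exact: ltW. Qed.

Lemma within_cylinder0_continuous (f : X * R -> R) p :
  {within cylinder0 Omega T, continuous f} -> cylinder Omega T p -> {for p, continuous f}.
Proof.
move=> cf Qp; have := continuous_subspaceW sub0 cf.
by rewrite continuous_open_subspace// => /(_ p); apply; exact: mem_set.
Qed.

Lemma within_cylinder0_bound (f : X * R -> R) L tau :
  {within cylinder0 Omega T, continuous f} -> compact L -> L `<=` Omega -> (tau%:E < T)%E ->
  exists2 M, 0 <= M & forall p, (L `*` `[0, tau]%classic) p -> `|f p| <= M.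
Proof.
move=> cf cL LO tauT; set K := L `*` _.
have cK : compact K by exact: compact_box.
have KQ : K `<=` cylinder0 Omega T by exact: box_cylinder0.
have cfK : compact (f @` K).
  by apply: continuous_compact => //; exact: continuous_subspaceW cf.
have [M [_ HM]] := compact_bounded cfK.
exists (`|M| + 1); first by rewrite addr_ge0.
move=> p Kp; apply: (HM (`|M| + 1)); last by exists p.
by rewrite (le_lt_trans (ler_norm M))// ltrDl.
Qed.

(** The derivatives exist for t > 0 only, but they coincide there with functions continuous up to t
    = 0, so they are bounded on compact boxes touching the initial time. *)
Lemma C1c_cylinder0_test phi : C1c_cylinder0 Omega T phi -> exists L,
  [/\ slab_test Omega T L phi,
   forall x, Omega x -> ~ L x -> phi (x, 0) = 0 &
   forall tau, (tau%:E < T)%E -> exists2 M, 0 <= M & forall p, cylinder Omega T p ->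
     slab 0 tau p -> L p.1 ->
     [/\ `|dt phi p| <= M, forall i, `|dx i phi p| <= M & `|phi p| <= M]].
Proof.
move=> [cphi dphi Dphi [K [cK KQ phiK]]].
pose L := fst @` K.
have cL : compact L.
  by apply: continuous_compact => //; apply: continuous_subspaceT => p; exact: cvg_fst.
have LO : L `<=` Omega by move=> _ [p Kp <-]; have [] := KQ p Kp.
have phiL p : cylinder0 Omega T p -> ~ L p.1 -> phi p = 0.
  by move=> Qp Lp; apply: phiK => // Kp; apply: Lp; exists p.
exists L; split.
- split => //.
  + move=> j p Qp; have [h ch Dh] := Dphi (basis_xt j).
    apply: (near_eq_continuous _ (within_cylinder0_continuous ch Qp)).
    by have := open_nbhs_nbhs (conj oQ Qp); apply: filterS => r /Dh.
  + by move=> p Qp; apply: phiL; exact: sub0.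
- by move=> x Ox Lx; apply: phiL.
move=> tau tauT.
have [M0 M00 HM0] := within_cylinder0_bound cphi cL LO tauT.
have bD v : exists2 M, 0 <= M & forall p,
    [set p | [/\ cylinder Omega T p, slab 0 tau p & L p.1]] p -> `|'D_v phi p| <= M.
  have [h ch Dh] := Dphi v; have [M Mge0 HM] := within_cylinder0_bound ch cL LO tauT.
  exists M => // p [Qp /andP[p0 pt] Lp]; rewrite Dh//; apply: HM; split => //=.
  by rewrite in_itv/= !ltW.
have [Mt Mt0 HMt] := bD (0, 1).
have [Mx Mx0 HMx] := family_bound (fun i : 'I_N => bD (delta_mx 0 i, 0)).
exists (M0 + Mt + Mx); first by rewrite !addr_ge0.
move=> p Qp Sp Lp; split.
- by rewrite (le_trans (HMt p _))// addrAC lerDr addr_ge0.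
- by move=> i; rewrite (le_trans (HMx i p _))// lerDr addr_ge0.
- rewrite (le_trans (HM0 p _)) -?addrA ?lerDl ?addr_ge0//; split => //=.
  by case/andP : Sp => p0 pt; rewrite in_itv/= !ltW.
Qed.

(** Values of phi outside Omega are arbitrary, so the initial value is redefined as 0 there; it
    stays continuous because it vanishes off the compact L. Uniform convergence as s -> 0 is by
    compactness of L. *)
Lemma cylinder0_initial_value phi L : {within cylinder0 Omega T, continuous phi} ->
  compact L -> L `<=` Omega -> (forall x, Omega x -> ~ L x -> phi (x, 0) = 0) ->
  exists phi0, [/\ Cc Omega phi0, forall x, ~ L x -> phi0 x = 0,
    forall x, Omega x -> phi0 x = phi (x, 0) &
    forall e, 0 < e -> \forall s \near (0 : R)^'+, forall x, L x -> `|phi (x, s) - phi0 x| <= e].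
Proof.
move=> cphi cL LO phiL.
pose phi0 x := if `[< Omega x >] then phi (x, 0) else 0.
have phi0E x : Omega x -> phi0 x = phi (x, 0) by move=> Ox; rewrite /phi0 asboolT.
have phi0L x : ~ L x -> phi0 x = 0.
  by move=> Lx; rewrite /phi0; case: asboolP => // Ox; exact: phiL.
have clL : closed L by apply: compact_closed => //; exact: norm_hausdorff.
have loc x e : Omega x -> 0 < e -> exists2 AB : set X * set R, nbhs x AB.1 /\ nbhs (0 : R) AB.2 &
    forall y s, AB.1 y -> AB.2 s -> 0 <= s -> (s%:E < T)%E -> Omega y /\ `|phi (x, 0) - phi (y, s)| <= e.
  move=> Ox e0; have Qx : cylinder0 Omega T (x, 0) by split.
  have := (subspace_continuousP (cylinder0 Omega T) phi).1 cphi (x, 0) Qx; move/cvgrPdist_le => /(_ _ e0).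
  rewrite near_withinE => -[[A B] /= [nA nB] AB].
  exists (A `&` Omega, B).
    by split => //=; apply: filterI => //; exact: open_nbhs_nbhs.
  move=> y s [/= Ay Oy] Bs s0 sT; split => //.
  by apply: (AB (y, s)) => //; split.
have cx (x : X) : Omega x -> {for x, continuous phi0}.
  move=> Ox; apply: continuous_at_dist => e e0.
  have [[A B] /= [nA nB] AB] := loc x e Ox e0.
  exists A => // y Ay; have [Oy h] := AB y 0 Ay (nbhs_singleton nB) (lexx 0) T0.
  by rewrite !phi0E.
exists phi0; split => //.
- split; last exact: compact_support_sub cL LO phi0L.
  move=> x; have [Lx|Lx] := pselect (L x); last first.
    have phix : \forall y \near x, phi0 y = 0.
      have := open_nbhs_nbhs (conj (closed_openC clL) Lx).
      by apply: filterS => y /phi0L.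
    by apply: (@near_eq_continuous _ _ phi0 (cst 0) x phix); exact: cst_continuous.
  exact: cx (LO _ Lx).
- move=> e e0; have [+ _] := compact_near_coveringP L => /(_ cL).
  move=> /(_ _ (0 : R)^'+ (fun s x => `|phi (x, s) - phi0 x| <= e)); apply => x Lx.
  have e20 : 0 < e / 2 by rewrite divr_gt0.
  have Ox := LO _ Lx; have [[A B] /= [nA nB] AB] := loc x _ Ox e20.
  have [tau tau0 tauT] := ereal_gt_between T0.
  exists (A, [set s | [/\ B s, 0 < s & s < tau]]) => /=.
    split => //; near=> s; split; near: s; last 2 first.
    + exact: nbhs_right_gt.
    + exact: nbhs_right_lt.
    + exact: (cvg_at_right_filter (f := id) cvg_id).
  move=> [y s] /= [Ay [Bs s0 st]].
  have sT : (s%:E < T)%E by rewrite (lt_trans _ tauT)// lte_fin.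
  have [Oy h1] := AB y s Ay Bs (ltW s0) sT.
  have [_ h2] := AB y 0 Ay (nbhs_singleton nB) (lexx 0) T0.
  rewrite phi0E//; move: h1 h2; move: (phi (x, 0)) (phi (y, s)) (phi (y, 0)) => a b c.
  by rewrite !ler_norml => /andP[? ?] /andP[? ?]; apply/andP; split; lra.
Unshelve. all: by end_near.
Qed.

End cylinder0_tests.

(** * Reduction of weak solutions to nonnegative measurable data *)

Section reduction.
Context {R : realType} {N : nat}.
Local Notation X := 'rV[R]_N.
Local Notation XT := (X * measurableTypeR R)%type.
Local Notation lam := (@lebesgue_rV R N).
Local Notation ell := (@lebesgue_measure R).
Local Notation mu := (@lebesgue_xt R N).
Variables (q : R) (T : \bar R) (Omega : set X) (u : X * R -> R) (Du : X * R -> X).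
Hypotheses (q1 : 1 < q) (T0 : (0 < T)%E) (oO : open Omega)
  (sol : nonneg_weak_solution Omega T q u Du).
Local Notation Q := (cylinder Omega T : set XT).

Let G (p : X * R) := enorm (Du p) `^ q.
(** Since u is nonnegative only almost everywhere, |u| is taken to have a sign at every point. *)
Let w : XT -> R := (fun p => `|u p|) \_ Q.
Let g : XT -> R := (G : XT -> R) \_ Q.
Let d i : XT -> R := (fun p => Du p 0 i) \_ Q.

Let oQ : open (cylinder Omega T). Proof. exact: cylinder_open. Qed.
Let mQ : measurable Q. Proof. exact: open_xt_measurable. Qed.
Let iu : L1loc (cylinder Omega T) u. Proof. by case: sol. Qed.
Let iD i : L1loc (cylinder Omega T) (fun p => Du p 0 i).
Proof. by have [_ _ wg _ _] := sol; exact: (wg i).1. Qed.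
Let iG : L1loc (cylinder Omega T) G. Proof. by case: sol. Qed.
Let measurable_u : measurable_fun Q (u : XT -> R). Proof. exact: L1loc_measurable. Qed.
Let mD i : measurable_fun Q (fun p : XT => Du p 0 i). Proof. exact: L1loc_measurable. Qed.
Let mG : measurable_fun Q (G : XT -> R). Proof. exact: L1loc_measurable. Qed.
Let mw : measurable_fun setT w.
Proof. by apply: (measurable_restrictT _ mQ).1; exact: measurableT_comp. Qed.
Let mg : measurable_fun setT g.
Proof. exact: (measurable_restrictT _ mQ).1. Qed.
Let md i : measurable_fun setT (d i).
Proof. exact: (measurable_restrictT _ mQ).1. Qed.
Let w0 p : 0 <= w p. Proof. by rewrite /w patchE; case: ifPn. Qed.
Let g0 p : 0 <= g p. Proof. by rewrite /g patchE; case: ifPn => // _; exact: powR_ge0. Qed.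
Let wQ p : ~ Q p -> w p = 0.
Proof. by move=> Qp; rewrite /w patchE; case: ifPn => // /set_mem. Qed.
Let gQ p : ~ Q p -> g p = 0.
Proof. by move=> Qp; rewrite /g patchE; case: ifPn => // /set_mem. Qed.
Let dQ i p : ~ Q p -> d i p = 0.
Proof. by move=> Qp; rewrite /d patchE; case: ifPn => // /set_mem. Qed.
Let wE p : Q p -> w p = `|u p|. Proof. by move=> Qp; rewrite /w patchE mem_set. Qed.
Let gE p : Q p -> g p = G p. Proof. by move=> Qp; rewrite /g patchE mem_set. Qed.
Let dE i p : Q p -> d i p = Du p 0 i. Proof. by move=> Qp; rewrite /d patchE mem_set. Qed.

Let dg i p : `|d i p| <= 1 + g p.
Proof.
have [Qp|Qp] := pselect (Q p); last by rewrite dQ// normr0 addr_ge0.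
rewrite dE// gE// /G.
have de : `|Du p 0 i| <= enorm (Du p).
  rewrite -sqrtr_sqr ler_wsqrtr// /dotprod (bigD1 i)//= -expr2 lerDl.
  by apply: sumr_ge0 => j _; rewrite -expr2 sqr_ge0.
apply: (le_trans de); have [e1|/ltW e1] := leP (enorm (Du p)) 1.
  by rewrite (le_trans e1)// lerDl powR_ge0.
by rewrite (le_trans (le1r_powR e1 (ltW q1)))// lerDr.
Qed.

Let finite_loc (f : XT -> R) (h : X * R -> R) K : L1loc (cylinder Omega T) h ->
  (forall p, Q p -> f p = `|h p|) ->
  compact K -> K `<=` Q -> (\int[mu]_(p in K) (f p)%:E < +oo)%E.
Proof.
move=> ih fh cK KQ; have /integrableP[_] := ih K cK KQ; apply: le_lt_trans.
rewrite le_eqVlt; apply/orP; left; apply/eqP; apply: eq_integral => p /set_mem /KQ Qp.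
by rewrite fh.
Qed.

Let iw K : compact K -> K `<=` Q -> (\int[mu]_(p in K) (w p)%:E < +oo)%E.
Proof. exact: finite_loc iu wE. Qed.

Let ig K : compact K -> K `<=` Q -> (\int[mu]_(p in K) (g p)%:E < +oo)%E.
Proof. by apply: finite_loc iG _ => p Qp; rewrite gE// ger0_norm// powR_ge0. Qed.

Let cont_mQ (f : X * R -> R) : continuous f -> measurable_fun Q (f : XT -> R).
Proof. by move=> cf; apply: continuous_measurable_xt => // p _; exact: cf. Qed.

Let ae_wu : {ae mu, forall p, Q p -> w p = u p}.
Proof.
have [u0 _ _ _ _] := sol.
apply: ae_mono u0 => p up Qp.
by rewrite wE// ger0_norm//; exact: up.
Qed.

(** Moves between integrals of the extended data over the whole space and those of u, Du over Q,
    which agree only almost everywhere. *)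
Let restrict_integral (f h : XT -> R) : (forall p, ~ Q p -> f p = 0) ->
  measurable_fun Q f -> measurable_fun Q h ->
  {ae mu, forall p, Q p -> f p = h p} -> \int[mu]_p f p = \int[mu]_(p in Q) h p.
Proof.
move=> f0 mf mh fh; rewrite (_ : \int[mu]_p f p = \int[mu]_(p in Q) f p).
  congr fine; apply: ae_eq_integral => //; [exact/measurable_EFinP|exact/measurable_EFinP|].
  by apply: ae_mono fh => p fhp Qp /=; rewrite fhp.
rewrite [RHS]Rintegral_mkcond; apply: eq_Rintegral => p _; rewrite patchE.
by case: ifPn => // /negP Qp; rewrite f0// => Qp'; apply: Qp; exact: mem_set.
Qed.

Let Ccd (phi : X * R -> R) v : Cc_infty (cylinder Omega T) phi ->
  Cc_infty (cylinder Omega T) (fun p => 'D_v phi p).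
Proof.
move=> [Cphi [cK KQ]]; split; first by move=> k; exact: Ck_derive.
apply: (compact_support_sub cK KQ) => p Kp.
apply: (derive_off_support _ (@closed_closure _ _) _ Kp) => r Kr.
by apply: contrapT => /eqP fr; apply: Kr; exact: subset_closure.
Qed.

Let mlap (phi : X * R -> R) : Cc_infty (cylinder Omega T) phi ->
  continuous (laplacian phi).
Proof.
move=> [Cphi _]; apply: (@Ck_sum _ _ 0) => i.
by apply: Ck_derive => k; exact: Ck_derive.
Qed.

Let E2 phi : Cc_infty Q phi ->
  \int[mu]_p (- w p * dt phi p - w p * laplacian phi p + g p * phi p) = 0.
Proof.
move=> Cphi; have [_ _ _ _ /(_ phi Cphi) <-] := sol.
have cphi : continuous phi by exact: Cphi.1 0%N.
have cdt : continuous (dt phi) by exact: (Ccd (0, 1) Cphi).1 0%N.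
have ms (f1 f2 : XT -> R) : measurable_fun Q f1 -> measurable_fun Q f2 ->
    measurable_fun Q (fun p => - f1 p * dt phi p - f1 p * laplacian phi p + f2 p * phi p).
  move=> m1 m2; have mn : measurable_fun Q (fun p => - f1 p) by exact: measurableT_comp.
  have c1 := cont_mQ cdt; have c2 := cont_mQ (mlap Cphi); have c3 := cont_mQ cphi.
  apply: measurable_funD; last exact: measurable_funM.
  by apply: measurable_funB; exact: measurable_funM.
apply: restrict_integral.
- by move=> p Qp; rewrite wQ// gQ//; ring.
- by apply: ms; exact: measurable_funTS.
- exact: ms.
- apply: ae_mono ae_wu => p wu Qp.
  by rewrite wu// gE.
Qed.

(** Each [dx i phi] is itself a test function, so the definition of the weak gradient turns the
    Laplacian term into the one with Du . grad phi. *)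
Let E1 phi : Cc_infty Q phi ->
  \int[mu]_p jet w g d (dt phi) (fun i => dx i phi) phi p = 0.
Proof.
move=> Cphi; have [_ _ wg _ /(_ phi Cphi) E0] := sol.
have cphi : continuous phi by exact: Cphi.1 0%N.
have cdt : continuous (dt phi) by exact: (Ccd (0, 1) Cphi).1 0%N.
have Cdx i : Cc_infty (cylinder Omega T) (dx i phi) by exact: (Ccd (delta_mx 0 i, 0) Cphi).
have cdx i : continuous (dx i phi) by exact: (Cdx i).1 0%N.
have Cdxx i : Cc_infty (cylinder Omega T) (dx i (dx i phi)) by exact: (Ccd (delta_mx 0 i, 0) (Cdx i)).
have iut := L1loc_mul_integrable oQ iu cdt (Ccd (0, 1) Cphi).2.
have iuxx i := L1loc_mul_integrable oQ iu ((Cdxx i).1 0%N) (Cdxx i).2.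
have iDx i := L1loc_mul_integrable oQ (iD i) (cdx i) (Cdx i).2.
have iGp := L1loc_mul_integrable oQ iG cphi Cphi.2.
have sumI (f : 'I_N -> XT -> R) : (forall i, mu.-integrable Q (EFin \o f i)) ->
    mu.-integrable Q (EFin \o (fun p => \sum_i f i p)) /\
    \int[mu]_(p in Q) \sum_i f i p = \sum_i \int[mu]_(p in Q) f i p.
  move=> fi; have EE : EFin \o (fun p => \sum_i f i p) = fun p => (\sum_(i < N) (f i p)%:E)%E.
    by apply/funext => p; rewrite /= sumEFin.
  split; first by rewrite EE; apply: integrable_sum => // i _; exact: fi.
  rewrite /Rintegral -[X in fine (integral _ _ X)]/(EFin \o (fun p => \sum_i f i p)) EE.
  rewrite integral_sum// (eq_bigr (fun i => (fine (\int[mu]_(p in Q) (f i p)%:E))%:E)) ?sumEFin// => i _.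
  by rewrite fineK//; apply: integrable_fin_num => //; exact: fi.
have [is1 s1] := sumI _ iDx; have [is2 s2] := sumI _ iuxx.
have sE : \int[mu]_(p in Q) (\sum_i Du p 0 i * dx i phi p) =
    - \int[mu]_(p in Q) (\sum_i u p * dx i (dx i phi) p).
  rewrite s1 s2 -sumrN; apply: eq_bigr => i _.
  by have := (wg i).2 _ (Cdx i) => ->; rewrite opprK.
have iutG : mu.-integrable Q (EFin \o (fun p => G p * phi p - u p * dt phi p)).
  by have := integrableB mQ iGp iut; apply: eq_integrable.
have EA : \int[mu]_(p in Q) (G p * phi p - u p * dt phi p) =
    \int[mu]_(p in Q) (\sum_i u p * dx i (dx i phi) p).
  apply/eqP; rewrite -subr_eq0 -RintegralB//; apply/eqP; rewrite -[RHS]E0.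
  apply: eq_Rintegral => p _; rewrite /laplacian mulr_sumr /G; ring.
transitivity (\int[mu]_(p in Q) (\sum_i Du p 0 i * dx i phi p + (G p * phi p - u p * dt phi p))); last first.
  by rewrite RintegralD// sE EA addNr.
have mphi := cont_mQ cphi; have mdt := cont_mQ cdt; have mdx i := cont_mQ (cdx i).
apply: restrict_integral.
- by move=> p Qp; exact: (jet_out wQ gQ dQ).
- apply: measurable_funTS; exact: (measurable_jet mQ mw mg md wQ gQ dQ).
- apply: measurable_funD.
    by apply/measurable_EFinP; exact: measurable_int is1.
  by apply/measurable_EFinP; exact: measurable_int iutG.
- apply: ae_mono ae_wu => p wu Qp.
  rewrite /jet wu// gE//.
  rewrite (eq_bigr (fun i => Du p 0 i * dx i phi p)) => [|i _]; last by rewrite dE.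
  by ring.
Qed.

Lemma bounded_massE : bounded_mass Omega T w <-> Linfty_loc_L1loc Omega T u.
Proof.
have slice t D : 0 < t -> (t%:E < T)%E -> D `<=` Omega ->
    (\int[lam]_(x in D) `|u (x, t)|%:E = \int[lam]_(x in D) (w (x, t))%:E)%E.
  by move=> t0 tT DO; apply: eq_integral => x /set_mem Dx; rewrite wE//; split => //; exact: DO.
have ms t D : measurable_fun D (fun x => (w (x, t))%:E).
  apply: measurable_funTS; apply/measurable_EFinP.
  have mpt : measurable_fun setT (fun x : X => (x, t) : XT) by apply: measurable_fun_pair.
  exact: measurableT_comp mw mpt.
have mono t A B : measurable A -> measurable B -> A `<=` B ->
    (\int[lam]_(x in A) (w (x, t))%:E <= \int[lam]_(x in B) (w (x, t))%:E)%E.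
  by move=> mA mB AB; apply: ge0_subset_integral => // x _; rewrite lee_fin.
split=> [bm|bl] tau tau0 tauT.
- move=> omega [oo co cO]; have [C aC] := bm tau tau0 tauT _ co cO.
  exists C; apply: ae_mono aC => t Ct t0t.
  have /andP[t0 tt] := t0t; have so := subset_trans (@subset_closure _ omega) cO.
  rewrite slice// ?(lt_trans _ tauT) ?lte_fin//; apply: le_trans (Ct t0t).
  apply: mono; [exact: open_rV_measurable|exact: compact_rV_measurable|exact: subset_closure].
- move=> L cL LO; have [omega oc Lo] := compactly_contained_nbhs oO cL LO.
  have [C aC] := bl tau tau0 tauT omega oc; have [oo _ cO] := oc.
  exists C; apply: ae_mono aC => t Ct t0t.
  have /andP[t0 tt] := t0t; have so := subset_trans (@subset_closure _ omega) cO.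
  have := Ct t0t; rewrite slice// ?(lt_trans _ tauT) ?lte_fin//; apply: le_trans.
  by apply: mono => //; [exact: compact_rV_measurable|exact: open_rV_measurable].
Qed.

Lemma finite_dissipationE : finite_dissipation Omega T g <-> Lq_loc_upto0 Omega T q Du.
Proof.
have KE (K : set XT) : (\int[mu]_(p in K) (g p)%:E = \int[mu]_(p in K `&` Q) `|(G p)%:E|)%E.
  rewrite integral_mkcond [RHS]integral_mkcond; apply: eq_integral => p _; rewrite !patchE.
  case: ifPn => [/set_mem Kp|/negP Kp].
    have [Qp|Qp] := pselect (Q p).
      by rewrite mem_set// gE// gee0_abs// lee_fin powR_ge0.
    by rewrite gQ//; case: ifPn => // /set_mem[_ /Qp].
  by case: ifPn => // /set_mem[Kp' _]; case: Kp; exact: mem_set.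
split=> h K cK KQ.
- apply/integrableP; split; last by rewrite -KE; exact: h.
  apply/measurable_EFinP; apply: measurable_funS mG => //; exact: subIsetr.
- by rewrite KE; have /integrableP[] := h K cK KQ.
Qed.

Lemma representativeE v : L1loc_continuous_representative Omega T u v ->
  L1loc_continuous_representative Omega T w v.
Proof.
move=> [vu vc]; split => //.
apply: ae_mono2 vu ae_wu => p vup wup Qp.
by rewrite vup// wup.
Qed.

Lemma Linfty_iff_Lq : Linfty_loc_L1loc Omega T u <-> Lq_loc_upto0 Omega T q Du.
Proof.
rewrite -bounded_massE -finite_dissipationE; split.
- exact: (dissipation_of_bounded_mass oO T0 mw mg md w0 g0 dg wQ gQ dQ iw ig E2).
- exact: (bounded_mass_of_dissipation oO mw mg md w0 g0 dg wQ gQ dQ iw ig E1).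
Qed.

Lemma Linfty_iff_trace v : L1loc_continuous_representative Omega T u v ->
  (Linfty_loc_L1loc Omega T u <-> exists u0, initial_trace Omega v u0).
Proof.
move=> /representativeE vw; rewrite -bounded_massE; split.
- exact: (initial_trace_exists oO T0 mw mg md w0 g0 dg wQ gQ dQ iw ig E1 E2 vw).
- move=> [u0].
  exact: (bounded_mass_of_trace oO mw mg md w0 g0 dg wQ gQ dQ iw ig vw).
Qed.

Lemma trace_formula v u0 tau phi : L1loc_continuous_representative Omega T u v ->
  initial_trace Omega v u0 -> 0 < tau -> (tau%:E < T)%E -> C1c_cylinder0 Omega T phi ->
  \int[lam]_(x in Omega) (v (x, tau) * phi (x, tau)) +
    \int[mu]_(p in cylinder Omega tau%:E)
      (- u p * dt phi p + dotprod (Du p) (grad phi p) + enorm (Du p) `^ q * phi p) =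
  \int[u0]_(x in Omega) phi (x, 0).
Proof.
move=> /representativeE vw tr tau0 tauT C1phi.
have [L [Lphi phiL bnd]] := C1c_cylinder0_test oO T0 C1phi.
have [cL LO dphi Dphi phiS] := Lphi; have [cphi _ _ _] := C1phi.
have [phi0 [Cphi0 phi0L phi0E unif]] := cylinder0_initial_value oO T0 cphi cL LO phiL.
have bm := bounded_mass_of_trace oO mw mg md w0 g0 dg wQ gQ dQ iw ig vw tr.
have fd := dissipation_of_bounded_mass oO T0 mw mg md w0 g0 dg wQ gQ dQ iw ig E2 bm.
have [M M0 HM] := bnd tau tauT.
have cB := compact_box (s := 0) (t := tau) cL.
have [] // := @slab_integrable _ _ _ _ oO w g d mw mg md w0 g0 dg wQ gQ dQ L phi 0 tau M M Lphi HM M0 M0.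
  apply: major_finite => //.
  - exact: compact_xt_measurable.
  - exact: compact_xt_finite.
  - apply: lte_mul_pinfty => //.
    exact: (mass_finite mw w0 wQ bm cL LO tauT).
  - by apply: fd => //; exact: box_cylinder0.
move=> iH _.
have := initial_trace_identity oO mw mg md w0 g0 dg wQ gQ dQ iw ig E1 vw tr Lphi tau0 tauT iH Cphi0 phi0L unif.
have -> : \int[u0]_(x in Omega) phi (x, 0) = \int[u0]_(x in Omega) phi0 x.
  by apply: eq_Rintegral => x /set_mem Ox; rewrite phi0E.
move=> <-; congr (_ + _).
set Ct := cylinder Omega tau%:E.
have CQ : Ct `<=` Q by move=> p [Op p0 pt]; split => //; exact: lt_trans pt tauT.
have mCt : measurable (Ct : set XT).
  by apply: open_xt_measurable; exact: cylinder_open.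
(* The slab is unbounded in space; intersected with Q, off which the jet vanishes, it is the
   cylinder of height tau. *)
have CS : (slab 0 tau `&` Q = Ct :> set XT).
  apply/seteqP; split => [p [/andP[p0 pt] [Op _ _]]|p Cp]; first by split.
  by split; [case: Cp => _ p0 pt; apply/andP|exact: CQ].
rewrite [RHS](_ : _ = \int[mu]_(p in Ct) jet w g d (dt phi) (fun i => dx i phi) phi p); last first.
  rewrite -CS Rintegral_mkcond [RHS]Rintegral_mkcond; apply: eq_Rintegral => p _; rewrite !patchE.
  case: ifPn => [/set_mem Sp|/negP Sp]; last first.
    by case: ifPn => // /set_mem[Sp' _]; case: Sp; exact: mem_set.
  by case: ifPn => // /negP Qp; rewrite (jet_out wQ gQ dQ)// => Qp'; apply: Qp; exact: mem_set.
have mC (f : X * R -> R) : (forall p, Q p -> {for p, continuous f}) -> measurable_fun (Ct : set XT) (f : XT -> R).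
  by move=> cf; apply: measurable_funS CQ _ => //; exact: continuous_measurable_xt.
have m1 := mC _ (Dphi None); have m2 i := mC _ (Dphi (Some i)).
have m3 : measurable_fun (Ct : set XT) (phi : XT -> R).
  by apply: mC => p /dphi; exact: differentiable_continuous.
have mr (f : XT -> R) : measurable_fun Q f -> measurable_fun (Ct : set XT) f.
  exact: measurable_funS.
congr fine; apply: ae_eq_integral => //.
- apply/measurable_EFinP; apply: measurable_funD; last first.
    by apply: measurable_funM => //; exact: mr mG.
  apply: measurable_funD.
    by apply: measurable_funM => //; apply: measurableT_comp => //; exact: mr.
  rewrite /dotprod; apply: measurable_sum => i; apply: measurable_funM; first exact: mr (mD i).
  by have := m2 i; apply: eq_measurable_fun => p _; rewrite /grad mxE.
- apply/measurable_EFinP; apply: measurable_funS CQ _ => //.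
  apply: measurable_funTS; apply: (measurable_jet mQ mw mg md wQ gQ dQ).
  + exact: continuous_measurable_xt oQ (Dphi None).
  + by move=> i; exact: continuous_measurable_xt oQ (Dphi (Some i)).
  + by apply: continuous_measurable_xt => // p /dphi; exact: differentiable_continuous.
- apply: ae_mono ae_wu => p wu Cp /=.
  have Qp := CQ _ Cp; rewrite /jet wu// gE//; congr (_ + _ + _)%:E.
  by rewrite /dotprod; apply: eq_bigr => i _; rewrite dE// /grad mxE.
Qed.

End reduction.

Theorem proposition2p18 (R : realType) (N : nat) (q : R) (T : \bar R)
    (Omega : set 'rV[R]_N)
    (u : 'rV[R]_N * R -> R) (Du : 'rV[R]_N * R -> 'rV[R]_N) :
  (1 <= N)%N -> 1 < q -> (0 < T)%E -> domain Omega ->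
  nonneg_weak_solution Omega T q u Du ->
  (Linfty_loc_L1loc Omega T u <-> Lq_loc_upto0 Omega T q Du) /\
  forall v, L1loc_continuous_representative Omega T u v ->
    (Linfty_loc_L1loc Omega T u <-> exists u0, initial_trace Omega v u0) /\
    forall u0, initial_trace Omega v u0 ->
    forall tau, 0 < tau -> (tau%:E < T)%E ->
    forall phi, C1c_cylinder0 Omega T phi ->
      \int[lebesgue_rV N]_(x in Omega) (v (x, tau) * phi (x, tau)) +
      \int[lebesgue_xt]_(p in cylinder Omega tau%:E)
        (- u p * dt phi p + dotprod (Du p) (grad phi p)
         + enorm (Du p) `^ q * phi p) =
      \int[u0]_(x in Omega) phi (x, 0).
Proof.
move=> _ q1 T0 [oO _ _] sol; split; first exact: Linfty_iff_Lq.
move=> v uv; split; first exact: (Linfty_iff_trace q1 T0 oO sol uv).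
by move=> u0 tr tau tau0 tauT phi C1phi; apply: (trace_formula q1 T0 oO sol uv tr).
Qed.
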